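(* Let $\Sigma=(\mathbb{D},\mathbb{M})$ be a disk with a finite set $\mathbb{M}$ of at least three marked points on its boundary. Then the assignment $l\mapsto \mathbb{I}_{\mathcal{A}}^q(l)=M_{T_l}(\mathbf{w})$ described in the context defines a (canonical) map $\mathbb{I}_{\mathcal{A}}^q:\mathcal{A}_\Sigma(\mathbb{Z}^t)\rightarrow\mathcal{X}_\Sigma^q$ satisfying the following properties: 1. For any choice of ideal triangulation $T$ of $\Sigma$, the element $\mathbb{I}_{\mathcal{A}}^q(l)\in\mathcal{X}_\Sigma^q$ can be written as a Laurent polynomial in the variables $X_j=X_{j;T}$ ($j\in J_T$) with coefficients in $\mathbb{Z}_{\geq0}[q,q^{-1}]$. 2. The expression $\mathbb{I}_{\mathcal{A}}^q(l)$ agrees with the Laurent polynomial $\mathbb{I}_{\mathcal{A}}(l)$ when $q=1$. 3. Let $*$ be the canonical involutive antiautomorphism of $\mathcal{X}_\Sigma^q$ that fixes each $X_j$ and sends $q$ to $q^{-1}$. Then $*\mathbb{I}_{\mathcal{A}}^q(l)=\mathbb{I}_{\mathcal{A}}^q(l)$. 4. For any ideal triangulation $T$, with its internal edges numbered so that $J_T=\{1,\dots,n\}$, the highest term of $\mathbb{I}_{\mathcal{A}}^q(l)$ is $$q^{-\sum_{i<j}\varepsilon_{ij}a_ia_j}X_1^{a_1}\cdots X_n^{a_n},$$ where $X_1^{a_1}\cdots X_n^{a_n}$ is the highest term of the classical expression $\mathbb{I}_{\mathcal{A}}(l)$. 5. For any $l,l'\in\mathcal{A}_\Sigma(\mathbb{Z}^t)$,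 we have $$\mathbb{I}_{\mathcal{A}}^q(l)\,\mathbb{I}_{\mathcal{A}}^q(l')=\sum_{l''\in\mathcal{A}_\Sigma(\mathbb{Z}^t)}c^q(l,l';l'')\,\mathbb{I}_{\mathcal{A}}^q(l'')$$ where $c^q(l,l';l'')\in\mathbb{Z}[q,q^{-1}]$ and only finitely many terms are nonzero.
   Context: **Disk and triangulations.** $\mathbb{D}$ is a compact oriented disk, $\mathbb{M}\subset\partial\mathbb{D}$ is a finite set of at least three marked points. Curves connecting marked points are considered up to homotopy and are noncontractible, so a curve is determined by its two distinct endpoints. An ideal triangulation $T$ of $\Sigma$ is a triangulation of $\mathbb{D}$ with vertex set exactly $\mathbb{M}$. Write $I=I_T$ for its set of edges and $J=J_T\subset I$ for the internal edges (those not lying along $\partial\mathbb{D}$). For $i,j\in I$ sharing a vertex $v$, say $i$ is clockwise to $j$ if $i$ is reached from $j$ by rotating clockwise about $v$ inside $\mathbb{D}$, and immediately clockwise if moreover no other edge of $T$ at $v$ lies between them. Put - $\varepsilon_{ij}=-1$ if $i$ is immediately clockwise to $j$, $\varepsilon_{ij}=1$ if $j$ is immediately clockwise to $i$, $0$ otherwise ($i,j\in I$); - $b_{ij}=-\varepsilon_{ij}$ for $i\in I$, $j\in J$; - $\lambda_{ij}=1$ if $i$ is clockwise to $j$, $-1$ if $j$ is clockwise to $i$, $0$ otherwise ($i,j\in I$); $\Lambda_T$ is the skew-symmetric bilinear form on $\mathbb{Z}^I$ with matrix $(\lambda_{ij})$. One has $\sum_k b_{kj}\lambda_{ki}=4\delta_{ij}$.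 The flip of $T$ at $k\in J$ replaces $k$ by the other diagonal of the quadrilateral formed by the two triangles containing $k$; edges of the flipped triangulation $T'$ are identified with those of $T$, the new edge again being called $k$. Any two ideal triangulations are related by flips. **The skew field $\mathcal{F}$ and the frames $M_T$.** Let $\omega$ be a formal variable, $q=\omega^4$, $[n]_+=\max(0,n)$, $\mathbf{e}_i$ the standard basis vectors. $\mathcal{F}$ is the skew field of fractions of the skein algebra (ambient skew field of the quantum cluster algebra) of $\Sigma$; it carries maps $M_T:\mathbb{Z}^{I_T}\to\mathcal{F}\setminus\{0\}$, one for each ideal triangulation $T$, characterized by: (i) $M_T(v_1)M_T(v_2)=\omega^{-\Lambda_T(v_1,v_2)}M_T(v_1+v_2)$, $M_T(0)=1$, and the $M_T(v)$ form a $\mathbb{Z}[\omega^{\pm1}]$-basis of a quantum torus whose skew field of fractions is $\mathcal{F}$; (ii) if $T'$ is the flip of $T$ at $k$, then $M_{T'}(\mathbf{e}_i)=M_T(\mathbf{e}_i)$ for $i\ne k$ and $M_{T'}(\mathbf{e}_k)=M_T(-\mathbf{e}_k+\sum_i[b_{ik}]_+\mathbf{e}_i)+M_T(-\mathbf{e}_k+\sum_i[-b_{ik}]_+\mathbf{e}_i)$. **The algebra $\mathcal{X}_\Sigma^q$.** For each $T$, let $\mathcal{X}_T^q$ be the quantum torus over $\mathbb{Q}[q,q^{-1}]$ generated by $X_j^{\pm1}$ ($j\in J_T$) with $X_iX_j=q^{2\varepsilon_{ij}}X_jX_i$. $\mathcal{X}_\Sigma^q$ is obtained from the skew fields of fractions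 $\mathrm{Frac}(\mathcal{X}_T^q)$ by identifying, for each flip at $k$, the generators $X'_i$ for $T'$ with: $X_k^{-1}$ if $i=k$; $X_i\prod_{p=0}^{|\varepsilon_{ik}|-1}(1+q^{2p+1}X_k)$ if $i\ne k$, $\varepsilon_{ik}\le0$; $X_iX_k^{\varepsilon_{ik}}\prod_{p=0}^{\varepsilon_{ik}-1}(X_k+q^{2p+1})^{-1}$ if $i\neq k$, $\varepsilon_{ik}\ge0$. It is regarded as a subalgebra of $\mathcal{F}$ via $q=\omega^4$ and $X_{j;T}=M_T(\sum_s\varepsilon_{js}\mathbf{e}_s)$, $j\in J_T$. **Laminations.** An $\mathcal{A}$-lamination is a collection of mutually nonintersecting (in the interior of $\mathbb D$), nonhomotopic curves on $\Sigma$ connecting points of $\mathbb{M}$, each with a nonzero integral weight, such that curves not homotopic to a boundary segment joining adjacent marked points have positive weight, and the total weight of the curves incident to each marked point is zero. $\mathcal{A}_\Sigma(\mathbb{Z}^t)$ is the set of $\mathcal{A}$-laminations up to homotopy. **The map.** Given $l\in\mathcal{A}_\Sigma(\mathbb{Z}^t)$, choose an ideal triangulation $T_l$ such that each curve of $l$ is an edge of $T_l$, and let $\mathbf{w}\in\mathbb{Z}^{I_{T_l}}$ have $i$-th component the weight of the curve at edge $i$ (zero if none). Put $\mathbb{I}_{\mathcal{A}}^q(l)=M_{T_l}(\mathbf{w})\in\mathcal{F}$ (independent of the choice of $T_l$). **The classical map.** Let $A_c$, for each chord or boundary segment $c$ joining two marked points, be the elements of the commutative field $\mathbb{Q}(A_i:i\in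 I_T)$ determined by the Ptolemy relations $A_{pr}A_{st}=A_{ps}A_{rt}+A_{pt}A_{rs}$ for marked points in cyclic order $p,s,r,t$ (i.e. the commutative version, obtained by setting $\omega=1$ and writing $A_i$ for $M_T(\mathbf{e}_i)$, of the flip relation $M_{T'}(\mathbf{e}_k)=M_T(-\mathbf{e}_k+\sum_i[b_{ik}]_+\mathbf{e}_i)+M_T(-\mathbf{e}_k+\sum_i[-b_{ik}]_+\mathbf{e}_i)$ satisfied by the frames $M_T$). Then $\mathbb{I}_{\mathcal{A}}(l)=\prod_c A_c^{w_c}$, where $w_c$ is the weight of $c$ in $l$; it is a Laurent polynomial with nonnegative integer coefficients in the $X_j=\prod_sA_s^{\varepsilon_{js}}$ ($j\in J_T$). **Highest term.** In an expansion $\sum_{\mathbf{d}\in\mathbb{Z}^n}\lambda_{\mathbf{d}}X_1^{d_1}\cdots X_n^{d_n}$, the highest term is the nonzero term with exponent $(a_1,\dots,a_n)$ such that every other nonzero term satisfies $d_j\le a_j$ for all $j$; for $\mathbb{I}_{\mathcal{A}}(l)$ it exists and has coefficient $1$. *)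

(* Defs.v *)
From HB Require Import structures.
From mathcomp Require Import all_boot all_order all_algebra.
From mathcomp Require Import fraction.
From mathcomp Require mpoly.

Set Implicit Arguments.
Unset Strict Implicit.
Unset Printing Implicit Defensive.

Import Order.TTheory GRing.Theory Num.Theory.

Local Open Scope ring_scope.

(* Rational functions over Q in n variables. The notations of mpoly clash     *)
(* with those of monalg.                                                      *)
Module RatFun.
Import mpoly.
Definition field (n : nat) : fieldType := {fraction {mpoly rat[n]}}.
Definition var (n : nat) (i : 'I_n) : field n := tofrac 'X_i.
End RatFun.

From mathcomp Require Import monalg.

(* The disk with m marked points is modelled by the m-gon whose vertices are  *)
(* 'I_m, numbered counterclockwise along the boundary. A curve joining two    *)
(* distinct marked points is, up to homotopy, the pair of its end points,     *)
(* listed in increasing order.                                                *)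

Definition chord (m : nat) : Type := {p : 'I_m * 'I_m | (p.1 < p.2)%N}.

Section Surface.

Variable m : nat.

Implicit Types (c d i j k : chord m) (u v x : 'I_m).

Definition joins c v x : bool := (val c == (v, x)) || (val c == (x, v)).

Definition incident v c : bool := ((val c).1 == v) || ((val c).2 == v).

Definition boundary c : bool :=
  ((val c).2 == (val c).1.+1 :> nat) ||
  (((val c).1 == 0 :> nat) && ((val c).2 == m.-1 :> nat)).

(* c and d meet in the interior of the disk *)
Definition crosses c d : bool :=
  [&& (val c).1 < (val d).1, (val d).1 < (val c).2 & (val c).2 < (val d).2]%N
  || [&& (val d).1 < (val c).1, (val c).1 < (val d).2
       & (val d).2 < (val c).2]%N.

Definition noncrossing (S : {set chord m}) : bool :=
  [forall c in S, forall d in S, ~~ crosses c d].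

Definition triangulation : Type :=
  {T : {set chord m} | maxset noncrossing T}.

(* I_T, and the lattice Z^(I_T) *)
Definition edge (T : triangulation) : Type := {c : chord m | c \in val T}.

Definition lattice (T : triangulation) : Type := {ffun edge T -> int}.

(* J_T *)
Definition internal (T : triangulation) c : bool :=
  (c \in val T) && ~~ boundary c.

(* Position of the vertex x, counted counterclockwise starting from v. Seen   *)
(* from v, the chords to x of smaller offset lie on the clockwise side.       *)
Definition offset v x : nat := ((x + m - v) %% m)%N.

(* i is clockwise to j *)
Definition clockwise i j : bool :=
  [exists v, exists x, exists y,
    [&& joins i v x, joins j v y & (offset v x < offset v y)%N]].

Definition imm_clockwise (T : triangulation) i j : bool :=
  [exists v, exists x, exists y,
    [&& joins i v x, joins j v y, (offset v x < offset v y)%N &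
      ~~ [exists c in val T, exists z,
           joins c v z && (offset v x < offset v z < offset v y)%N]]].

Definition eps (T : triangulation) i j : int :=
  if imm_clockwise T i j then -1 else if imm_clockwise T j i then 1 else 0.

Definition bmat (T : triangulation) i j : int := - eps T i j.

Definition lam i j : int :=
  if clockwise i j then 1 else if clockwise j i then -1 else 0.

Definition Lam (T : triangulation) (v w : lattice T) : int :=
  \sum_(i : edge T) \sum_(j : edge T) v i * lam (val i) (val j) * w j.

(* The restriction to the edges of T of a function on all chords *)
Definition restr (T : triangulation) (f : chord m -> int) : lattice T :=
  [ffun i => f (val i)].

(* The standard basis vector e_c of Z^(I_T) *)
Definition basis (T : triangulation) c : lattice T :=
  restr T (fun i => (i == c)%:R).

(* a, b, c, d are the consecutive sides, and k, k' the diagonals, of a        *)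
(* quadrilateral p s r t inscribed in the disk; k = pr and k' = st.           *)
Definition quadrilateral (a b c d k k' : chord m) : Prop :=
  exists p s r t : 'I_m, [&& (p < s)%N, (s < r)%N & (r < t)%N] /\
    [/\ val a = (p, s), val b = (s, r), val c = (r, t) & val d = (p, t)] /\
    val k = (p, r) /\ val k' = (s, t).

(* T' is the flip of T at k, and k' is the new edge *)
Definition flip (T : triangulation) k (T' : triangulation) k' : Prop :=
  k \in val T /\ val T' = k' |: (val T :\ k) /\
  exists a b c d : chord m,
    [/\ a \in val T, b \in val T, c \in val T & d \in val T] /\
    (quadrilateral a b c d k k' \/ quadrilateral a b c d k' k).

(* w c is the weight of the curve c in the lamination, and 0 when c does not  *)
(* belong to it.                                                              *)
Definition is_lamination (w : {ffun chord m -> int}) : bool :=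
  [&& noncrossing [set c | w c != 0],
      [forall c, (w c != 0) && ~~ boundary c ==> (0 < w c)] &
      [forall v, \sum_(c | incident v c) w c == 0]].

Definition lamination : Type := {w : {ffun chord m -> int} | is_lamination w}.

(* every curve of l is an edge of T *)
Definition carries (T : triangulation) (l : lamination) : Prop :=
  forall c, val l c != 0 -> c \in val T.

(* The entries of e number the internal edges of T. *)
Definition numbering (T : triangulation) n (e : n.-tuple (chord m)) : Prop :=
  uniq e /\ forall c, (c \in e) = internal T c.

End Surface.

(* A Laurent polynomial in one variable with integer coefficients is an       *)
(* element of {malg int[int]}; its coefficient at n is that of the n-th power *)
(* of the variable.                                                           *)
Definition laurent_at (R : unitRingType) (x : R) (f : {malg int[int]}) : R :=
  mmap intr (fun n : int => x ^ n) f.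

Notation expo n := {ffun 'I_n -> int}.

(* X_1^(d_1) ... X_n^(d_n), in this order *)
Definition monomial (R : unitRingType) n (X : 'I_n -> R) (d : expo n) : R :=
  \prod_(i < n) X i ^ d i.

(* Value of a Laurent polynomial with coefficients in Z, resp. Z[q, q^-1] *)
Definition ceval (R : unitRingType) n (X : 'I_n -> R)
    (P : {malg int[expo n]}) : R :=
  mmap intr (monomial X) P.

Definition qeval (R : unitRingType) (q : R) n (X : 'I_n -> R)
    (P : {malg {malg int[int]}[expo n]}) : R :=
  mmap (laurent_at q) (monomial X) P.

Definition is_highest (G : zmodType) n (P : {malg G[expo n]}) (a : expo n) :
    Prop :=
  P@_a != 0 /\ forall d, P@_d != 0 -> forall j, d j <= a j.

Section Quantum.

Variables (m : nat) (F : unitRingType) (omega : F).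
Variable M : forall T : triangulation m, lattice T -> F.

Record quantum_frames : Prop := QuantumFrames {
  skew_field : forall x : F, x != 0 -> x \is a GRing.unit;
  omega_neq0 : omega != 0;
  omega_central : forall x : F, omega * x = x * omega;
  frame_neq0 : forall T (v : lattice T), M v != 0;
  frame0 : forall T, M (0 : lattice T) = 1;
  frameM : forall T (v1 v2 : lattice T),
    M v1 * M v2 = omega ^ (- Lam v1 v2) * M (v1 + v2);
  (* linear independence of the M v over the ring of Laurent polynomials in a *)
  (* formal variable specialised to omega; thus omega is transcendental       *)
  frame_free : forall T (f : {malg {malg int[int]}[lattice T]}),
    mmap (laurent_at omega) (@M T) f = 0 -> f = 0;
  frame_frac : forall T (x : F),
    exists f g : {malg {malg int[int]}[lattice T]},
      mmap (laurent_at omega) (@M T) g != 0 /\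
      x = mmap (laurent_at omega) (@M T) f / mmap (laurent_at omega) (@M T) g;
  frame_flip_old : forall T T' (k k' i : chord m), flip T k T' k' ->
    i \in val T -> i != k -> M (basis T' i) = M (basis T i);
  frame_flip_new : forall T T' (k k' : chord m), flip T k T' k' ->
    M (basis T' k') =
      M (restr T (fun i => Num.max 0 (bmat T i k)) - basis T k) +
      M (restr T (fun i => Num.max 0 (- bmat T i k)) - basis T k)
}.

(* X_(j;T) as an element of F *)
Definition Xq (T : triangulation m) (j : chord m) : F :=
  M (restr T (eps T j)).

Definition q_of : F := omega ^+ 4.

(* The subalgebra X_Sigma^q of F: the skew field generated by the images of   *)
(* the skew fields Frac(X_T^q), T ranging over all ideal triangulations.      *)
Inductive in_Xalg : F -> Prop :=
  | Xalg1 : in_Xalg 1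
  | Xalg_q : in_Xalg q_of
  | Xalg_gen T j : internal T j -> in_Xalg (Xq T j)
  | XalgB x y : in_Xalg x -> in_Xalg y -> in_Xalg (x - y)
  | XalgM x y : in_Xalg x -> in_Xalg y -> in_Xalg (x * y)
  | XalgV x : in_Xalg x -> in_Xalg x^-1.

(* Only the restriction of star to X_Sigma^q is relevant. *)
Record is_star (star : F -> F) : Prop := IsStar {
  star_closed : forall x, in_Xalg x -> in_Xalg (star x);
  star1 : star 1 = 1;
  starD : forall x y, in_Xalg x -> in_Xalg y -> star (x + y) = star x + star y;
  starM : forall x y, in_Xalg x -> in_Xalg y -> star (x * y) = star y * star x;
  starK : forall x, in_Xalg x -> star (star x) = x;
  star_q : star q_of = q_of^-1;
  star_X : forall T j, internal T j -> star (Xq T j) = Xq T j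
}.

(* Iq l is M_T(w) for the triangulations T containing all the curves of l:    *)
(* such a T exists, and the value does not depend on its choice.              *)
Definition is_duality_map (Iq : lamination m -> F) : Prop :=
  forall l : lamination m,
    (exists T, carries T l) /\
    (forall T, carries T l -> Iq l = M (restr T (val l))).

End Quantum.

Notation ratfun T := (RatFun.field #|{: edge T}|).

Section Classical.

Variables (m : nat) (T0 : triangulation m) (A : chord m -> ratfun T0).

Record ptolemy_coordinates : Prop := PtolemyCoordinates {
  ptolemy_var : forall i : edge T0, A (val i) = RatFun.var (enum_rank i);
  ptolemy_rel : forall a b c d k k' : chord m, quadrilateral a b c d k k' ->
    A k * A k' = A a * A c + A d * A b
}.

(* I_A(l) and the classical X_j *)
Definition Icl (l : lamination m) : ratfun T0 := \prod_c A c ^ val l c.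

Definition Xcl (T : triangulation m) (j : chord m) : ratfun T0 :=
  \prod_(s : edge T) A (val s) ^ eps T j (val s).

End Classical.

(* Main.v *)
(* Fix a triangulation T. If a chord c is not in T, resolving it against the  *)
(* first edge of T that it crosses expresses the quantum variable of c by     *)
(* variables of chords that cross fewer edges, up to division by a monomial.  *)
(* By induction it is a sum of terms omega^n M_T(v), and the same exponents v *)
(* expand the classical variable. The pairings Lam(v, e_j) are maximal for a  *)
(* single exponent, where they are given by lam, or by 2 at a crossing: this  *)
(* is a tropical form of the Ptolemy relation. An exponent v of degree 0 at   *)
(* every vertex is the combination of the vectors eps_j with the coefficients *)
(* Lam(v, e_j) / 4, hence M_T(v) is a monomial in the X_j. The antiautomor-   *)
(* phism that inverts omega and fixes all M_T(v) fixes the quantum variables, *)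
(* which normalises the highest coefficient to 1; all other powers of omega   *)
(* are then powers of q. Laminations multiply by resolving crossings in words *)
(* of chord variables.                                                        *)

Require Import Defs.
From HB Require Import structures.
From mathcomp Require Import all_boot all_order all_algebra.
From mathcomp Require Import fraction.
From mathcomp Require mpoly.
From mathcomp Require Import zify ring.

Set Implicit Arguments.
Unset Strict Implicit.
Unset Printing Implicit Defensive.

Import Order.TTheory GRing.Theory Num.Theory.

Local Open Scope ring_scope.

(** Everything is read off from expansions in one triangulation [T]. By [good_Aq], the quantum
    variable of any chord is a sum of terms [omega ^ n * M v] with [4 %| n], with no signs. All its
    exponents [v] have the same degree at every vertex, and one of them dominates the others in
    every pairing with an edge of [T]. The proof is the induction [chord_ind]: a chord outside [T]
    is a diagonal of a quadrilateral whose other diagonal and two of whose sides lie in [T], and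
    whose remaining two sides cross fewer edges. [tropical] tells which of the two Ptolemy summands
    is the larger. Such expansions can be multiplied ([pgood_mul]), so they exist for every [M w]
    whose negative weights sit on the boundary, in particular for laminations ([good_Iq]).

    A lamination has degree 0. In degree 0 the form [Lam] is divisible by 4 and the vectors [epsv]
    span ([zero_degree_expand]), so the terms become monomials in the [X_j] with powers of [q] as
    coefficients ([Iq_expansion]). Positivity, the classical limit and the highest term follow. The
    polynomials involved are unique, because positive sums are kept as lists and equal sums are
    permutations of each other ([terms_inj], [monomials_inj]).

    The antiautomorphism attached to [T] fixes the monomials of all frames ([star_frame]), since the
    quantum Ptolemy relation is invariant under it; this fixes the powers of [omega] in the
    induction. Any other involution with the required properties agrees with it on degree 0
    monomials ([is_star_M]).

    For products, laminations are written as words in chord variables, crossings are resolved until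
    the words are planar ([word_expansion]), and planar words are again laminations
    ([planar_word_Iq]). *)

Module RatFunTheory.
Import mpoly.

(** * Linear independence of monomials in the field of rational functions *)

Section RationalFunctions.

Variable n : nat.

Implicit Types (s t : seq {ffun 'I_n -> nat}) (v : {ffun 'I_n -> nat}).

Let mnm v : 'X_{1..n} := Multinom [tuple v i | i < n].

Let mnmE v i : mnm v i = v i.
Proof. exact: mnmE. Qed.

(** The coefficient of a monomial is the multiplicity of its exponent in the list, and
    characteristic 0 recovers this multiplicity. *)
Lemma var_monomials_inj s t :
  \sum_(v <- s) \prod_(i < n) RatFun.var i ^+ v i =
  \sum_(v <- t) \prod_(i < n) RatFun.var i ^+ v i :> RatFun.field n ->
  perm_eq s t.
Proof.
pose f s' : {mpoly rat[n]} := \sum_(v <- s') 'X_[mnm v].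
have fE s' : \sum_(v <- s') \prod_(i < n) RatFun.var i ^+ v i = tofrac (f s').
  rewrite /f rmorph_sum; apply: eq_bigr => v _ /=.
  rewrite mpolyXE_id rmorph_prod; apply: eq_bigr => i _ /=.
  by rewrite mnmE rmorphXn.
rewrite !fE => /eqP; rewrite tofrac_eq => /eqP e.
apply/allP => u _ /=.
have cE s' : (f s')@_(mnm u) = (count_mem u s')%:R.
  rewrite /f raddf_sum /= -sum1_count natr_sum [RHS]big_mkcond /=.
  apply: eq_bigr => v _; rewrite mcoeffX.
  have -> : (mnm v == mnm u) = (v == u).
    apply/eqP/eqP => [h|->//]; apply/ffunP => i.
    by rewrite -!mnmE h.
  by case: (v == u).
by have := cE s; rewrite e cE => /eqP; rewrite eqr_nat eq_sym.
Qed.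

Lemma var_neq0 (i : 'I_n) : RatFun.var i != 0.
Proof.
rewrite /RatFun.var tofrac_eq0; apply/eqP => e.
have := mcoeffX rat U_(i) U_(i).
by rewrite e mcoeff0 eqxx => /eqP; rewrite eq_sym oner_eq0.
Qed.

End RationalFunctions.

End RatFunTheory.

From mathcomp Require Import monalg.

(** * Chords and orientation *)

(** Cyclic order is stated on natural numbers, so that questions about positions of a few points are
    within reach of [lia]. *)
Definition ccw (a b c : nat) : bool :=
  [|| a < b < c, b < c < a | c < a < b]%N.

Definition xing (a b p q : nat) : bool :=
  (ccw a p b && ccw b q a) || (ccw a q b && ccw b p a).

Section Chords.

Variable m : nat.

Implicit Types (c d i j k : chord m) (u v w x y z p q : 'I_m).

Lemma joinsC c v x : joins c v x = joins c x v.
Proof. by rewrite /joins orbC. Qed.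

Lemma joins_ends c : joins c (val c).1 (val c).2.
Proof. by rewrite /joins -surjective_pairing eqxx. Qed.

Lemma joins_uniq c d v x : joins c v x -> joins d v x -> c = d.
Proof.
have := valP c; have := valP d; rewrite /joins => hd hc.
move=> /orP[] /eqP Ec /orP[] /eqP Ed; move: hd hc; rewrite Ec Ed /= => hd hc;
  by [apply: val_inj; rewrite Ec Ed | move: (ltn_trans hd hc); rewrite ltnn].
Qed.

Lemma joins_neq c v x : joins c v x -> v != x.
Proof.
have := valP c; rewrite /joins => hc.
case/orP=> /eqP E; move: hc; rewrite E /= => h; apply/eqP=> e;
  by move: h; rewrite e ltnn.
Qed.

Lemma chord_ex v x : v != x -> exists c, joins c v x.
Proof.
move=> nvx; case: (ltngtP v x) => [h|h|/val_inj e]; last by rewrite e eqxx in nvx.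
- have h' : ((v, x).1 < (v, x).2)%N by [].
  by exists (exist _ (v, x) h'); rewrite /joins eqxx.
- have h' : ((x, v).1 < (x, v).2)%N by [].
  by exists (exist _ (x, v) h'); rewrite /joins eqxx orbT.
Qed.

Lemma joins_inj c u v x y : joins c u v -> joins c x y ->
  (x = u /\ y = v) \/ (x = v /\ y = u).
Proof.
rewrite /joins => /orP[] /eqP -> /orP[] /eqP [-> ->]; by [left | right].
Qed.

Lemma incidentE c u v x : joins c u v -> incident x c = (x == u) || (x == v).
Proof.
rewrite /joins /incident => /orP[] /eqP -> /=; rewrite ![x == _]eq_sym //.
by rewrite orbC.
Qed.

Lemma crossesE c d a b p q : joins c a b -> joins d p q ->
  crosses c d = xing a b p q.
Proof.
have := valP c; have := valP d; rewrite /joins /crosses /xing /ccw => hd hc.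
by move=> /orP[] /eqP Ec /orP[] /eqP Ed; move: hd hc; rewrite Ec Ed /=; lia.
Qed.

Lemma crossesC c d : crosses c d = crosses d c.
Proof.
rewrite (crossesE (joins_ends c) (joins_ends d)).
by rewrite (crossesE (joins_ends d) (joins_ends c)) /xing /ccw; lia.
Qed.

Lemma crosses_irr c : crosses c c = false.
Proof. by rewrite (crossesE (joins_ends c) (joins_ends c)) /xing /ccw; lia. Qed.

Lemma offsetE v x : offset v x = if (v <= x)%N then (x - v)%N else (x + m - v)%N.
Proof.
rewrite /offset; have := ltn_ord v; have := ltn_ord x; case: ifP => h hx hv.
  have -> : (x + m - v = (x - v) + m)%N by lia.
  by rewrite modnDr modn_small //; lia.
by rewrite modn_small //; lia.
Qed.

Lemma offset_ccw v x y : v != x -> v != y -> (offset v x < offset v y)%N = ccw v x y.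
Proof.
rewrite !offsetE /ccw -!val_eqE /=; have := ltn_ord v.
by have := ltn_ord x; have := ltn_ord y; do 2!case: ifP; lia.
Qed.

Lemma clockwiseP i j : reflect
  (exists v x y, [/\ joins i v x, joins j v y & ccw v x y]) (clockwise i j).
Proof.
apply: (iffP existsP) => -[v].
  case/existsP=> x /existsP[y /and3P[hi hj]].
  by rewrite (offset_ccw (joins_neq hi) (joins_neq hj)) => h; exists v, x, y.
case=> x [y [hi hj h]]; exists v; apply/existsP; exists x; apply/existsP; exists y.
by rewrite hi hj (offset_ccw (joins_neq hi) (joins_neq hj)).
Qed.

(** An arithmetic form of [lam], with one summand for each possible common end. When both ends agree
    the summands vanish, because [o v x x = 0]. *)
Definition lamf (a b p q : nat) : int :=
  let o (v x y : nat) := (ccw v x y)%:Z - (ccw v y x)%:Z in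
  (if a == p then o a b q else 0) + (if a == q then o a b p else 0) +
  (if b == p then o b a q else 0) + (if b == q then o b a p else 0).

Lemma lamE c d a b p q : joins c a b -> joins d p q -> lam c d = lamf a b p q.
Proof.
move=> hc hd; have nab := joins_neq hc; have npq := joins_neq hd.
have cwE c' d' a' b' p' q' : joins c' a' b' -> joins d' p' q' ->
  clockwise c' d' = [|| (a' == p') && ccw a' b' q', (a' == q') && ccw a' b' p',
      (b' == p') && ccw b' a' q' | (b' == q') && ccw b' a' p'].
  move=> hc' hd'; apply/clockwiseP/idP.
    case=> v [x [y [h1 h2 h3]]].
    case: (joins_inj hc' h1) => -[e1 e2]; case: (joins_inj hd' h2) => -[e3 e4];
      subst; move: h3; rewrite /ccw ?eqxx -?val_eqE /=; lia.
  case/or4P=> /andP[/eqP e h]; subst.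
  - by exists p', b', q'.
  - by exists q', b', p'; split=> //; rewrite joinsC.
  - by exists p', a', q'; split=> //; rewrite joinsC.
  - by exists q', a', p'; split=> //; rewrite joinsC.
rewrite /lam (cwE _ _ _ _ _ _ hc hd) (cwE _ _ _ _ _ _ hd hc) /lamf.
have asym (v x y : nat) : ccw v x y -> ccw v y x = false by rewrite /ccw; lia.
have irr (v x : nat) : ccw v x x = false by rewrite /ccw; lia.
have aux (v x y : nat) :
    (if ccw v x y then 1 else if ccw v y x then -1 else 0) =
    (ccw v x y)%:Z - (ccw v y x)%:Z.
  by case h: (ccw v x y); [rewrite (asym _ _ _ h) | case: (ccw v y x)].
have neqF (x y : 'I_m) : x != y -> ((val x == val y) = false) * ((val y == val x) = false).
  by move=> nxy; rewrite (eq_sym (val y)) val_eqE (negbTE nxy).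
have simp := (eqxx, irr, orbF, andbF, addr0, add0r).
rewrite -!val_eqE /=; case: (eqVneq a p) => [?|n1]; first subst p.
  case: (eqVneq b q) => [?|n2]; first by subst q; rewrite !(neqF _ _ nab) /= ?simp.
  by rewrite !(neqF _ _ nab) !(neqF _ _ npq) !(neqF _ _ n2) ?simp /= ?simp aux.
case: (eqVneq a q) => [?|n2]; first subst q.
  case: (eqVneq b p) => [?|n3]; first by subst p; rewrite !(neqF _ _ nab) /= ?simp.
  by rewrite !(neqF _ _ nab) !(neqF _ _ npq) !(neqF _ _ n3) ?simp /= ?simp aux.
case: (eqVneq b p) => [?|n3]; first subst p.
  by rewrite !(neqF _ _ nab) !(neqF _ _ npq) !(neqF _ _ n2) ?simp /= ?simp aux.
case: (eqVneq b q) => [?|n4]; first subst q.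
  by rewrite !(neqF _ _ nab) !(neqF _ _ npq) !(neqF _ _ n1) ?simp /= ?simp aux.
by rewrite !(neqF _ _ n1) !(neqF _ _ n2) !(neqF _ _ n3) !(neqF _ _ n4) ?simp.
Qed.

(** Cyclic order is invariant under rotation. Taking for [u] one of the points moves it to 0 and
    cuts down the later case analyses. *)
Lemma ccw_off u (a b c : 'I_m) : ccw a b c =
  ccw (offset u a) (offset u b) (offset u c).
Proof.
have := ltn_ord u; have := ltn_ord a; have := ltn_ord b; have := ltn_ord c.
by rewrite !offsetE /ccw; do !case: ifP; lia.
Qed.

Lemma xing_off u (a b p q : 'I_m) : xing a b p q =
  xing (offset u a) (offset u b) (offset u p) (offset u q).
Proof. by rewrite /xing -!ccw_off. Qed.

Lemma offsetvv u : offset u u = 0%N.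
Proof. by rewrite offsetE leqnn subnn. Qed.

Lemma offset_eq u (a b : 'I_m) : (offset u a == offset u b) = (a == b).
Proof.
rewrite -val_eqE /= !offsetE; have := ltn_ord u; have := ltn_ord a.
by have := ltn_ord b; do !case: ifP; lia.
Qed.

Lemma offset_gt0 u (a : 'I_m) : (0 < offset u a)%N = (u != a).
Proof. by rewrite lt0n -(offsetvv u) offset_eq eq_sym. Qed.

End Chords.

Lemma ccw0 (a b : nat) : (ccw 0 a b = (0 < a < b)%N) * (ccw a 0 b = (0 < b < a)%N)
  * (ccw a b 0 = (0 < a < b)%N).
Proof. by rewrite /ccw; repeat split; lia. Qed.

Lemma ccw_total (a b c : nat) : a != b -> b != c -> a != c ->
  ~~ ccw a b c -> ccw a c b.
Proof. by rewrite /ccw; lia. Qed.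

Lemma ccw_trans (u a b c : nat) : ccw u a b -> ccw u b c -> ccw u a c.
Proof. by rewrite /ccw; lia. Qed.

Lemma ccw_asym (a b c : nat) : ccw a b c -> ccw c b a = false.
Proof. by rewrite /ccw; lia. Qed.

Lemma ccw_rot (x y z : nat) : ccw x y z = ccw y z x.
Proof. by rewrite /ccw; lia. Qed.

Lemma xingC (a b p q : nat) : xing a b p q = xing p q a b.
Proof. by rewrite /xing /ccw; lia. Qed.

Lemma xingCl (a b p q : nat) : xing a b p q = xing b a p q.
Proof. by rewrite /xing /ccw; lia. Qed.

Lemma xingCr (a b p q : nat) : xing a b p q = xing a b q p.
Proof. by rewrite /xing /ccw; lia. Qed.

Lemma xing_apex (u y z q : nat) : ccw u y z -> xing y z u q ->
  ccw u y q && ccw u q z.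
Proof. by rewrite /xing /ccw; lia. Qed.

(** A chord entering a triangle through one side, and not ending at the opposite corner, leaves
    through another side. *)
Lemma xing_third (u y z p q : nat) : ccw u y z -> p != u -> q != u ->
  xing y z p q -> xing p q u y || xing p q u z.
Proof.
move=> uyz; have aux (p' q' : nat) : q' != u -> ccw y p' z -> ccw z q' y ->
    xing p' q' u y || xing p' q' u z.
  move=> nq ypz zqy; have [h|h] : ccw z q' u \/ ccw u q' y.
  + by move: uyz nq zqy; clear; rewrite /ccw; lia.
  + have [h1 h2] : ccw p' z q' /\ ccw q' u p'.
      by move: h uyz ypz; clear; rewrite /ccw; lia.
    by rewrite /xing h1 h2 !orbT.
  + have [h1 h2] : ccw p' u q' /\ ccw q' y p'.
      by move: h uyz ypz; clear; rewrite /ccw; lia.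
    by rewrite /xing h1 h2.
move=> np nq /orP[] /andP[h1 h2]; first exact: aux.
by rewrite xingCl (xingCl p) aux.
Qed.

(** * Triangulations and flips *)

Section Triangulations.

Variable m : nat.

Implicit Types (T : triangulation m) (c d i j k : chord m).
Implicit Types (a b s t u v w x y z p q : 'I_m).

Lemma noncrossingP (S : {set chord m}) :
  reflect (forall c d, c \in S -> d \in S -> crosses c d = false) (noncrossing S).
Proof.
apply: (iffP forall_inP) => [h c d hc hd | h c hc].
  by have /forall_inP/(_ d hd)/negbTE := h c hc.
by apply/forall_inP => d hd; rewrite h.
Qed.

Lemma tri_ncr T c d : c \in val T -> d \in val T -> crosses c d = false.
Proof. by have /maxsetp/noncrossingP := valP T; apply. Qed.

Lemma tri_max T c : (forall d, d \in val T -> crosses c d = false) -> c \in val T.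
Proof.
move=> h; have /maxsetP[/noncrossingP h1 h2] := valP T.
have <- : c |: val T = val T; last exact: setU11.
apply: h2; last exact: subsetUr.
apply/noncrossingP => d e; rewrite !inE.
case/orP=> [/eqP->|hd] /orP[/eqP->|he]; rewrite ?crosses_irr //; first exact: h.
  by rewrite crossesC h.
exact: h1.
Qed.

Lemma tri_cross T c : c \notin val T -> exists2 d, d \in val T & crosses c d.
Proof.
move=> nc; apply/exists_inP; apply: contraR nc => /exists_inPn h.
by apply: tri_max => d hd; apply/negbTE/h.
Qed.

Lemma tri_ext (S : {set chord m}) :
  noncrossing S -> exists T : triangulation m, S \subset val T.
Proof. by case/maxset_exists=> B hB sB; exists (exist _ B hB). Qed.

Lemma boundaryE c u v : joins c u v -> boundary c =
  [|| v == u.+1 :> nat, u == v.+1 :> nat, (u == 0 :> nat) && (v == m.-1 :> nat) |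
     (v == 0 :> nat) && (u == m.-1 :> nat)].
Proof.
have := valP c; have := ltn_ord u; have := ltn_ord v; rewrite /joins /boundary.
by move=> hu hv hc /orP[] /eqP E; move: hc; rewrite E /=; lia.
Qed.

Lemma boundary_ncr c d : boundary c -> crosses c d = false.
Proof.
rewrite (boundaryE (joins_ends c)) (crossesE (joins_ends c) (joins_ends d)) /xing /ccw.
have := ltn_ord (val d).1; have := ltn_ord (val d).2; have := valP c.
by have := valP d => /=; lia.
Qed.

Lemma boundary_tri T c : boundary c -> c \in val T.
Proof. by move=> h; apply: tri_max => d _; rewrite boundary_ncr. Qed.

Lemma next_vertex v x : v != x -> exists w c,
  [/\ joins c v w, boundary c & forall y, y != v -> y != w -> ccw v w y].
Proof.
rewrite -val_eqE /= => nvx; have hv := ltn_ord v; have hx := ltn_ord x.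
have hw : ((if v.+1 == m then 0 else v.+1) < m)%N by case: ifP; lia.
have nw : v != Ordinal hw by rewrite -val_eqE /=; case: ifP; lia.
have [c hc] := chord_ex nw; exists (Ordinal hw), c; split=> //.
  by rewrite (boundaryE hc) /=; case: ifP; lia.
by move=> y; rewrite -!val_eqE /= /ccw; have := ltn_ord y; case: ifP; lia.
Qed.

Lemma prev_vertex v x : v != x -> exists w c,
  [/\ joins c v w, boundary c & forall y, y != v -> y != w -> ccw v y w].
Proof.
rewrite -val_eqE /= => nvx; have hv := ltn_ord v; have hx := ltn_ord x.
have hw : ((if v == 0 :> nat then m.-1 else v.-1) < m)%N by case: ifP; lia.
have nw : v != Ordinal hw by rewrite -val_eqE /=; case: ifP; lia.
have [c hc] := chord_ex nw; exists (Ordinal hw), c; split=> //.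
  by rewrite (boundaryE hc) /=; case: ifP; lia.
by move=> y; rewrite -!val_eqE /= /ccw; have := ltn_ord y; case: ifP; lia.
Qed.

(** An edge of [T] crossing [yz] would either end at [u], inside the empty angle, or cross one of
    the edges [uy], [uz]. So none does, and maximality puts [yz] in [T]. *)
Lemma third_side T u y z cy cz :
  cy \in val T -> cz \in val T -> joins cy u y -> joins cz u z -> ccw u y z ->
  (forall c w, c \in val T -> joins c u w -> ~~ (ccw u y w && ccw u w z)) ->
  exists2 c, c \in val T & joins c y z.
Proof.
move=> hy hz jy jz uyz gap.
have nyz : y != z by apply: contraTneq uyz => ->; rewrite /ccw; lia.
have [c jc] := chord_ex nyz; exists c => //; apply: contraT => /tri_cross[d hd].
have jd := joins_ends d; move: (val d).1 (val d).2 jd => p q jd.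
have h1 := tri_ncr hd hy; have h2 := tri_ncr hd hz.
have g1 v : joins d u v -> ~~ (ccw u y v && ccw u v z) by exact: gap.
rewrite (crossesE jc jd); case: (eqVneq p u) => [e|np].
  rewrite e in jd *; move/(xing_apex uyz) => h.
  by have := g1 q jd; rewrite h.
case: (eqVneq q u) => [e|nq].
  rewrite e joinsC in jd; rewrite e xingCr => /(xing_apex uyz) h.
  by have := g1 p jd; rewrite h.
move/(xing_third uyz np nq).
by rewrite -(crossesE jd jy) -(crossesE jd jz) h1 h2.
Qed.

End Triangulations.

Lemma argmax_ex (I : finType) (P : pred I) (f : I -> nat) (i0 : I) : P i0 ->
  exists2 i, P i & forall j, P j -> (f j <= f i)%N.
Proof.
by move=> P0; case: (@arg_maxnP I i0 P f P0) => i Pi h; exists i.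
Qed.

Lemma argmin_ex (I : finType) (P : pred I) (f : I -> nat) (i0 : I) : P i0 ->
  exists2 i, P i & forall j, P j -> (f i <= f j)%N.
Proof.
by move=> P0; case: (@arg_minnP I i0 P f P0) => i Pi h; exists i.
Qed.

(** * Triangles adjacent to an edge or entered by a chord *)

Section Neighbours.

Variable m : nat.

Implicit Types (T : triangulation m) (c d i j k : chord m).
Implicit Types (a b s t u v w x y z p q : 'I_m).

(** This is the triangle of [T] on the side of [k] containing [w]. Its apex is the last neighbour of
    [a] before [b]; the angle left between them is empty, so [third_side] applies. *)
Lemma apex T k a b w : k \in val T -> joins k a b -> ccw a w b ->
  exists s ca cb, [/\ ccw a s b, ca \in val T, cb \in val T,
    joins ca a s & joins cb s b].
Proof.
move=> hk jk awb.
pose P s := ccw a s b && [exists c in val T, joins c a s].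
(* The boundary edge at [a] shows that there is a neighbour to start the maximum from. *)
have [x0 [c0 [j0 b0 x0m]]] := next_vertex (joins_neq jk).
have Px0 : P x0.
  apply/andP; split; last by apply/exists_inP; exists c0 => //; exact: boundary_tri.
  case: (eqVneq w x0) => [<-//|nw]; have nwa : w != a.
    by apply: contraTneq awb => ->; rewrite /ccw; lia.
  by have := x0m w nwa nw; move: awb; rewrite /ccw; lia.
have [s /andP[asb /exists_inP[ca hca jca]] smax] := argmax_ex (offset a) Px0.
have [|cb hcb jcb] := third_side hca hk jca jk asb.
  move=> c v hc jc; apply/negP => /andP[asv avb].
  have /smax : P v by rewrite /P avb; apply/exists_inP; exists c.
  by rewrite leqNgt offset_ccw ?asv // (joins_neq jca, joins_neq jc).
by exists s, ca, cb.
Qed.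

(** The chord [c] leaves [u] between two consecutive neighbours [z] and [y], so it enters the
    triangle [uzy] of [T] and leaves it through the opposite edge [k]. *)
Lemma straddle T u w c : c \notin val T -> joins c u w ->
  exists z y cz cy k, [/\ cz \in val T, cy \in val T & k \in val T] /\
    [/\ joins cz u z, joins cy u y & joins k z y] /\
    [/\ ccw u z w, ccw u w y &
      forall d x, d \in val T -> joins d u x -> ~~ (ccw u z x && ccw u x y)].
Proof.
move=> nc jc; have nuw := joins_neq jc; have nT := memPn nc.
have nin d x : d \in val T -> joins d u x -> x != w.
  by move=> /nT nd jd; apply: contra_neq nd => e; apply: joins_uniq jc; rewrite -e.
pose P s := ccw u s w && [exists c in val T, joins c u s].
pose Q s := ccw u w s && [exists c in val T, joins c u s].
have [x0 [c0 [j0 b0 x0m]]] := next_vertex nuw.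
have [x1 [c1 [j1 b1 x1m]]] := prev_vertex nuw.
have t0 := boundary_tri T b0; have t1 := boundary_tri T b1.
have Px0 : P x0.
  apply/andP; split; last by apply/exists_inP; exists c0.
  by rewrite x0m // eq_sym // (nin c0).
have Qx1 : Q x1.
  apply/andP; split; last by apply/exists_inP; exists c1.
  by rewrite x1m // eq_sym // (nin c1).
have [z /andP[uzw /exists_inP[cz hcz jcz]] zmax] := argmax_ex (offset u) Px0.
have [y /andP[uwy /exists_inP[cy hcy jcy]] ymin] := argmin_ex (offset u) Qx1.
have gap d x : d \in val T -> joins d u x -> ~~ (ccw u z x && ccw u x y).
  move=> hd jd; have nxw := nin _ _ hd jd; have nux := joins_neq jd.
  apply/negP => /andP[uzx uxy]; case: (boolP (ccw u x w)) => uxw.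
    have /zmax : P x by rewrite /P uxw; apply/exists_inP; exists d.
    by rewrite leqNgt offset_ccw ?uzx // (joins_neq jcz).
  have uwx : ccw u w x.
    by apply: ccw_total uxw.
  have /ymin : Q x by rewrite /Q uwx; apply/exists_inP; exists d.
  by rewrite leqNgt offset_ccw ?uxy // (joins_neq jcy).
have uzy := ccw_trans uzw uwy.
have [k hk jk] := third_side hcz hcy jcz jcy uzy gap.
by exists z, y, cz, cy, k.
Qed.

End Neighbours.

(** * Quadrilaterals and flips *)

Section Squares.

Variable m : nat.

Implicit Types (T : triangulation m) (c d i j k : chord m).
Implicit Types (a b s t u v w x y z p q : 'I_m).

Definition gap T v x y : Prop :=
  forall c z, c \in val T -> joins c v z -> ~~ (ccw v x z && ccw v z y).

Lemma imm_clockwiseP T i j : reflect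
  (exists v x y, [/\ joins i v x, joins j v y, ccw v x y & gap T v x y])
  (imm_clockwise T i j).
Proof.
apply: (iffP existsP) => -[v].
  case/existsP=> x /existsP[y /and4P[ji jj]].
  rewrite (offset_ccw (joins_neq ji) (joins_neq jj)) => h /exists_inPn g.
  exists v, x, y; split=> // c z hc jc; have := g c hc; apply: contra => hz.
  apply/existsP; exists z; rewrite jc /=.
  by rewrite !offset_ccw // (joins_neq ji, joins_neq jj, joins_neq jc).
case=> x [y [ji jj h g]]; exists v; apply/existsP; exists x; apply/existsP; exists y.
rewrite ji jj (offset_ccw (joins_neq ji) (joins_neq jj)) h /=.
apply/exists_inPn => c hc; apply/existsPn => z; apply/negP => /andP[jc].
rewrite !offset_ccw ?(joins_neq ji, joins_neq jj, joins_neq jc) //.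
by apply/negP; exact: g jc.
Qed.

Lemma triangle_gap T v x y c : c \in val T -> joins c x y -> ccw v x y -> gap T v x y.
Proof.
move=> hc jc vxy d z hd jd; apply/negP => /andP[h1 h2].
have := tri_ncr hc hd; rewrite (crossesE jc jd) /xing => /norP[_ /negP[]].
by move: vxy h1 h2; clear; rewrite /ccw; lia.
Qed.

Lemma gap_uniql T v x s y c d : c \in val T -> d \in val T -> joins c v x -> joins d v s ->
  ccw v x y -> ccw v s y -> gap T v x y -> gap T v s y -> x = s.
Proof.
move=> hc hd jc jd vxy vsy gx gs; apply/eqP; apply: contraT => nxs.
have := gx _ _ hd jd; have := gs _ _ hc jc; rewrite vxy vsy !andbT => n1.
rewrite (ccw_total _ _ _ n1) //; [exact: joins_neq jd | by rewrite eq_sym | exact: joins_neq jc].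
Qed.

Lemma gap_uniqr T v x y s c d : c \in val T -> d \in val T -> joins c v y -> joins d v s ->
  ccw v x y -> ccw v x s -> gap T v x y -> gap T v x s -> y = s.
Proof.
move=> hc hd jc jd vxy vxs gx gs; apply/eqP; apply: contraT => nxs.
have := gx _ _ hd jd; have := gs _ _ hc jc; rewrite vxy vxs /= => n1.
rewrite (ccw_total _ _ _ n1) //; [exact: joins_neq jc | exact: joins_neq jd].
Qed.

(* The vertices a, s, b, t are in counterclockwise order. *)
Definition square T k c1 c2 c3 c4 a s b t : Prop :=
  [/\ joins k a b,
      [/\ joins c1 a s, joins c2 s b, joins c3 b t & joins c4 t a],
      [/\ k \in val T, c1 \in val T, c2 \in val T, c3 \in val T & c4 \in val T] &
      ccw a s b /\ ccw b t a].

Lemma joins_ne c d u v x y : joins c u v -> joins d x y -> u != x -> u != y -> c != d.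
Proof.
move=> jc jd nx ny; apply: contraTneq jd => <-; apply/negP => jd.
by case: (joins_inj jc jd) => -[e1 e2]; move: nx ny; rewrite e1 e2 eqxx.
Qed.

(** At each end of [k] the angles of the two adjacent triangles are empty ([triangle_gap]), so the
    immediate neighbours of [k] are exactly the four sides, with signs alternating around the
    quadrilateral. *)
Lemma eps_square T k c1 c2 c3 c4 a s b t i : square T k c1 c2 c3 c4 a s b t ->
  i \in val T ->
  eps T k i = (i == c1)%:Z - (i == c2)%:Z + (i == c3)%:Z - (i == c4)%:Z.
Proof.
move=> [jk [j1 j2 j3 j4] [hk h1 h2 h3 h4] [asb bta]] hi.
have g1 : gap T a s b := triangle_gap h2 j2 asb.
have g3 : gap T b t a := triangle_gap h4 j4 bta.
have g2 : gap T b a s by apply: triangle_gap h1 j1 _; rewrite ccw_rot.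
have g4 : gap T a b t by apply: triangle_gap h3 j3 _; rewrite ccw_rot.
have j1' : joins c1 s a by rewrite joinsC.
have j2' : joins c2 b s by rewrite joinsC.
have j3' : joins c3 t b by rewrite joinsC.
have j4' : joins c4 a t by rewrite joinsC.
have jk' : joins k b a by rewrite joinsC.
have E1 : imm_clockwise T i k = (i == c1) || (i == c3).
  apply/imm_clockwiseP/orP.
    case=> v [x [y [ji jv vxy g]]].
    case: (joins_inj jk jv) => -[e1 e2]; subst v y; [left | right]; apply/eqP.
      by have e := gap_uniql hi h1 ji j1 vxy asb g g1; rewrite e in ji; exact: (joins_uniq ji j1).
    by have e := gap_uniql hi h3 ji j3 vxy bta g g3; rewrite e in ji; exact: (joins_uniq ji j3).
  by case=> /eqP->; [exists a, s, b | exists b, t, a].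
have E2 : imm_clockwise T k i = (i == c2) || (i == c4).
  apply/imm_clockwiseP/orP.
    case=> v [x [y [jv ji vxy g]]].
    case: (joins_inj jk jv) => -[e1 e2]; subst v x; [right | left]; apply/eqP.
      have abt : ccw a b t by rewrite ccw_rot.
      by have e := gap_uniqr hi h4 ji j4' vxy abt g g4; rewrite e in ji; exact: (joins_uniq ji j4').
    have bas : ccw b a s by rewrite ccw_rot.
    by have e := gap_uniqr hi h2 ji j2' vxy bas g g2; rewrite e in ji; exact: (joins_uniq ji j2').
  by case=> /eqP->; [exists b, a, s | exists a, b, t]; split=> //; rewrite ccw_rot.
have nst : s != t.
  by apply: contraTneq bta => <-; rewrite (ccw_asym asb).
have nas := joins_neq j1; have nsb := joins_neq j2; have nbt := joins_neq j3.
have nta := joins_neq j4; have nab := joins_neq jk.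
have F c d (n : c != d) : ((c == d) = false) * ((d == c) = false).
  by rewrite (eq_sym d) (negbTE n).
have n12 : c1 != c2 by apply: joins_ne j1 j2 _ _.
have n13 : c1 != c3 by apply: joins_ne j1 j3 _ _; rewrite // eq_sym.
have n14 : c1 != c4 by apply: joins_ne j1' j4 _ _; rewrite // eq_sym.
have n23 : c2 != c3 by apply: joins_ne j2 j3 _ _.
have n24 : c2 != c4 by apply: joins_ne j2 j4 _ _; rewrite // eq_sym.
have n34 : c3 != c4 by apply: joins_ne j3 j4 _ _; rewrite // eq_sym.
rewrite /eps E1 E2.
case: (eqVneq i c1) => [->|m1]; first by rewrite !(F _ _ n12, F _ _ n13, F _ _ n14).
case: (eqVneq i c2) => [->|m2]; first by rewrite !(F _ _ n23, F _ _ n24).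
case: (eqVneq i c3) => [->|m3]; first by rewrite !(F _ _ n34).
by case: (eqVneq i c4).
Qed.

Lemma quad_ex T k : internal T k ->
  exists c1 c2 c3 c4 a s b t, square T k c1 c2 c3 c4 a s b t.
Proof.
case/andP=> hk nb; have jk := joins_ends k; have jk' := jk; rewrite joinsC in jk'.
have nk := joins_neq jk; have nk' := nk; rewrite eq_sym in nk'.
move: (val k).1 (val k).2 jk jk' nk nk' => a b jk jk' nk nk'.
have [w [c [jc bc wm]]] := next_vertex nk.
have [w' [c' [jc' bc' wm']]] := next_vertex nk'.
have nbw : b != w by apply: contraNneq nb => e; rewrite (joins_uniq jk (_ : joins c a b)) ?e.
have naw' : a != w' by apply: contraNneq nb => e; rewrite (joins_uniq jk' (_ : joins c' b a)) ?e.
have [s [c1 [c2 [asb h1 h2 j1 j2]]]] := apex hk jk (wm _ nk' nbw).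
have [t [c3 [c4 [bta h3 h4 j3 j4]]]] := apex hk jk' (wm' _ nk naw').
by exists c1, c2, c3, c4, a, s, b, t.
Qed.

(** An end strictly between two consecutive corners would make the chord cross the side joining
    them, since its other end lies beyond [ab]. *)
Lemma square_xing (a s b t p q : nat) : ccw a s b -> ccw b t a ->
  ccw a p b -> ccw b q a -> ~~ xing p q a s -> ~~ xing p q s b ->
  ~~ xing p q b t -> ~~ xing p q t a -> ~~ xing p q s t -> p = s /\ q = t.
Proof.
move=> asb bta apb bqa n1 n2 n3 n4 n5.
have ps : p = s.
  apply/eqP; apply: contraT => nps.
  have [h|h] : ccw a p s \/ ccw s p b by move: asb apb nps; clear; rewrite /ccw; lia.
    by move: n1 h asb bqa; clear; rewrite /xing /ccw; lia.
  by move: n2 h asb bqa; clear; rewrite /xing /ccw; lia.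
split=> //; apply/eqP; apply: contraT => nqt.
have [h|h] : ccw b q t \/ ccw t q a by move: bta bqa nqt; clear; rewrite /ccw; lia.
  by move: n3 h bta apb; clear; rewrite /xing /ccw; lia.
by move: n4 h bta apb; clear; rewrite /xing /ccw; lia.
Qed.

Lemma joins_lt c u v : joins c u v -> (u < v)%N -> val c = (u, v).
Proof.
have := valP c; rewrite /joins => hc /orP[/eqP->//|/eqP e] h.
by move: hc; rewrite e /=; lia.
Qed.

Lemma quad_sorted c1 c2 c3 c4 k k' p s r t : joins c1 p s -> joins c2 s r ->
  joins c3 r t -> joins c4 t p -> joins k p r -> joins k' s t ->
  [&& p < s, s < r & r < t]%N -> quadrilateral c1 c2 c3 c4 k k'.
Proof.
move=> j1 j2 j3 j4 jk jk' /and3P[h1 h2 h3]; exists p, s, r, t; split; first by rewrite h1 h2.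
have h12 := ltn_trans h1 h2; have h23 := ltn_trans h2 h3; have h := ltn_trans h1 h23.
rewrite joinsC in j4.
by rewrite (joins_lt j1) // (joins_lt j2) // (joins_lt j3) // (joins_lt j4) // (joins_lt jk) // (joins_lt jk').
Qed.

(** [quadrilateral] lists its corners in increasing order; the smallest corner decides which of the
    four cyclic readings applies. *)
Lemma quad_cyc c1 c2 c3 c4 k k' a s b t : joins c1 a s -> joins c2 s b ->
  joins c3 b t -> joins c4 t a -> joins k a b -> joins k' s t ->
  ccw a s b -> ccw b t a ->
  quadrilateral c1 c2 c3 c4 k k' \/ quadrilateral c2 c3 c4 c1 k' k \/
  quadrilateral c3 c4 c1 c2 k k' \/ quadrilateral c4 c1 c2 c3 k' k.
Proof.
move=> j1 j2 j3 j4 jk jk' asb bta.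
have jkC := jk; rewrite joinsC in jkC; have jkC' := jk'; rewrite joinsC in jkC'.
have [h|[h|[h|h]]] : [&& a < s, s < b & b < t]%N \/ [&& s < b, b < t & t < a]%N \/
    [&& b < t, t < a & a < s]%N \/ [&& t < a, a < s & s < b]%N.
- by move: asb bta; clear; rewrite /ccw; lia.
- by left; apply: quad_sorted h.
- by right; left; apply: quad_sorted h.
- by right; right; left; apply: quad_sorted h.
- by right; right; right; apply: quad_sorted h.
Qed.

(** The new set is maximal because a chord other than [k'] that avoids the sides and crosses one
    diagonal crosses the other: a chord compatible with the new set is [k'] or compatible with
    [T]. *)
Lemma flip_ex T k k' c1 c2 c3 c4 a s b t : square T k c1 c2 c3 c4 a s b t ->
  joins k' s t -> exists T' : triangulation m, [/\ val T' = k' |: (val T :\ k),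
    flip T k T' k' & square T' k' c2 c3 c4 c1 s b t a].
Proof.
move=> [jk [j1 j2 j3 j4] [hk h1 h2 h3 h4] [asb bta]] jk'.
have kk' : crosses k' k.
  by rewrite (crossesE jk' jk) /xing; move: asb bta; clear; rewrite /ccw; lia.
have nkk' : k' != k by apply: contraTneq kk' => ->; rewrite crosses_irr.
have nas := joins_neq j1; have nsb := joins_neq j2; have nbt := joins_neq j3.
have nta := joins_neq j4; have nab := joins_neq jk.
have nsa := nas; rewrite eq_sym in nsa; have ntb := nbt; rewrite eq_sym in ntb.
have j1' := j1; rewrite joinsC in j1'; have j3' := j3; rewrite joinsC in j3'.
pose R := k' |: (val T :\ k).
have hR d : d \in val T -> d != k -> d \in R by move=> hd nd; rewrite !inE nd hd orbT.
have R1 : c1 \in R by apply: hR => //; apply: (joins_ne j1' jk nsa nsb).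
have R2 : c2 \in R by apply: hR => //; apply: (joins_ne j2 jk nsa nsb).
have R3 : c3 \in R by apply: hR => //; apply: (joins_ne j3' jk nta ntb).
have R4 : c4 \in R by apply: hR => //; apply: (joins_ne j4 jk nta ntb).
have crk' d p q : joins d p q -> ccw a p b -> ccw b q a -> crosses d c1 = false ->
    crosses d c2 = false -> crosses d c3 = false -> crosses d c4 = false ->
    d != k' -> crosses d k'.
  move=> jd apb bqa; rewrite (crossesE jd j1) (crossesE jd j2) (crossesE jd j3).
  rewrite (crossesE jd j4) (crossesE jd jk') => /negbT n1 /negbT n2 /negbT n3 /negbT n4 nd.
  apply: contraNT nd => n5.
  have [/val_inj ps /val_inj qt] := square_xing asb bta apb bqa n1 n2 n3 n4 n5.
  by rewrite ps qt in jd; rewrite (joins_uniq jd jk').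
have crk d : crosses d k -> crosses d c1 = false ->
    crosses d c2 = false -> crosses d c3 = false -> crosses d c4 = false ->
    d != k' -> crosses d k'.
  have jd := joins_ends d; have jd' := jd; rewrite joinsC in jd'.
  rewrite crossesC (crossesE jk jd) => /orP[] /andP[]; first exact: crk' jd.
  exact: crk' jd'.
have maxR : maxset (@noncrossing m) R.
  apply/maxsetP; split.
    (* The same argument with the diagonals exchanged: an edge of [T] meeting [k'] either meets [k]
       as well or joins [a] and [b]. *)
    have ncr d : d \in val T -> d != k -> crosses d k' = false.
      move=> hd nd; apply/negbTE/negP => h.
      have h' : crosses d k.
        move: h (tri_ncr hd h1) (tri_ncr hd h2) (tri_ncr hd h3) (tri_ncr hd h4).
        have jd := joins_ends d; move: (val d).1 (val d).2 jd => p q jd.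
        rewrite (crossesE jd j1) (crossesE jd j2) (crossesE jd j3).
        rewrite (crossesE jd j4) (crossesE jd jk') (crossesE jd jk).
        move=> h /negbT n1 /negbT n2 /negbT n3 /negbT n4; apply: contraT => n5.
        have sbt : ccw s b t by move: asb bta; clear; rewrite /ccw; lia.
        have tas : ccw t a s by move: asb bta; clear; rewrite /ccw; lia.
        rewrite xingCr in n5.
        have [[e1 e2]|[e1 e2]] : (p = b :> nat /\ q = a :> nat) \/ (q = b :> nat /\ p = a :> nat).
          move: h; rewrite xingC => /orP[] /andP[u1 u2]; [left | right].
            by apply: (square_xing sbt tas u1 u2); rewrite // xingCr.
          apply: (square_xing sbt tas u1 u2); by rewrite // xingCl // xingCr.
          move/val_inj: e1 => e1; move/val_inj: e2 => e2.
          by case/negP: nd; apply/eqP; apply: (joins_uniq _ jk); rewrite joinsC -e1 -e2.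
        move/val_inj: e1 => e1; move/val_inj: e2 => e2.
        by case/negP: nd; apply/eqP; apply: (joins_uniq _ jk); rewrite -e1 -e2.
      by rewrite (tri_ncr hd hk) in h'.
    apply/noncrossingP => d e; rewrite !inE.
    case/orP=> [/eqP->|/andP[nd hd]] /orP[/eqP->|/andP[ne he]].
    - exact: crosses_irr.
    - by rewrite crossesC ncr.
    - exact: ncr.
    - exact: tri_ncr hd he.
  move=> B /noncrossingP hB sB; apply/eqP; rewrite eqEsubset sB andbT.
  apply/subsetP=> e he; have nR d : d \in R -> crosses e d = false.
    by move=> hd; apply: hB => //; exact: (subsetP sB).
  rewrite !inE; case: (eqVneq e k') => [//|ne] /=.
  have Rk' : k' \in R by rewrite !inE eqxx.
  have nek : e != k by apply: contraTneq kk' => e1; rewrite -e1 crossesC nR.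
  have nek' : crosses e k = false.
    apply/negbTE/negP => h; have := nR _ Rk'.
    by rewrite (crk _ h (nR _ R1) (nR _ R2) (nR _ R3) (nR _ R4) ne).
  rewrite nek /=; apply: tri_max => d hd.
  by case: (eqVneq d k) => [-> //|ndk]; apply: nR; apply: hR.
exists (exist _ R maxR); split=> //.
- split=> //; split=> //.
  have := quad_cyc j1 j2 j3 j4 jk jk' asb bta.
  case=> [|[|[|]]] h; [exists c1, c2, c3, c4 | exists c2, c3, c4, c1 |
    exists c3, c4, c1, c2 | exists c4, c1, c2, c3]; split=> //; by [left | right].
- split=> //; first by split=> //; rewrite !inE eqxx.
  by split; move: asb bta; clear; rewrite /ccw; lia.
Qed.

End Squares.

(** * Induction on crossings, and connectedness by flips around a fixed chord *)

Section Induction.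

Variable m : nat.

Implicit Types (T : triangulation m) (c d i j k : chord m).
Implicit Types (a b s t u v w x y z p q : 'I_m).

(** A chord crossing [zx] but not [zy] cuts off the corner [x], so it separates [x] from [u]. *)
Lemma xing_subl (u z x y p q : nat) : ccw z x y -> ccw y u z ->
  xing z x p q -> ~~ xing z y p q -> xing x u p q.
Proof.
move=> h1 h2; have aux (p' q' : nat) : ccw z p' x -> ccw x q' z -> ~~ xing z y p' q' ->
    ccw x q' u && ccw u p' x.
  by move: h1 h2; clear; rewrite /xing /ccw; lia.
case/orP=> /andP[h3 h4] h5; rewrite /xing; first by rewrite (aux p q) ?orbT.
by rewrite (aux q p) // xingCr.
Qed.

Lemma xing_subr (u z x y p q : nat) : ccw z x y -> ccw y u z ->
  xing x y p q -> ~~ xing z y p q -> xing x u p q.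
Proof.
move=> h1 h2; have aux (p' q' : nat) : ccw x p' y -> ccw y q' x -> ~~ xing z y p' q' ->
    ccw x p' u && ccw u q' x.
  by move: h1 h2; clear; rewrite /xing /ccw; lia.
case/orP=> /andP[h3 h4] h5; rewrite /xing; first by rewrite (aux p q).
by rewrite (aux q p) ?orbT // xingCr.
Qed.

(** Induction on the number of edges of [T] crossed by [c]. The triangle [uzy] comes from
    [straddle]; the sides [zx] and [xy] cross only edges that [c] crosses, by [xing_subl] and
    [xing_subr]. *)
Lemma chord_ind T (P : chord m -> Prop) :
  (forall c, c \in val T -> P c) ->
  (forall c k czx cxy cyu cuz z x y u, c \notin val T ->
     joins k z y -> joins czx z x -> joins cxy x y -> joins cyu y u ->
     joins cuz u z -> joins c x u -> ccw z x y -> ccw y u z ->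
     k \in val T -> cyu \in val T -> cuz \in val T ->
     P czx -> P cxy -> P c) ->
  forall c, P c.
Proof.
move=> P0 Pstep c; have [n] := ubnP #|[set d in val T | crosses c d]|.
elim: n => // n IH in c *; case: (boolP (c \in val T)) => [/P0//|nc] hn.
have := joins_ends c; move: (val c).1 (val c).2 => x u jc.
have jc' := jc; rewrite joinsC in jc'.
have [z [y [cz [cy [k [[hz hy hk] [[jz jy jk] [uzx uxy _]]]]]]]] := straddle nc jc'.
have zxy : ccw z x y by move: uzx uxy; clear; rewrite /ccw; lia.
have yuz : ccw y u z by move: uzx uxy; clear; rewrite /ccw; lia.
have nzx : z != x by apply: contraTneq uzx => ->; clear; rewrite /ccw; lia.
have nxy : x != y by apply: contraTneq uxy => ->; clear; rewrite /ccw; lia.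
have [czx jzx] := chord_ex nzx; have [cxy jxy] := chord_ex nxy.
(* The edge [k] is crossed by [c] but by neither side, so the count drops strictly. *)
have ck : crosses c k.
  by rewrite (crossesE jc jk) xingC /xing zxy yuz.
have jzu := jz; rewrite joinsC in jzu; have jyu := jy; rewrite joinsC in jyu.
have dec d : crosses d k = false ->
    (forall e, e \in val T -> crosses d e -> crosses c e) -> P d.
  move=> dk sub; apply: IH; rewrite -ltnS; apply: leq_trans hn; rewrite ltnS.
  apply/proper_card/properP; split.
    by apply/subsetP => e; rewrite !inE => /andP[he /(sub _ he) ->]; rewrite he.
  by exists k; rewrite !inE hk ?ck // dk.
have nk e : e \in val T -> ~~ xing z y (val e).1 (val e).2.
  by move=> he; rewrite -(crossesE jk (joins_ends e)) (tri_ncr hk he).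
apply: (Pstep c k czx cxy cy cz z x y u) => //.
- apply: dec; first by rewrite (crossesE jzx jk) /xing; clear; rewrite /ccw; lia.
  move=> e he; rewrite (crossesE jzx (joins_ends e)) (crossesE jc (joins_ends e)) => h.
  exact: xing_subl zxy yuz h (nk e he).
- apply: dec; first by rewrite (crossesE jxy jk) /xing; clear; rewrite /ccw; lia.
  move=> e he; rewrite (crossesE jxy (joins_ends e)) (crossesE jc (joins_ends e)) => h.
  exact: xing_subr zxy yuz h (nk e he).
Qed.

(** A chord that crosses an edge away from [u] has an end separated from [u] by this edge; the chord
    from [u] to that end belongs to the fan and would cross the edge too. *)
Lemma fan_eq u T T' :
  (forall c, incident u c -> c \in val T) -> (forall c, incident u c -> c \in val T') ->
  T = T'.
Proof.
have sub : forall S S' : triangulation m, (forall c, incident u c -> c \in val S) ->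
    (forall c, incident u c -> c \in val S') -> val S \subset val S'.
  move=> S S' h h'; apply/subsetP => c hc.
  case: (boolP (incident u c)) => [/h'//|nu].
  have := joins_ends c; move: (val c).1 (val c).2 => a b jc.
  rewrite (incidentE _ jc) negb_or in nu; case/andP: nu => nua nub.
  apply: contraT => /tri_cross[d hd cd].
  have := joins_ends d; move: (val d).1 (val d).2 => p q jd.
  have sep w : xing a b w u -> false.
    move=> abwu; have nuw : u != w.
      by apply: contraTneq abwu => ->; clear; rewrite /xing /ccw; lia.
    have [e je] := chord_ex nuw.
    have := tri_ncr hc (h e _); rewrite (incidentE _ je) eqxx => /(_ isT).
    by rewrite (crossesE jc je) xingCr abwu.
  move: cd; rewrite (crossesE jc jd) => abpq; have [/sep//|/sep//] : xing a b p u \/ xing a b q u.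
  have nab := joins_neq jc; move: abpq; rewrite /xing.
  case: (boolP (ccw a u b)) => [_|/ccw_total bua] /=.
    by case/orP=> /andP[h1 h2]; [right | left]; rewrite h2 orbT.
  have -> : ccw b u a by rewrite -ccw_rot bua // eq_sym.
  by case/orP=> /andP[h1 h2]; [left | right]; rewrite h1.
move=> h h'; apply: val_inj; apply/eqP; rewrite eqEsubset.
by rewrite (sub T T') ?(sub T' T).
Qed.

(* A triangulation containing c can be moved to the fan at u by flips that     *)
(* increase the degree of u, hence never flip an edge at u.                   *)
Lemma fan_connected (V : Type) (f : triangulation m -> V) c u : incident u c ->
  (forall T k T' k', flip T k T' k' -> c \in val T -> c != k -> f T = f T') ->
  forall T T', c \in val T -> c \in val T' -> f T = f T'.
Proof.
move=> uc fE; have fan T : c \in val T -> exists T1 : triangulation m,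
    f T = f T1 /\ forall d, incident u d -> d \in val T1.
  have [n] := ubnP #|[set d : chord m | incident u d & d \notin val T]|.
  elim: n => // n IH in T * => hn hc.
  case: (boolP [forall d, incident u d ==> (d \in val T)]) => [/forall_inP h|].
    by exists T.
  rewrite negb_forall_in => /exists_inP[d ud nd].
  have [w jd] : exists w, joins d u w.
    move: ud; rewrite (incidentE _ (joins_ends d)) => /orP[] /eqP->.
      by exists (val d).2; exact: joins_ends.
    by exists (val d).1; rewrite joinsC joins_ends.
  (* In the triangle entered by the missing chord [d], the side [k] faces [u]; the diagonal
     replacing it therefore ends at [u]. *)
  have [z [y [cz [cy [k [[hz hy hk] [[jz jy jk] [uzw uwy gp]]]]]]]] := straddle nd jd.
  have zwy : ccw z w y by move: uzw uwy; clear; rewrite /ccw; lia.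
  have [s [c1 [c2 [zsy h1 h2 j1 j2]]]] := apex hk jk zwy.
  have yuz : ccw y u z by move: uzw uwy; clear; rewrite /ccw; lia.
  have sq : square T k c1 c2 cy cz z s y u by split=> //; split=> //; rewrite joinsC.
  have usn : s != u by apply: contraTneq zsy => ->; move: yuz; clear; rewrite /ccw; lia.
  have [k' jk'] := chord_ex usn.
  have [T' [eT' fl _]] := flip_ex sq jk'.
  have nuk : ~~ incident u k.
    rewrite (incidentE _ jk) negb_or; apply/andP; split.
      by apply: contraTneq yuz => ->; clear; rewrite /ccw; lia.
    by apply: contraTneq yuz => ->; clear; rewrite /ccw; lia.
  have uk' : incident u k' by rewrite (incidentE _ jk') eqxx orbT.
  have nck : c != k by apply: contraNneq nuk => <-.
  have nk' : k' \notin val T.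
    by apply/negP => /(tri_ncr hk); rewrite (crossesE jk jk') /xing zsy yuz.
  have [|| T1 [e1 h1']] := IH T'.
  - rewrite -ltnS; apply: leq_trans hn; rewrite ltnS; apply/proper_card/properP; split.
      apply/subsetP => e; rewrite !inE eT' !inE => /andP[ue]; rewrite negb_or negb_and ue.
      case/andP=> _ /orP[/negPn/eqP ek|->//].
      by rewrite ek (negbTE nuk) in ue.
    by exists k'; rewrite !inE uk' ?nk' // eT' !inE eqxx.
  - by rewrite eT' !inE nck hc orbT.
  by exists T1; rewrite (fE T k T' k').
move=> T T' hT hT'; have [T1 [-> h1]] := fan T hT; have [T2 [-> h2]] := fan T' hT'.
by rewrite (fan_eq h1 h2).
Qed.

End Induction.

(** * Signs of crossings *)

Section Signs.

(* The value 2 at a crossing makes the tropical Ptolemy relation below hold.  *)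
Definition lampf (a b p q : nat) : int := if xing a b p q then 2 else lamf a b p q.

(* The position of v with respect to the chord joining 0 and q. *)
Let side (q v : nat) : int := (q < v)%N%:Z - (0 < v < q)%N%:Z.
Let tip (q v : nat) : int := (v == q)%:Z - (v == 0%N)%:Z.

Lemma xing_signs (a b q : nat) :
  xing a b 0 q = ((0 < a < q) && (q < b) || (0 < b < q) && (q < a))%N.
Proof. by rewrite /xing !ccw0 /ccw; lia. Qed.

Lemma side_cases (q v : nat) : (0 < q)%N ->
  [\/ [/\ v = 0%N, side q v = 0 & tip q v = -1],
      [/\ (0 < v < q)%N, side q v = -1 & tip q v = 0],
      [/\ v = q, side q v = 0 & tip q v = 1] |
      [/\ (q < v)%N, side q v = 1 & tip q v = 0]].
Proof.
move=> q0; rewrite /side /tip; have [v0|vq|vq|vq] :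
    [\/ v = 0%N, (0 < v < q)%N, v = q | (q < v)%N].
  by case: (ltngtP v q) => h; case: (posnP v) => h'; [apply: Or41 | apply: Or42 |
    apply: Or44 | apply: Or44 | apply: Or43 | apply: Or43]; lia.
- by apply: Or41; split; lia.
- by apply: Or42; split; lia.
- by apply: Or43; split; lia.
- by apply: Or44; split; lia.
Qed.

(** This product form reduces the identities below to a finite check on the positions of the corners
    relative to 0 and [q]. *)
Lemma lamf_signs (a b q : nat) : (0 < q)%N ->
  lamf a b 0 q = tip q a * side q b + tip q b * side q a.
Proof.
move=> q0; have o0 v : (ccw 0 v q)%:Z - (ccw 0 q v)%:Z = - side q v.
  by rewrite !ccw0 /side q0 opprB.
have oq v : (ccw q v 0)%:Z - (ccw q 0 v)%:Z = side q v.
  by rewrite !ccw0 /side q0.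
have E (u w v : nat) (x : int) : ((ccw w v q)%:Z - (ccw w q v)%:Z = x) ->
    (if u == w then (ccw u v q)%:Z - (ccw u q v)%:Z else 0) = (u == w)%:Z * x.
  by move=> <-; case: eqP => [->|_]; rewrite ?mul1r ?mul0r.
have E' (u w v : nat) (x : int) : ((ccw w v 0)%:Z - (ccw w 0 v)%:Z = x) ->
    (if u == w then (ccw u v 0)%:Z - (ccw u 0 v)%:Z else 0) = (u == w)%:Z * x.
  by move=> <-; case: eqP => [->|_]; rewrite ?mul1r ?mul0r.
rewrite /lamf (E _ _ _ _ (o0 b)) (E' _ _ _ _ (oq b)) (E _ _ _ _ (o0 a)) (E' _ _ _ _ (oq a)).
by rewrite /tip; ring.
Qed.

(** Only [s] is free to lie across the chord [0q], which does not cross the triangle [abt]. The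
    Ptolemy summand containing [as] and [bt] is therefore maximal whatever [q] is, and the other one
    falls short by at least 4 when the chord is [ab] itself. *)
Lemma tropical0 (a s b t q : nat) : ccw a s b -> ccw b t a -> (0 < q)%N ->
  ~~ xing b t 0 q -> ~~ xing t a 0 q -> ~~ xing a b 0 q ->
  lampf s t 0 q = lamf b t 0 q - lamf a b 0 q + lampf a s 0 q /\
  lamf t a 0 q - lamf a b 0 q + lampf s b 0 q <=
    lampf s t 0 q - (if (a == 0%N) && (b == q) || (a == q) && (b == 0%N) then 4 else 0).
Proof.
move=> asb bta q0 n1 n2 n3.
have [nas nsb nbt nta [nab nst]] :
    [/\ a != s, s != b, b != t, t != a & a != b /\ s != t].
  by move: asb bta; clear; rewrite /ccw => *; split; try split; lia.
rewrite /lampf !lamf_signs //; move: n1 n2 n3; rewrite !xing_signs.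
case: (side_cases a q0) => -[ha -> ->]; case: (side_cases b q0) => -[hb -> ->];
  case: (side_cases t q0) => -[ht -> ->]; move=> n1 n2 n3;
  try (by exfalso; move: n1 n2 n3 ha hb ht nab nbt nta; clear; lia);
  case: (side_cases s q0) => -[hs -> ->];
  try (by exfalso; move: ha hb ht hs nas nsb nst asb bta q0; clear; rewrite /ccw; lia).
all: move: ha hb ht hs q0; clear => ha hb ht hs q0;
  by split; do !case: ifP => ?; move: ha hb ht hs q0; lia.
Qed.

(** This is the compatibility of the exchange matrix with [lam], which makes their product 4 times
    the identity, read on one quadrilateral. *)
Lemma dual0 (a s b t q : nat) : ccw a s b -> ccw b t a -> (0 < q)%N ->
  ~~ xing a s 0 q -> ~~ xing s b 0 q ->
  ~~ xing b t 0 q -> ~~ xing t a 0 q -> ~~ xing a b 0 q ->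
  lamf a s 0 q - lamf s b 0 q + lamf b t 0 q - lamf t a 0 q =
  if (a == 0%N) && (b == q) || (a == q) && (b == 0%N) then 4 else 0.
Proof.
move=> asb bta q0 n4 n5 n1 n2 n3.
have [nas nsb nbt nta [nab nst]] :
    [/\ a != s, s != b, b != t, t != a & a != b /\ s != t].
  by move: asb bta; clear; rewrite /ccw => *; split; try split; lia.
rewrite !lamf_signs //; move: n1 n2 n3 n4 n5; rewrite !xing_signs.
case: (side_cases a q0) => -[ha -> ->]; case: (side_cases b q0) => -[hb -> ->];
  case: (side_cases t q0) => -[ht -> ->]; move=> n1 n2 n3 n4 n5;
  try (by exfalso; move: n1 n2 n3 ha hb ht nab nbt nta; clear; lia);
  case: (side_cases s q0) => -[hs -> ->];
  try (by exfalso; move: n4 n5 ha hb ht hs nas nsb nst asb bta q0; clear; rewrite /ccw; lia).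
all: move: ha hb ht hs q0; clear => ha hb ht hs q0;
  by case: ifP => ?; move: ha hb ht hs q0; lia.
Qed.

End Signs.

Section Tropical.

Variable m : nat.

Implicit Types (T : triangulation m) (c d i j k : chord m).
Implicit Types (a b s t u v w x y z p q : 'I_m).

(* The largest pairing with e_d of an exponent of the variable of c, when d    *)
(* is an edge of the triangulation in which that variable is expanded.        *)
Definition lamp c d : int := if crosses c d then 2 else lam c d.

Lemma lamf_off u a b p q : lamf a b p q =
  lamf (offset u a) (offset u b) (offset u p) (offset u q).
Proof. by rewrite /lamf -!ccw_off !offset_eq. Qed.

Lemma lampE c d a b p q : joins c a b -> joins d p q -> lamp c d = lampf a b p q.
Proof. by move=> jc jd; rewrite /lamp /lampf (crossesE jc jd) (lamE jc jd). Qed.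

Lemma lamC c d : lam c d = - lam d c.
Proof.
have := joins_ends c; have := joins_ends d.
move: (val c).1 (val c).2 (val d).1 (val d).2 => a b p q jd jc.
rewrite (lamE jc jd) (lamE jd jc) /lamf.
have E (u v w x : nat) : (if u == x then (ccw u v w)%:Z - (ccw u w v)%:Z else 0) =
    - (if x == u then (ccw x w v)%:Z - (ccw x v w)%:Z else 0).
  by rewrite eq_sym; case: eqP => [->|_]; rewrite ?opprB ?oppr0.
rewrite (E a b q p) (E a b p q) (E b a q p) (E b a p q) !opprD -!addrA.
by congr (_ + _); rewrite addrCA.
Qed.

Lemma joins_eq c d a b p q : joins c a b -> joins d p q ->
  (c == d) = (a == p) && (b == q) || (a == q) && (b == p).
Proof.
move=> jc jd; apply/eqP/idP => [e|].
  by subst d; case: (joins_inj jc jd) => -[-> ->]; rewrite !eqxx ?orbT.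
case/orP=> /andP[/eqP e1 /eqP e2]; subst; first exact: joins_uniq jc jd.
by apply: joins_uniq jd; rewrite joinsC.
Qed.

Lemma tropical k k' c1 c2 c3 c4 a s b t j :
  joins k a b -> joins k' s t -> joins c1 a s -> joins c2 s b -> joins c3 b t ->
  joins c4 t a -> ccw a s b -> ccw b t a ->
  crosses c3 j = false -> crosses c4 j = false -> crosses k j = false ->
  lamp k' j = lam c3 j - lam k j + lamp c1 j /\
  lam c4 j - lam k j + lamp c2 j <= lamp k' j - (if k == j then 4 else 0).
Proof.
have jj := joins_ends j; move: (val j).1 (val j).2 jj => p q jj.
move=> jk jk' j1 j2 j3 j4; rewrite (lamE j3 jj) (lamE jk jj) (lamE j4 jj).
rewrite (lampE j1 jj) (lampE j2 jj) (lampE jk' jj).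
rewrite (crossesE j3 jj) (crossesE j4 jj) (crossesE jk jj) (joins_eq jk jj).
have nq := joins_neq jj; rewrite -(offset_gt0 p) in nq.
rewrite /lampf !(lamf_off p) !(xing_off p) !(ccw_off p) -!(offset_eq p) offsetvv.
by move=> asb bta /negbT n1 /negbT n2 /negbT n3; exact: tropical0.
Qed.

Lemma dual T k c1 c2 c3 c4 a s b t j : square T k c1 c2 c3 c4 a s b t ->
  j \in val T ->
  lam c1 j - lam c2 j + lam c3 j - lam c4 j = if k == j then 4 else 0.
Proof.
have jj := joins_ends j; move: (val j).1 (val j).2 jj => p q jj.
move=> [jk [j1 j2 j3 j4] [hk h1 h2 h3 h4] [asb bta]] hj.
have := tri_ncr hk hj; have := tri_ncr h1 hj; have := tri_ncr h2 hj.
have := tri_ncr h3 hj; have := tri_ncr h4 hj; move: asb bta.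
rewrite (lamE j1 jj) (lamE j2 jj) (lamE j3 jj) (lamE j4 jj) (joins_eq jk jj).
rewrite (crossesE j1 jj) (crossesE j2 jj) (crossesE j3 jj) (crossesE j4 jj) (crossesE jk jj).
have nq := joins_neq jj; rewrite -(offset_gt0 p) in nq.
rewrite !(lamf_off p) !(xing_off p) !(ccw_off p) -!(offset_eq p) offsetvv.
move=> asb bta /negbT n4 /negbT n3 /negbT n2 /negbT n1 /negbT n5; exact: dual0.
Qed.

End Tropical.

(** * The lattice of a triangulation *)

Section Lattice.

Variables (m : nat) (T : triangulation m).

Implicit Types (c d i j k : chord m) (u v w : lattice T).
Implicit Types (F G : chord m -> int) (x y p q r s : 'I_m).

Definition wsum v F : int := \sum_(i : edge T) v i * F (val i).

Lemma wsumDl u v F : wsum (u + v) F = wsum u F + wsum v F.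
Proof. by rewrite -big_split; apply: eq_bigr => i _; rewrite ffunE mulrDl. Qed.

Lemma wsumNl v F : wsum (- v) F = - wsum v F.
Proof. by rewrite -sumrN; apply: eq_bigr => i _; rewrite ffunE mulNr. Qed.

Lemma wsum0l F : wsum 0 F = 0.
Proof. by apply: big1 => i _; rewrite ffunE mul0r. Qed.

Lemma wsumBl u v F : wsum (u - v) F = wsum u F - wsum v F.
Proof. by rewrite wsumDl wsumNl. Qed.

Lemma wsumMnl v n F : wsum (v *+ n) F = wsum v F *+ n.
Proof. by elim: n => [|n IH]; rewrite ?mulr0n ?wsum0l // !mulrS wsumDl IH. Qed.

Lemma wsumMzl v n F : wsum (v *~ n) F = n * wsum v F.
Proof.
case: n => n; first by rewrite -pmulrn wsumMnl -mulr_natl natz.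
by rewrite NegzE mulrNz wsumNl -pmulrn wsumMnl mulNr -mulr_natl natz.
Qed.

Lemma wsum_suml (I : Type) (e : seq I) (P : pred I) (V : I -> lattice T) F :
  wsum (\sum_(i <- e | P i) V i) F = \sum_(i <- e | P i) wsum (V i) F.
Proof. exact: (big_morph (wsum ^~ F) (fun u v => wsumDl u v F) (wsum0l F)). Qed.

Lemma eq_wsum v F G : (forall c, c \in val T -> F c = G c) -> wsum v F = wsum v G.
Proof. by move=> E; apply: eq_bigr => i _; rewrite E ?(valP i). Qed.

Lemma wsumDr v F G : wsum v (fun c => F c + G c) = wsum v F + wsum v G.
Proof. by rewrite -big_split; apply: eq_bigr => i _; rewrite mulrDr. Qed.

Lemma wsumMr v n F : wsum v (fun c => n * F c) = n * wsum v F.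
Proof. by rewrite /wsum mulr_sumr; apply: eq_bigr => i _; rewrite mulrCA. Qed.

Lemma wsum_sumr v (I : Type) (e : seq I) (P : pred I) (FF : I -> chord m -> int) :
  wsum v (fun c => \sum_(i <- e | P i) FF i c) = \sum_(i <- e | P i) wsum v (FF i).
Proof. by rewrite exchange_big; apply: eq_bigr => i _; rewrite mulr_sumr. Qed.

Lemma wsum_restr f F : wsum (restr T f) F = \sum_(c in val T) f c * F c.
Proof.
rewrite (big_sub (mem (val T)) (fun c => f c * F c)).
by apply: eq_bigr => i _; rewrite ffunE.
Qed.

Lemma wsum_basis c F : c \in val T -> wsum (basis T c) F = F c.
Proof.
move=> hc; rewrite wsum_restr (bigD1 c) //= eqxx mul1r big1 ?addr0 // => d /andP[_ /negbTE->].
by rewrite mul0r.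
Qed.

Lemma lattice_expand v : v = \sum_(i : edge T) basis T (val i) *~ v i.
Proof.
apply/ffunP => j; rewrite sum_ffunE (bigD1 j) //= big1 => [|i nij].
  by rewrite addr0 ffunMzE ffunE eqxx intz.
by rewrite ffunMzE ffunE val_eqE eq_sym (negbTE nij) mul0rz.
Qed.

Definition vdeg v x : int := wsum v (fun c => (incident x c)%:Z).

Definition pair v d : int := wsum v (fun c => lam c d).

Lemma LamE v w : Lam v w = wsum w (pair v).
Proof.
rewrite /Lam exchange_big; apply: eq_bigr => j _; rewrite mulr_sumr.
by apply: eq_bigr => i _; rewrite mulrC.
Qed.

Lemma LamC v w : Lam v w = - Lam w v.
Proof.
rewrite /Lam exchange_big -sumrN; apply: eq_bigr => j _; rewrite -sumrN.
by apply: eq_bigr => i _; rewrite lamC; ring.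
Qed.

Lemma LamDr u v w : Lam u (v + w) = Lam u v + Lam u w.
Proof. by rewrite !LamE wsumDl. Qed.

Lemma LamDl u v w : Lam (u + v) w = Lam u w + Lam v w.
Proof. by rewrite LamC LamDr opprD -!LamC. Qed.

Lemma LamNr u v : Lam u (- v) = - Lam u v.
Proof. by rewrite !LamE wsumNl. Qed.

Lemma LamNl u v : Lam (- u) v = - Lam u v.
Proof. by rewrite LamC LamNr -LamC. Qed.

Lemma Lamvv u : Lam u u = 0.
Proof. by have := LamC u u; move: (Lam u u) => z; clear; lia. Qed.

Lemma LamMzr u v n : Lam u (v *~ n) = n * Lam u v.
Proof. by rewrite !LamE wsumMzl. Qed.

Lemma LamMzl u v n : Lam (u *~ n) v = n * Lam u v.
Proof. by rewrite LamC LamMzr -mulrN -LamC. Qed.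

Lemma Lam_basisr v c : c \in val T -> Lam v (basis T c) = pair v c.
Proof. by move=> hc; rewrite LamE wsum_basis. Qed.

Definition epsv k : lattice T := restr T (eps T k).

Lemma wsum_epsv k c1 c2 c3 c4 a s b t F : square T k c1 c2 c3 c4 a s b t ->
  wsum (epsv k) F = F c1 - F c2 + F c3 - F c4.
Proof.
move=> sq; have [_ _ [_ h1 h2 h3 h4] _] := sq; rewrite wsum_restr.
have E c : c \in val T -> \sum_(i in val T) (i == c)%:Z * F i = F c.
  move=> hc; rewrite (bigD1 c) //= eqxx mul1r big1 ?addr0 // => d /andP[_ /negbTE->].
  by rewrite mul0r.
rewrite -(E _ h1) -(E _ h2) -(E _ h3) -(E _ h4) -!sumrN -!big_split /=.
by apply: eq_bigr => i hi; rewrite (eps_square sq hi) !mulrDl !mulNr.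
Qed.

Lemma pair_epsv k j : internal T k -> j \in val T ->
  pair (epsv k) j = if k == j then 4 else 0.
Proof.
case/quad_ex => c1 [c2 [c3 [c4 [a [s [b [t sq]]]]]]] hj.
by rewrite /pair (wsum_epsv _ sq) (dual sq hj).
Qed.

Lemma vdeg_epsv k x : internal T k -> vdeg (epsv k) x = 0.
Proof.
case/quad_ex => c1 [c2 [c3 [c4 [a [s [b [t sq]]]]]]].
rewrite /vdeg (wsum_epsv _ sq); case: sq => _ [j1 j2 j3 j4] _ _.
rewrite (incidentE _ j1) (incidentE _ j2) (incidentE _ j3) (incidentE _ j4).
have E (y z : 'I_m) : y != z -> ((x == y) || (x == z))%:Z = (x == y)%:Z + (x == z)%:Z :> int.
  by move=> n; case: (eqVneq x y) => [->|]; rewrite ?(negbTE n).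
by rewrite !E ?(joins_neq j1, joins_neq j2, joins_neq j3, joins_neq j4) //; ring.
Qed.

End Lattice.

(** * Vectors of degree zero: divisibility by 4 *)

Section ZeroDegree.

Variables (m : nat) (T : triangulation m).

Implicit Types (c d i j k : chord m) (v : lattice T) (F : chord m -> int).
Implicit Types (x y p q r s t : 'I_m).

(** For chords that do not cross, [c] lies under [j], on the side away from the boundary edge
    joining the first and the last marked point. *)
Definition within c j : bool :=
  ((val j).1 <= (val c).1)%N && ((val c).2 <= (val j).2)%N.

Lemma lamf_sides (a b p q : nat) :
  let f (v : nat) := (ccw p q v)%:Z - (ccw p v q)%:Z in
  lamf a b p q = ((a == q)%:Z - (a == p)%:Z) * f b + ((b == q)%:Z - (b == p)%:Z) * f a.
Proof.
move=> f; have E (u w v : nat) (x : int) : ((ccw w v q)%:Z - (ccw w q v)%:Z = x) ->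
    (if u == w then (ccw u v q)%:Z - (ccw u q v)%:Z else 0) = (u == w)%:Z * x.
  by move=> <-; case: eqP => [->|_]; rewrite ?mul1r ?mul0r.
have E' (u w v : nat) (x : int) : ((ccw w v p)%:Z - (ccw w p v)%:Z = x) ->
    (if u == w then (ccw u v p)%:Z - (ccw u p v)%:Z else 0) = (u == w)%:Z * x.
  by move=> <-; case: eqP => [->|_]; rewrite ?mul1r ?mul0r.
have fp (v : nat) : (ccw p v q)%:Z - (ccw p q v)%:Z = - f v by rewrite opprB.
have fq (v : nat) : (ccw q v p)%:Z - (ccw q p v)%:Z = f v.
  by rewrite -(ccw_rot p q v) (ccw_rot q p v).
rewrite /lamf (E _ _ _ _ (fp b)) (E' _ _ _ _ (fq b)) (E _ _ _ _ (fp a)) (E' _ _ _ _ (fq a)).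
by ring.
Qed.

Lemma lam_within c j : crosses c j = false ->
  lam c j = ((incident (val j).1 c)%:Z - (incident (val j).2 c)%:Z) * ((within c j)%:Z *+ 2 - 1).
Proof.
rewrite (lamE (joins_ends c) (joins_ends j)) /incident /within /crosses.
have := valP c; have := valP j; rewrite -!val_eqE /=.
move: (nat_of_ord (val c).1) (nat_of_ord (val c).2) => a b.
move: (nat_of_ord (val j).1) (nat_of_ord (val j).2) => p q.
move=> pq ab ncr; rewrite lamf_sides; move: ncr; rewrite /ccw pq.
rewrite (ltnNge q p) (ltnW pq) /=.
case: (ltngtP a p) => hap; case: (ltngtP a q) => haq;
case: (ltngtP b p) => hbp; case: (ltngtP b q) => hbq;
try (by exfalso; move: pq ab hap haq hbp hbq; clear; lia).
all: try by [].
Qed.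

Definition inner v j : int := wsum v (fun c => (within c j)%:Z).

Definition inner_at v x j : int :=
  wsum v (fun c => (incident x c)%:Z * (within c j)%:Z).

Lemma sum_incident c : \sum_x (incident x c)%:Z = 2 :> int.
Proof.
have n := joins_neq (joins_ends c).
rewrite (bigD1 (val c).1) // (bigD1 (val c).2) ?(eq_sym _ (val c).1) //=.
rewrite /incident !eqxx orbT big1 // => x /andP[n1 n2].
by rewrite ![_ == x]eq_sym (negbTE n1) (negbTE n2).
Qed.

Hypothesis hm : (3 <= m)%N.

(** Count the ends of the edges under [j] in two ways. At a vertex strictly under [j] all edges lie
    under [j], so the total is the degree, which is 0; vertices outside contribute nothing; only the
    two ends of [j] remain. *)
Lemma inner_ends v j : (forall x, vdeg v x = 0) -> j \in val T ->
  inner_at v (val j).1 j + inner_at v (val j).2 j = 2 * inner v j.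
Proof.
move=> hv hj; have n := joins_neq (joins_ends j).
have <- : \sum_x inner_at v x j = 2 * inner v j.
  rewrite -wsum_sumr -wsumMr; apply: eq_wsum => c hc.
  by rewrite -mulr_suml sum_incident.
rewrite (bigD1 (val j).1) // (bigD1 (val j).2) ?(eq_sym _ (val j).1) //= addrA.
rewrite [X in _ = _ + X]big1 ?addr0 // => x /andP[n1 n2].
have [xin|xout] := boolP ((val j).1 < x < (val j).2)%N.
  rewrite -(hv x); apply: eq_wsum => c hc.
  have [xc|] := boolP (incident x c); last by rewrite mul0r.
  suff -> : within c j by rewrite mulr1.
  move: (tri_ncr hc hj) xc xin; rewrite /crosses /within /incident -!val_eqE /=.
  by have := valP c; move: (val c) (val j) => [a b] [p q] /=; clear; lia.
rewrite /inner_at -(wsum0l T (fun=> 0)) /wsum big1 ?big1 // => i _; rewrite ?mulr0 //.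
have [xc|] := boolP (incident x (val i)); last by rewrite mul0r mulr0.
suff -> : within (val i) j = false by rewrite !mulr0.
move: {i}(val i) xc => c xc.
have := valP c; move: xc xout n1 n2; rewrite /within /incident -!val_eqE.
by move: (val c).1 (val c).2 (val j).1 (val j).2 => a b p q; rewrite /=; clear; lia.
Qed.

Lemma pair_inner v j : (forall x, vdeg v x = 0) -> j \in val T ->
  pair v j = 4 * (inner_at v (val j).1 j - inner v j).
Proof.
move=> hv hj; have e := inner_ends hv hj.
(* This is [lam_within] multiplied out; the degrees come from its term [- 1]. *)
have -> : pair v j = 2 * inner_at v (val j).1 j + (-2) * inner_at v (val j).2 j +
    (-1) * vdeg v (val j).1 + vdeg v (val j).2.
  rewrite /inner_at /vdeg -!wsumMr -!wsumDr; apply: eq_wsum => c hc.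
  by rewrite (lam_within (tri_ncr hc hj)); ring.
by rewrite !hv; move: e; clear; lia.
Qed.

(** In the triangle [psr] hanging under [j], an edge under [j] is [j] itself or lies under exactly
    one of the two lower sides. *)
Lemma inner_split p s r j j1 j2 (F : chord m -> int) v : j \in val T -> j1 \in val T ->
  j2 \in val T -> val j = (p, r) -> val j1 = (p, s) -> val j2 = (s, r) ->
  wsum v (fun c => F c * (within c j)%:Z) =
  wsum v (fun c => F c * (c == j)%:Z) + wsum v (fun c => F c * (within c j1)%:Z) +
  wsum v (fun c => F c * (within c j2)%:Z).
Proof.
move=> hj h1 h2 ej e1 e2; rewrite -!wsumDr; apply: eq_wsum => c hc.
rewrite -!mulrDr; congr (_ * _).
move: (tri_ncr hc h1) (tri_ncr hc h2); rewrite -val_eqE /crosses /within ej e1 e2.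
have := valP c; have := valP j1; have := valP j2; rewrite e1 e2.
case: (val c) => a b; rewrite xpair_eqE -!val_eqE /=.
move: (nat_of_ord a) (nat_of_ord b) (nat_of_ord p) (nat_of_ord r) (nat_of_ord s).
by clear => *; lia.
Qed.

End ZeroDegree.

(** * Vectors of degree zero: nondegeneracy and a basis *)

Section Nondegenerate.

Variables (m : nat) (T : triangulation m).

Implicit Types (c d i j k : chord m) (v : lattice T) (F : chord m -> int).
Implicit Types (x y p q r s t : 'I_m).

Hypothesis hm : (3 <= m)%N.

Definition coef v j : int := wsum v (fun c => (c == j)%:Z).

Lemma coefE v (i : edge T) : coef v (val i) = v i.
Proof.
rewrite /coef /wsum (bigD1 i) //= eqxx mulr1 big1 ?addr0 // => j.
by rewrite -val_eqE => /negbTE->; rewrite mulr0.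
Qed.

Lemma coef_mul v F j : wsum v (fun c => F c * (c == j)%:Z) = F j * coef v j.
Proof.
rewrite -wsumMr; apply: eq_wsum => c _.
by case: (eqVneq c j) => [->|_]; rewrite ?mulr0.
Qed.

(** When all pairings vanish, the ends of an edge carry the same weight as everything under it.
    Splitting [j] with the weights 1, incidence to [p] and incidence to [r] gives three linear
    equations, whose solution is the claim. *)
Lemma inner_triangle v p s r j j1 j2 : j \in val T -> j1 \in val T ->
  j2 \in val T -> val j = (p, r) -> val j1 = (p, s) -> val j2 = (s, r) ->
  (forall x, vdeg v x = 0) -> (forall j, j \in val T -> pair v j = 0) ->
  [/\ inner v j1 = 0, inner v j2 = 0 & inner v j = coef v j].
Proof.
move=> hj h1 h2 ej e1 e2 hv hp.
have ps : (p < s)%N by have := valP j1; rewrite e1.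
have sr : (s < r)%N by have := valP j2; rewrite e2.
have I i : i \in val T -> inner_at v (val i).1 i = inner v i /\
    inner_at v (val i).2 i = inner v i.
  move=> hi; have := pair_inner hv hi; have := inner_ends hv hi; rewrite (hp _ hi).
  by clear; lia.
have sp F := inner_split F v hj h1 h2 ej e1 e2.
have := sp (fun=> 1); have := sp (fun c => (incident p c)%:Z).
have := sp (fun c => (incident r c)%:Z); rewrite !coef_mul.
have [A1 B1] := I _ h1; have [A2 B2] := I _ h2; have [A B] := I _ hj.
have one i : wsum v (fun c => 1 * (within c i)%:Z) = inner v i.
  by apply: eq_wsum => c _; rewrite mul1r.
have z0 x i : (x < (val i).1)%N || ((val i).2 < x)%N ->
    wsum v (fun c => (incident x c)%:Z * (within c i)%:Z) = 0.
  move=> out; rewrite -[RHS](mul0r (wsum v (fun=> 0))) -wsumMr; apply: eq_wsum => c _.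
  rewrite mul0r; have := valP c; move: out; rewrite /incident /within -!val_eqE.
  move: (val c).1 (val c).2 (val i).1 (val i).2 => a b a' b' /=.
  clear => out ab; case: (boolP ((a' <= a)%N && (b <= b')%N)) => h; last by rewrite mulr0.
  by suff -> : (a == x :> nat) || (b == x :> nat) = false by []; lia.
rewrite !one (z0 p j2) ?e2 /= ?ps // (z0 r j1) ?e1 /= ?sr ?orbT //.
move: A B A1 B1 A2 B2; rewrite /inner_at ej e1 e2 /= => -> -> -> _ _ ->.
have -> : (incident p j)%:Z = 1 by rewrite /incident ej /= eqxx.
have -> : (incident r j)%:Z = 1 by rewrite /incident ej /= eqxx orbT.
by clear => *; split; lia.
Qed.

(** Every edge other than the one joining the first and last marked points is a lower side of the
    triangle above it, so [inner_triangle] applies. For the exceptional edge, all edges lie under it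
    and the weight at an end is a degree. *)
Lemma inner0 v j : (forall x, vdeg v x = 0) ->
  (forall j, j \in val T -> pair v j = 0) -> j \in val T -> inner v j = 0.
Proof.
move=> hv hp hj; have jj := joins_ends j; rewrite joinsC in jj.
have := valP j; case ej : (val j) jj => [p r] /= jj pr.
have [/andP[/eqP p0 /eqP rm]|out] := boolP ((p == 0 :> nat) && (r == m.-1 :> nat)).
  have [e1 e2] := (pair_inner hv hj, inner_ends hv hj).
  have : inner_at v (val j).1 j = vdeg v (val j).1.
    apply: eq_wsum => c _; suff -> : within c j by rewrite mulr1.
    have := ltn_ord (val c).2; rewrite /within ej /= p0 rm; clear; lia.
  by move: e1; rewrite hp // hv; clear; lia.
have [w rwp] : exists w : 'I_m, ccw r w p.
  have h0 : (0 < m)%N by apply: ltn_trans hm.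
  have h1 : (m.-1 < m)%N by rewrite prednK.
  have rm := ltn_ord r; have [p0|p0] := posnP p.
    by exists (Ordinal h1); move: out pr rm; rewrite /ccw /= p0; clear; lia.
  by exists (Ordinal h0); move: out pr rm; rewrite /ccw /=; move: p0; clear; lia.
have [t [ca [cb [rtp ha hb ja jb]]]] := apex hj jj rwp.
have [rt|tp] : (r < t)%N \/ (t < p)%N by move: rtp pr; rewrite /ccw; clear; lia.
  have pt := ltn_trans pr rt; rewrite joinsC in jb.
  by have [-> _ _] := inner_triangle hb hj ha (joins_lt jb pt) ej (joins_lt ja rt) hv hp.
have tr := ltn_trans tp pr; rewrite joinsC in ja.
by have [_ -> _] := inner_triangle ha hb hj (joins_lt ja tr) (joins_lt jb tp) ej hv hp.
Qed.

(** A coefficient equals the weight under its edge, which is 0 by [inner0]: use the triangle below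
    the edge, or observe that nothing else lies under an edge joining consecutive points. *)
Lemma pair_nondegenerate v : (forall x, vdeg v x = 0) ->
  (forall j, j \in val T -> pair v j = 0) -> v = 0.
Proof.
move=> hv hp; apply/ffunP => i; rewrite ffunE -coefE.
have hi := valP i; move: (val i) hi => {i} j hj.
have e := inner0 hv hp hj; have jj := joins_ends j.
have := valP j; case ej : (val j) jj => [p r] /= jj pr.
have [rp|rp] := eqVneq (r : nat) p.+1.
  rewrite -e; apply: eq_wsum => c _; congr (_%:Z); rewrite -val_eqE /within ej.
  have := valP c; rewrite [X in X == _]surjective_pairing xpair_eqE -!val_eqE; move: (val c).1 (val c).2 => a b /=.
  by move: rp pr; clear; lia.
have hw : (p.+1 < m)%N by apply: leq_ltn_trans pr (ltn_ord r).
have pwr : ccw p (Ordinal hw) r by move: rp pr; rewrite /ccw /=; clear; lia.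
have [s [ca [cb [psr ha hb ja jb]]]] := apex hj jj pwr.
have /andP[ps sr] : (p < s < r)%N by move: psr pr; rewrite /ccw; clear; lia.
by have [_ _ <-] := inner_triangle hj ha hb ej (joins_lt ja ps) (joins_lt jb sr) hv hp.
Qed.

Lemma pair_boundary v j : (forall x, vdeg v x = 0) -> boundary j -> pair v j = 0.
Proof.
move=> hv bj; have hj := boundary_tri T bj; rewrite (pair_inner hv hj).
suff -> : inner_at v (val j).1 j = inner v j by rewrite subrr mulr0.
case/orP: (bj) => [/eqP e|/andP[/eqP e1 /eqP e2]].
  apply: eq_wsum => c _; have := valP c; rewrite /incident /within -!val_eqE.
  move: e; move: (val c).1 (val c).2 (val j).1 (val j).2 => a b p q /=; clear => e ab.
  case h : ((p <= a)%N && (b <= q)%N); last by rewrite mulr0.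
  by suff -> : a == p :> nat by []; lia.
have W c : within c j.
  by have := ltn_ord (val c).2; rewrite /within e1 e2; clear; lia.
have E x : inner_at v x j = vdeg v x by apply: eq_wsum => c _; rewrite W mulr1.
by have := inner_ends hv hj; rewrite !E !hv; clear; lia.
Qed.

Lemma pair_dvd4 v j : (forall x, vdeg v x = 0) -> j \in val T -> (4 %| pair v j)%Z.
Proof. by move=> hv hj; rewrite (pair_inner hv hj) dvdz_mulr. Qed.

(** Both sides have degree 0 and the same pairings: 4 times the coefficient at internal edges by
    [pair_epsv], and 0 at boundary edges. Nondegeneracy concludes. *)
Lemma zero_degree_expand n (e : n.-tuple (chord m)) v : numbering T e ->
  (forall x, vdeg v x = 0) ->
  v = \sum_(i < n) epsv T (tnth e i) *~ (pair v (tnth e i) %/ 4)%Z.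
Proof.
move=> [ue he] hv; have int_e (i : 'I_n) : internal T (tnth e i) by rewrite -he mem_tnth.
apply/eqP; rewrite -subr_eq0; apply/eqP.
have dE x : vdeg (v - \sum_(i < n) epsv T (tnth e i) *~ (pair v (tnth e i) %/ 4)%Z) x = 0.
  rewrite /vdeg wsumBl wsum_suml big1 ?subr0; first exact: (hv x).
  move=> i _.
  by rewrite wsumMzl; have := vdeg_epsv x (int_e i); rewrite /vdeg => ->; rewrite mulr0.
apply: pair_nondegenerate => // j hj.
have [bj|nbj] := boolP (boundary j); first exact: pair_boundary.
have : j \in e by rewrite he /internal hj.
case/tnthP=> l el; rewrite /pair wsumBl wsum_suml (bigD1 l) //= big1 => [|i nil].
  have := pair_epsv (int_e l) hj; rewrite /pair wsumMzl -el eqxx => ->.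
  by rewrite addr0 divzK ?subrr //; exact: pair_dvd4.
have := pair_epsv (int_e i) hj; rewrite /pair wsumMzl => ->.
by rewrite el (inj_eq (elimT (tuple_uniqP e) ue)) (negbTE nil) mulr0.
Qed.

End Nondegenerate.

(** * Polynomials as lists of terms *)

Section PositivePolynomials.

Variable K : choiceType.

(** A list with repetitions encodes a polynomial with nonnegative coefficients; nothing cancels, so
    equality of polynomials is equality up to permutation. *)
Definition cpoly (s : seq K) : {malg int[K]} := \sum_(k <- s) << k >>.

Definition lpoly (s : seq (int * K)) : {malg {malg int[int]}[K]} :=
  \sum_(p <- s) << << p.1 >> *g p.2 >>.

Lemma cpolyE (s : seq K) k : (cpoly s)@_k = (count_mem k s)%:R.
Proof.
elim: s => [|k' s IH]; first by rewrite /cpoly big_nil mcoeff0.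
by rewrite /cpoly big_cons mcoeffD IH mcoeffU /= natrD.
Qed.

Lemma lpolyE (s : seq (int * K)) n k : (lpoly s)@_k@_n = (count_mem (n, k) s)%:R.
Proof.
elim: s => [|[n' k'] s IH]; first by rewrite /lpoly big_nil !mcoeff0.
rewrite /lpoly big_cons !mcoeffD IH mcoeffU /= xpair_eqE natrD; congr (_ + _).
case: (eqVneq k' k) => _ /=; last by rewrite andbF mulr0n mcoeff0.
by rewrite andbT mulr1n mcoeffU.
Qed.

Lemma perm_cpoly (s t : seq K) : perm_eq s t -> cpoly s = cpoly t.
Proof. exact: perm_big. Qed.

Lemma perm_lpoly (s t : seq (int * K)) : perm_eq s t -> lpoly s = lpoly t.
Proof. exact: perm_big. Qed.

Lemma cpoly_split (f : {malg int[K]}) : exists s t, f = cpoly s - cpoly t.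
Proof.
rewrite [f]monalgE; elim: (finmap.enum_fset _) => [|k e [s [t IH]]].
  by exists [::], [::]; rewrite /cpoly !big_nil subrr.
rewrite big_cons IH.
have nE (z : nat) : << z%:Z *g k >> = cpoly (nseq z k).
  elim: z => [|z IHz]; first by rewrite /cpoly big_nil monalgU0.
  by rewrite intS monalgUD IHz /= /cpoly big_cons.
case: (f@_k) => z.
  by exists (nseq z k ++ s), t; rewrite nE /cpoly big_cat /= addrA.
exists s, (nseq z.+1 k ++ t); rewrite NegzE monalgUN nE /cpoly big_cat /= opprD.
by rewrite addrCA.
Qed.

End PositivePolynomials.

Lemma lpoly_split (K : choiceType) (f : {malg {malg int[int]}[K]}) :
  exists s t, f = lpoly s - lpoly t.
Proof.
rewrite [f]monalgE; elim: (finmap.enum_fset _) => [|k e [s [t IH]]].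
  by exists [::], [::]; rewrite /lpoly !big_nil subrr.
rewrite big_cons IH; have [s' [t' ->]] := cpoly_split f@_k.
have kE r : << cpoly r *g k >> = lpoly [seq (n, k) | n <- r].
  rewrite /cpoly /lpoly big_map; elim: r => [|n r IHr]; first by rewrite !big_nil monalgU0.
  by rewrite !big_cons monalgUD IHr.
exists ([seq (n, k) | n <- s'] ++ s), ([seq (n, k) | n <- t'] ++ t).
by rewrite monalgUB !kE /lpoly !big_cat /= opprD addrACA.
Qed.

Lemma laurent_at_is_additive (R : unitRingType) (x : R) : additive (laurent_at x).
Proof. exact: mmap_is_additive. Qed.

HB.instance Definition _ (R : unitRingType) (x : R) :=
  GRing.isAdditive.Build {malg int[int]} R (laurent_at x) (laurent_at_is_additive x).

Lemma mmap_cpoly (R : unitRingType) (K : choiceType) (h : K -> R) (s : seq K) :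
  mmap intr h (cpoly s) = \sum_(k <- s) h k.
Proof.
rewrite /cpoly raddf_sum; apply: eq_bigr => k _ /=.
by rewrite mmapU /= mul1r.
Qed.

Lemma mmap_lpoly (R : unitRingType) (x : R) (K : choiceType) (h : K -> R)
    (s : seq (int * K)) :
  mmap (laurent_at x) h (lpoly s) = \sum_(p <- s) x ^ p.1 * h p.2.
Proof.
rewrite /lpoly raddf_sum; apply: eq_bigr => p _ /=.
by rewrite mmapU /= /laurent_at mmapU mul1r.
Qed.

(** * Quantum frames *)

Section Frames.

Variable m : nat.

Implicit Types (T : triangulation m) (c d i j k : chord m).
Implicit Types (a b s t u v w x y z p q : 'I_m).

Lemma clockwise_excl i j : clockwise i j -> clockwise j i = false.
Proof. by move=> h; have := lamC i j; rewrite /lam h; case: clockwise. Qed.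

Lemma imm_clockwise_clockwise T i j : imm_clockwise T i j -> clockwise i j.
Proof.
by case/imm_clockwiseP=> v [x [y [ji jj h _]]]; apply/clockwiseP; exists v, x, y.
Qed.

Lemma epsC T i j : eps T i j = - eps T j i.
Proof.
rewrite /eps; case h1 : (imm_clockwise T i j); case h2 : (imm_clockwise T j i) => //.
have := clockwise_excl (imm_clockwise_clockwise h1).
by rewrite (imm_clockwise_clockwise h2).
Qed.

Lemma square_neq T k c1 c2 c3 c4 a s b t : square T k c1 c2 c3 c4 a s b t ->
  [/\ c1 != c2, c1 != c4, c3 != c2 & c3 != c4].
Proof.
move=> [jk [j1 j2 j3 j4] _ [asb bta]].
have nst : s != t by apply: contraTneq bta => <-; rewrite (ccw_asym asb).
have [[[n1 n2] n3] n4] := (joins_neq j1, joins_neq j2, joins_neq j3, joins_neq j4).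
have nab := joins_neq jk.
have j1' := j1; rewrite joinsC in j1'; have j3' := j3; rewrite joinsC in j3'.
split.
- by apply: joins_ne j1 j2 _ _.
- by apply: joins_ne j1' j4 _ _; rewrite // eq_sym.
- by apply: joins_ne j3' j2 _ _; rewrite eq_sym.
- by apply: joins_ne j3 j4 _ _; rewrite // eq_sym.
Qed.

Lemma restr_pos T k c1 c2 c3 c4 a s b t : square T k c1 c2 c3 c4 a s b t ->
  restr T (fun i => Num.max 0 (bmat T i k)) = basis T c1 + basis T c3 /\
  restr T (fun i => Num.max 0 (- bmat T i k)) = basis T c2 + basis T c4.
Proof.
move=> sq; have [n12 n14 n32 n34] := square_neq sq.
have n13 : c1 != c3.
  case: sq => jk [j1 j2 j3 j4] _ _.
  by apply: joins_ne j1 j3 _ _; rewrite ?(joins_neq jk) // eq_sym (joins_neq j4).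
have n24 : c2 != c4.
  case: sq => jk [j1 j2 j3 j4] _ _.
  rewrite joinsC in j2.
  by apply: joins_ne j2 j4 _ _; rewrite ?(joins_neq j3) // eq_sym (joins_neq jk).
split; apply/ffunP => i; rewrite !ffunE /bmat epsC opprK (eps_square sq (valP i));
  move: (val i) => {i} i.
- case: (eqVneq i c1) => [->|_]; first by rewrite (negbTE n12) (negbTE n13) (negbTE n14).
  case: (eqVneq i c2) => [->|_]; first by rewrite eq_sym (negbTE n32) (negbTE n24).
  case: (eqVneq i c3) => [->|_]; first by rewrite (negbTE n34).
  by case: (eqVneq i c4).
- case: (eqVneq i c1) => [->|_]; first by rewrite (negbTE n12) (negbTE n13) (negbTE n14).
  case: (eqVneq i c2) => [->|_]; first by rewrite eq_sym (negbTE n32) (negbTE n24).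
  case: (eqVneq i c3) => [->|_]; first by rewrite (negbTE n34).
  by case: (eqVneq i c4).
Qed.

(** Frames belong to whole triangulations, so a quadrilateral with its diagonal must first be
    completed to one. *)
Lemma square_ex k c1 c2 c3 c4 a s b t : joins k a b -> joins c1 a s ->
  joins c2 s b -> joins c3 b t -> joins c4 t a -> ccw a s b -> ccw b t a ->
  exists T, square T k c1 c2 c3 c4 a s b t.
Proof.
move=> jk j1 j2 j3 j4 asb bta.
pose S := [set k; c1; c2; c3; c4].
have hS : noncrossing S.
  apply/noncrossingP => c d; rewrite !inE -!orbA.
  case/or4P => [/eqP->|/eqP->|/eqP->|/orP[]/eqP->];
  case/or4P => [/eqP->|/eqP->|/eqP->|/orP[]/eqP->]; rewrite ?crosses_irr //;
  rewrite (crossesE jk j1, crossesE jk j2, crossesE jk j3, crossesE jk j4,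
    crossesE j1 jk, crossesE j1 j2, crossesE j1 j3, crossesE j1 j4,
    crossesE j2 jk, crossesE j2 j1, crossesE j2 j3, crossesE j2 j4,
    crossesE j3 jk, crossesE j3 j1, crossesE j3 j2, crossesE j3 j4,
    crossesE j4 jk, crossesE j4 j1, crossesE j4 j2, crossesE j4 j3);
  by apply/negbTE; move: asb bta; clear; rewrite /xing /ccw; lia.
have [T /subsetP sT] := tri_ext hS.
by exists T; split=> //; split; apply: sT; rewrite !inE eqxx ?orbT.
Qed.

Lemma chord_noncrossing c : noncrossing [set c].
Proof. by apply/noncrossingP => i j /set1P-> /set1P->; exact: crosses_irr. Qed.

Definition tri_of (S : {set chord m}) (hS : noncrossing S) : triangulation m :=
  let: exist2 B hB _ := maxset_exists hS in exist _ B hB.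

Lemma tri_ofP (S : {set chord m}) (hS : noncrossing S) : S \subset val (tri_of hS).
Proof. by rewrite /tri_of; case: maxset_exists. Qed.

End Frames.

(** * The quantum torus of one triangulation *)

Section QuantumAlgebra.

Variables (m : nat) (F : unitRingType) (omega : F).
Variable M : forall T : triangulation m, lattice T -> F.
Hypothesis hM : quantum_frames omega M.

Implicit Types (c d k : chord m).

Lemma omega_unit : omega \is a GRing.unit.
Proof. by apply: (skew_field hM); exact: (omega_neq0 hM). Qed.

Lemma omegaXC (n : int) (x : F) : omega ^ n * x = x * omega ^ n.
Proof.
have: GRing.comm x omega by rewrite /GRing.comm (omega_central hM).
by move/(commrXz n).
Qed.

Lemma omegaD (n n' : int) : omega ^ (n + n') = omega ^ n * omega ^ n'.
Proof. by rewrite exprzDr // omega_unit. Qed.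

Lemma skew_mulf_eq0 (x y : F) : x * y = 0 -> x = 0 \/ y = 0.
Proof.
move=> xy; have [x0|/(skew_field hM) ux] := eqVneq x 0; first by left.
by right; apply: (mulrI ux); rewrite xy mulr0.
Qed.

Section OneFrame.

Variable T : triangulation m.
Implicit Types (u v w : lattice T) (s t : seq (int * lattice T)).

Lemma M_unit v : M v \is a GRing.unit.
Proof. by apply: (skew_field hM); exact: (frame_neq0 hM). Qed.

Lemma MD u v : M (u + v) = omega ^ (Lam u v) * M u * M v.
Proof. by rewrite -mulrA (frameM hM) mulrA -omegaD subrr mul1r. Qed.

Lemma MN v : M (- v) = (M v)^-1.
Proof.
apply: (mulrI (M_unit v)); rewrite mulrV ?M_unit // (frameM hM) subrr.
by rewrite LamNr Lamvv !oppr0 mul1r (frame0 hM).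
Qed.

Definition terms s : F := \sum_(p <- s) omega ^ p.1 * M p.2.

Lemma terms_nil : terms [::] = 0. Proof. exact: big_nil. Qed.

Lemma terms_cat s t : terms (s ++ t) = terms s + terms t.
Proof. exact: big_cat. Qed.

Lemma terms1 n v : terms [:: (n, v)] = omega ^ n * M v.
Proof. exact: big_seq1. Qed.

Lemma perm_terms s t : perm_eq s t -> terms s = terms t.
Proof. exact: perm_big. Qed.

Definition shift (n : int) s := [seq (n + p.1, p.2) | p <- s].

Lemma terms_shift n s : terms (shift n s) = omega ^ n * terms s.
Proof.
rewrite /terms big_map mulr_sumr; apply: eq_bigr => p _.
by rewrite omegaD mulrA.
Qed.

Definition qmul s t :=
  [seq (p.1 + r.1 - Lam p.2 r.2, p.2 + r.2) | p <- s, r <- t].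

Lemma terms_mul s t : terms (qmul s t) = terms s * terms t.
Proof.
rewrite /terms /qmul big_allpairs_dep mulr_suml; apply: eq_bigr => p _.
rewrite mulr_sumr; apply: eq_bigr => r _.
rewrite MD /= !mulrA -omegaD subrK; congr (_ * _).
by rewrite -[RHS]mulrA -omegaXC mulrA -omegaD.
Qed.

Lemma mmap_terms s : mmap (laurent_at omega) (@M T) (lpoly s) = terms s.
Proof. exact: mmap_lpoly. Qed.

Lemma terms_inj s t : terms s = terms t -> perm_eq s t.
Proof.
rewrite -!mmap_terms => /eqP; rewrite -subr_eq0 -raddfB => /eqP/(frame_free hM)/eqP.
rewrite subr_eq0 => /eqP e; apply/allP => -[n v] _ /=.
by have := lpolyE s n v; rewrite e lpolyE => /eqP; rewrite eqr_nat eq_sym.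
Qed.

Lemma in_frac (x : F) : exists s1 s2 t1 t2,
  terms t1 - terms t2 != 0 /\ x = (terms s1 - terms s2) / (terms t1 - terms t2).
Proof.
have [f [g []]] := frame_frac hM T x.
have [s1 [s2 ->]] := lpoly_split f; have [t1 [t2 ->]] := lpoly_split g.
by rewrite !raddfB /= !mmap_terms => g0 e; exists s1, s2, t1, t2.
Qed.

End OneFrame.

End QuantumAlgebra.

Section ChordVariables.

Variables (m : nat) (F : unitRingType) (omega : F).
Variable M : forall T : triangulation m, lattice T -> F.
Hypothesis hM : quantum_frames omega M.

Implicit Types (T : triangulation m) (c d k : chord m).

Definition Aq c : F := M (basis (tri_of (chord_noncrossing c)) c).

(** Two triangulations containing [c] are joined by flips at other edges, and such flips keep the
    variable of [c]. *)
Lemma AqE T c : c \in val T -> M (basis T c) = Aq c.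
Proof.
move=> hc; apply: (@fan_connected m F (fun T => M (basis T c)) c (val c).1) => //.
- by rewrite /incident eqxx.
- by move=> T1 k T2 k' fl hc1 nck; rewrite (frame_flip_old hM fl).
- by apply: (subsetP (tri_ofP _)); rewrite inE.
Qed.

Lemma quantum_ptolemy k k' c1 c2 c3 c4 (a s b t : 'I_m) :
  joins k a b -> joins k' s t -> joins c1 a s -> joins c2 s b -> joins c3 b t ->
  joins c4 t a -> ccw a s b -> ccw b t a ->
  exists T, square T k c1 c2 c3 c4 a s b t /\
    Aq k' = M (basis T c1 + basis T c3 - basis T k) +
            M (basis T c2 + basis T c4 - basis T k).
Proof.
move=> jk jk' j1 j2 j3 j4 asb bta.
have [T sq] := square_ex jk j1 j2 j3 j4 asb bta; exists T; split=> //.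
have [T' [eT' fl _]] := flip_ex sq jk'; have [e1 e2] := restr_pos sq.
have := frame_flip_new hM fl; rewrite AqE; first by rewrite e1 e2.
by rewrite eT' !inE eqxx.
Qed.

End ChordVariables.

(** * The involution *)

Section Involution.

Variables (m : nat) (F : unitRingType) (omega : F).
Variable M : forall T : triangulation m, lattice T -> F.
Hypothesis hM : quantum_frames omega M.
Variable T : triangulation m.

Local Notation qterms := (@terms m F omega M T).

Implicit Types (s t : seq (int * lattice T)) (x y f g h k u v : F).

Definition bar s := [seq (- p.1, p.2) | p <- s].

Lemma barK : involutive bar.
Proof.
by move=> s; rewrite /bar -map_comp map_id_in // => -[n v] _ /=; rewrite opprK.
Qed.

Lemma terms_bar_mul s t : qterms (bar (qmul s t)) = qterms (bar t) * qterms (bar s).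
Proof.
rewrite -(terms_mul hM) /terms /qmul /bar big_map !big_allpairs_dep exchange_big big_map.
apply: eq_bigr => r _; rewrite big_map; apply: eq_bigr => p _ /=.
by rewrite [p.2 + r.2]addrC (LamC r.2); congr (_ ^ _ * _); ring.
Qed.

(** A relation, because an element of the torus has many presentations as a difference; [terms_inj]
    shows that the conjugate does not depend on the presentation. *)
Definition conjugates x y := exists s t,
  x = qterms s - qterms t /\ y = qterms (bar s) - qterms (bar t).

Lemma conjugates_fun x y y' : conjugates x y -> conjugates x y' -> y = y'.
Proof.
move=> [s [t [-> ->]]] [s' [t' [e ->]]].
have {e} : qterms (s ++ t') = qterms (s' ++ t).
  by rewrite !terms_cat; apply/eqP; rewrite -subr_eq addrAC e subrK.
move/(terms_inj hM)/(perm_map (fun p => (- p.1, p.2)))/(perm_terms omega M).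
rewrite !map_cat !terms_cat => e; apply/eqP.
by rewrite subr_eq addrAC -[X in _ == X - _]e addrK.
Qed.

Lemma conjugates_sym x y : conjugates x y -> conjugates y x.
Proof. by move=> [s [t [-> ->]]]; exists (bar s), (bar t); rewrite !barK. Qed.

Lemma conjugates_terms s : conjugates (qterms s) (qterms (bar s)).
Proof. by exists s, [::]; rewrite terms_nil !subr0. Qed.

Lemma conjugatesD x x' y y' : conjugates x x' -> conjugates y y' ->
  conjugates (x + y) (x' + y').
Proof.
move=> [s [t [-> ->]]] [s' [t' [-> ->]]]; exists (s ++ s'), (t ++ t').
by rewrite /bar !map_cat !terms_cat !opprD; split; rewrite addrACA.
Qed.

Lemma conjugatesM x x' y y' : conjugates x x' -> conjugates y y' ->
  conjugates (x * y) (y' * x').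
Proof.
move=> [s [t [-> ->]]] [s' [t' [-> ->]]].
exists (qmul s s' ++ qmul t t'), (qmul s t' ++ qmul t s').
rewrite /bar !map_cat !terms_cat -!/(bar _) !terms_bar_mul !(terms_mul hM).
rewrite !mulrBl !mulrBr !opprB; split; first by rewrite addrACA -opprD.
by rewrite addrACA -opprD [X in _ - X]addrC.
Qed.

Lemma conjugates0 x y : conjugates x y -> (x == 0) = (y == 0).
Proof.
have c00 : conjugates 0 0 by exists [::], [::]; rewrite terms_nil subrr.
move=> c; apply/eqP/eqP => e; rewrite e in c; first exact: conjugates_fun c c00.
exact: conjugates_fun (conjugates_sym c) c00.
Qed.

Lemma conjugates1 : conjugates 1 1.
Proof.
have := conjugates_terms [:: (0, 0)]; rewrite /= !terms1 ?oppr0 expr0z ?mul1r.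
by rewrite (frame0 hM).
Qed.

Definition fraction_pair x q :=
  let den := qterms q.2.1 - qterms q.2.2 in
  (den != 0) && (x == (qterms q.1.1 - qterms q.1.2) / den).

Lemma fraction_pair_ex x : exists q, fraction_pair x q.
Proof.
have [s1 [s2 [t1 [t2 [n0 e]]]]] := in_frac hM T x.
by exists ((s1, s2), (t1, t2)); rewrite /fraction_pair /= n0 e eqxx.
Qed.

(* The antiautomorphism of F that inverts omega and fixes the monomials of T. *)
Definition star x : F :=
  let q := xchoose (fraction_pair_ex x) in
  (qterms (bar q.2.1) - qterms (bar q.2.2))^-1 *
  (qterms (bar q.1.1) - qterms (bar q.1.2)).

(** Products are reversed, so a right fraction is sent to a left fraction. *)
Definition fconj x y := exists f f' g g',
  [/\ conjugates f f', conjugates g g', g != 0 & x = f / g /\ y = g'^-1 * f'].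

Lemma unitF x : x != 0 -> x \is a GRing.unit.
Proof. exact: (skew_field hM). Qed.

Lemma fraction_ex x : exists f f' g g',
  [/\ conjugates f f', conjugates g g', g != 0 & x = f / g].
Proof.
have [s1 [s2 [t1 [t2 [n0 e]]]]] := in_frac hM T x.
exists (qterms s1 - qterms s2), (qterms (bar s1) - qterms (bar s2)).
exists (qterms t1 - qterms t2), (qterms (bar t1) - qterms (bar t2)).
by split=> //; [exists s1, s2 | exists t1, t2].
Qed.

(** The Ore condition: [g^-1 * k] is itself a right fraction [u / v] of torus elements. It gives the
    common denominators needed to compare and add fractions. *)
Lemma ore g g' k k' : conjugates g g' -> conjugates k k' -> g != 0 -> k != 0 ->
  exists u u' v v', [/\ conjugates u u', conjugates v v', u != 0, v != 0 & g * u = k * v].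
Proof.
move=> cg ck g0 k0; have [u [u' [v [v' [cu cv v0 e]]]]] := fraction_ex (g^-1 * k).
have gu : g * u = k * v.
  by rewrite -[RHS]mul1r -(mulrV (unitF g0)) -!mulrA (mulrA _ k) e divrK ?unitF.
exists u, u', v, v'; split=> //; apply: contraTneq v0 => u0.
rewrite negbK; move: gu; rewrite u0 mulr0 => /esym/(skew_mulf_eq0 hM)[/eqP|->//].
by rewrite (negbTE k0).
Qed.

Lemma fconj_fun x y y' : fconj x y -> fconj x y' -> y = y'.
Proof.
move=> [f [f' [g [g' [cf cg g0 [-> ->]]]]]] [h [h' [k [k' [ch ck k0 [e ->]]]]]].
have [u [u' [v [v' [cu cv u0 v0 e1]]]]] := ore cg ck g0 k0.
have g'0 : g' != 0 by rewrite -(conjugates0 cg).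
have k'0 : k' != 0 by rewrite -(conjugates0 ck).
have v'0 : v' != 0 by rewrite -(conjugates0 cv).
have e2 : f * u = h * v.
  by rewrite -(divrK (unitF g0) f) e -mulrA e1 mulrA divrK ?unitF.
have e1' : u' * g' = v' * k'.
  by have := conjugatesM cg cu; rewrite e1 => /conjugates_fun; apply; exact: conjugatesM.
have e2' : u' * f' = v' * h'.
  by have := conjugatesM cf cu; rewrite e2 => /conjugates_fun; apply; exact: conjugatesM.
apply: (mulrI (unitF k'0)); rewrite mulVKr ?unitF //.
apply: (mulrI (unitF v'0)); rewrite -e2' !mulrA -e1' mulrK ?unitF //.
Qed.

Lemma starP x : fconj x (star x).
Proof.
rewrite /star; move: (xchooseP (fraction_pair_ex x)).
move: (xchoose _) => [[s1 s2] [t1 t2]] /andP[n0 /eqP e].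
exists (qterms s1 - qterms s2), (qterms (bar s1) - qterms (bar s2)).
exists (qterms t1 - qterms t2), (qterms (bar t1) - qterms (bar t2)).
by split=> //; [exists s1, s2 | exists t1, t2].
Qed.

Lemma star_eq x y : fconj x y -> star x = y.
Proof. exact: fconj_fun (starP x). Qed.

Lemma star_conjugates x y : conjugates x y -> star x = y.
Proof.
move=> c; apply: star_eq; exists x, y, 1, 1.
by split; rewrite ?oner_neq0 ?divr1 ?invr1 ?mul1r //; exact: conjugates1.
Qed.

Lemma star_add x y : star (x + y) = star x + star y.
Proof.
apply: star_eq.
have [f [f' [g [g' [cf cg g0 [ex ->]]]]]] := starP x.
have [h [h' [k [k' [ch ck k0 [ey ->]]]]]] := starP y.
have [u [u' [v [v' [cu cv u0 v0 e1]]]]] := ore cg ck g0 k0.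
have g'0 : g' != 0 by rewrite -(conjugates0 cg).
have k'0 : k' != 0 by rewrite -(conjugates0 ck).
have u'0 : u' != 0 by rewrite -(conjugates0 cu).
have v'0 : v' != 0 by rewrite -(conjugates0 cv).
have e1' : u' * g' = v' * k'.
  by have := conjugatesM cg cu; rewrite e1 => /conjugates_fun; apply; exact: conjugatesM.
exists (f * u + h * v), (u' * f' + v' * h'), (g * u), (u' * g').
split; [| exact: conjugatesM | | split].
- by apply: conjugatesD; exact: conjugatesM.
- by apply: contraNneq u0 => /(skew_mulf_eq0 hM)[/eqP|->//]; rewrite (negbTE g0).
- rewrite mulrDl {2}e1 !invrM ?unitF // !mulrA !mulrK ?unitF //.
  by rewrite -ex -ey.
- rewrite mulrDr {2}e1' !invrM ?unitF // -!mulrA !mulKr ?unitF //.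
Qed.

Lemma star_mul x y : star (x * y) = star y * star x.
Proof.
apply: star_eq.
have [f [f' [g [g' [cf cg g0 [ex ->]]]]]] := starP x.
have [h [h' [k [k' [ch ck k0 [ey ->]]]]]] := starP y.
have [u [u' [v [v' [cu cv v0 e]]]]] := fraction_ex (g^-1 * h).
have g'0 : g' != 0 by rewrite -(conjugates0 cg).
have k'0 : k' != 0 by rewrite -(conjugates0 ck).
have v'0 : v' != 0 by rewrite -(conjugates0 cv).
have e1 : h * v = g * u.
  by rewrite -[LHS]mul1r -(mulrV (unitF g0)) -!mulrA (mulrA _ h) e divrK ?unitF.
have e1' : v' * h' = u' * g'.
  by have := conjugatesM ch cv; rewrite e1 => /conjugates_fun; apply; exact: conjugatesM.
exists (f * u), (u' * f'), (k * v), (v' * k').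
split; [exact: conjugatesM | exact: conjugatesM | | split].
- by apply: contraNneq v0 => /(skew_mulf_eq0 hM)[/eqP|->//]; rewrite (negbTE k0).
- by rewrite ex ey invrM ?unitF // !mulrA -(mulrA f) e !mulrA.
- rewrite invrM ?unitF // -!mulrA; congr (_ * _); rewrite !mulrA; congr (_ * _).
  by apply: (mulIr (unitF g'0)); rewrite divrK ?unitF // -mulrA -e1' mulKr ?unitF.
Qed.

Lemma star_invol x : star (star x) = x.
Proof.
apply: star_eq.
have [f [f' [g [g' [cf cg g0 [ex ->]]]]]] := starP x.
have [a [a' [b [b' [ca cb b0 e]]]]] := fraction_ex (g'^-1 * f').
have g'0 : g' != 0 by rewrite -(conjugates0 cg).
have b'0 : b' != 0 by rewrite -(conjugates0 cb).
exists a, a', b, b'; split=> //; split=> //.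
have e1 : f' * b = g' * a.
  by rewrite -[LHS]mul1r -(mulrV (unitF g'0)) -!mulrA (mulrA _ f') e divrK ?unitF.
have e1' : b' * f = a' * g.
  have := conjugatesM (conjugates_sym cf) cb; rewrite e1 => /conjugates_fun; apply.
  exact: conjugatesM (conjugates_sym cg) ca.
by rewrite ex; apply: (mulIr (unitF g0)); rewrite divrK ?unitF // -mulrA -e1' mulKr ?unitF.
Qed.

Lemma star_omega n : star (omega ^ n) = omega ^ (- n).
Proof.
apply: star_conjugates; have := conjugates_terms [:: (n, 0)].
by rewrite /= !terms1 (frame0 hM) !mulr1.
Qed.

Lemma star_terms s : star (qterms s) = qterms (bar s).
Proof. exact/star_conjugates/conjugates_terms. Qed.

Lemma star_M (v : lattice T) : star (M v) = M v.
Proof.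
have := star_terms [:: (0, v)].
by rewrite /= !terms1 ?oppr0 expr0z ?mul1r.
Qed.

Lemma star_one : star 1 = 1.
Proof. exact/star_conjugates/conjugates1. Qed.

Lemma star_zero : star 0 = 0.
Proof. by have := star_terms [::]; rewrite terms_nil. Qed.

Lemma star_inv x : star x^-1 = (star x)^-1.
Proof.
have [->|x0] := eqVneq x 0; first by rewrite invr0 star_zero invr0.
have e : star x^-1 * star x = 1 by rewrite -star_mul mulrV ?unitF // star_one.
have n0 : star x != 0.
  by apply: contraTneq (oner_neq0 F) => e0; rewrite -e e0 mulr0 eqxx.
by apply: (mulIr (unitF n0)); rewrite e mulVr ?unitF.
Qed.

Lemma star_opp x : star (- x) = - star x.
Proof. by apply/eqP; rewrite -addr_eq0 -star_add addNr star_zero. Qed.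

(** Reversing [M u * M v] and inverting [omega] compensate each other by skew-symmetry of [Lam], so
    the exponents of fixed monomials form a group. *)
Lemma star_span (T' : triangulation m) (w : lattice T') :
  (forall i : edge T', w i != 0 -> star (Aq M (val i)) = Aq M (val i)) ->
  star (M w) = M w.
Proof.
move=> fixA; pose S := fun w' : lattice T' => star (M w') = M w'.
have S0 : S 0 by rewrite /S (frame0 hM) star_one.
have SD (u' v' : lattice T') : S u' -> S v' -> S (u' + v').
  move=> hu hv; rewrite /S {1}(MD hM) !star_mul star_omega hu hv.
  rewrite -(omegaXC hM) mulrA -(omegaXC hM) -mulrA (frameM hM) mulrA.
  by rewrite -(omegaD hM) [Lam v' u']LamC opprK addNr mul1r addrC.
have SN (u' : lattice T') : S u' -> S (- u') by rewrite /S (MN hM) star_inv => ->.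
have SMn (u' : lattice T') n : S u' -> S (u' *~ n).
  move=> hu; have aux (l : nat) : S (u' *+ l).
    by elim: l => [|l IH]; rewrite ?mulr0n // mulrS; apply: SD.
  by case: n => l; [rewrite -pmulrn | rewrite NegzE mulrNz -pmulrn; apply: SN].
rewrite -/(S w) (lattice_expand w); apply: (big_ind S) => // i _.
have [->|n0] := eqVneq (w i) 0; first by rewrite mulr0z.
by apply: SMn; rewrite /S (AqE hM (valP i)) fixA.
Qed.

(** Both summands of the quantum Ptolemy relation are frame monomials, without a power of [omega],
    in variables already known to be fixed. *)
Lemma star_Aq c : star (Aq M c) = Aq M c.
Proof.
move: c; apply: (@chord_ind _ T) => [c hc|].
  by rewrite -(AqE hM hc) star_M.
move=> c k czx cxy cyu cuz z x y u nc jk jzx jxy jyu juz jc zxy yuz hk hyu huz e1 e2.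
have [T' [sq ->]] := quantum_ptolemy hM jk jc jzx jxy jyu juz zxy yuz.
have A d : d \in val T -> star (Aq M d) = Aq M d.
  by move=> hd; rewrite -(AqE hM hd) star_M.
rewrite star_add !star_span // => i; rewrite !ffunE => n0.
  have [->|n2] := eqVneq (val i) cxy; first exact: e2.
  have [->|n4] := eqVneq (val i) cuz; first exact: A.
  have [->|n] := eqVneq (val i) k; first exact: A.
  by move: n0; rewrite (negbTE n2) (negbTE n4) (negbTE n).
have [->|n2] := eqVneq (val i) czx; first exact: e1.
have [->|n4] := eqVneq (val i) cyu; first exact: A.
have [->|n] := eqVneq (val i) k; first exact: A.
by move: n0; rewrite (negbTE n2) (negbTE n4) (negbTE n).
Qed.

Lemma star_frame (T' : triangulation m) (w : lattice T') : star (M w) = M w.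
Proof. by apply: star_span => i _; exact: star_Aq. Qed.

End Involution.

(** * Expansions in a fixed triangulation *)

Section Classical.

Variables (m : nat) (K : fieldType) (B : chord m -> K).

Definition ptolemy : Prop := forall a b c d k k' : chord m,
  quadrilateral a b c d k k' -> B k * B k' = B a * B c + B d * B b.

Lemma ptolemy_cyc k k' c1 c2 c3 c4 (a s b t : 'I_m) : ptolemy ->
  joins k a b -> joins k' s t -> joins c1 a s -> joins c2 s b -> joins c3 b t ->
  joins c4 t a -> ccw a s b -> ccw b t a ->
  B k * B k' = B c1 * B c3 + B c4 * B c2.
Proof.
move=> pB jk jk' j1 j2 j3 j4 asb bta.
have [/pB e|[/pB e|[/pB e|/pB e]]] := quad_cyc j1 j2 j3 j4 jk jk' asb bta.
- by rewrite e; ring.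
- by rewrite mulrC e; ring.
- by rewrite e; ring.
- by rewrite mulrC e; ring.
Qed.

Variable T : triangulation m.

Definition cmon (v : lattice T) : K := \prod_(i : edge T) B (val i) ^ v i.

Lemma cmonD u v : (forall c, c \in val T -> B c != 0) -> cmon (u + v) = cmon u * cmon v.
Proof.
move=> nz; rewrite /cmon -big_split; apply: eq_bigr => i _.
by rewrite ffunE expfzDr // nz // (valP i).
Qed.

Lemma cmon_basisMz c n : c \in val T -> cmon (basis T c *~ n) = B c ^ n.
Proof.
move=> hc; rewrite /cmon (bigD1 (exist _ c hc)) //= ffunMzE ffunE eqxx intz.
rewrite big1 ?mulr1 // => i; rewrite -val_eqE /= => /negbTE ni.
by rewrite ffunMzE ffunE ni mul0rz expr0z.
Qed.

Lemma cmon_basis c : c \in val T -> cmon (basis T c) = B c.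
Proof. by move=> hc; have := cmon_basisMz 1 hc; rewrite mulr1z expr1z. Qed.

Lemma cmon0 : cmon 0 = 1.
Proof. by apply: big1 => i _; rewrite ffunE expr0z. Qed.

End Classical.

Lemma dvdzD (d a b : int) : (d %| a)%Z -> (d %| b)%Z -> (d %| a + b)%Z.
Proof. exact: rpredD. Qed.

Lemma dvdzB (d a b : int) : (d %| a)%Z -> (d %| b)%Z -> (d %| a - b)%Z.
Proof. exact: rpredB. Qed.

Lemma count1_eq (I : eqType) (P : pred I) (s : seq I) (a b : I) :
  count P s = 1%N -> a \in s -> b \in s -> P a -> P b -> a = b.
Proof.
rewrite -size_filter => e ha hb Pa Pb.
have : a \in filter P s by rewrite mem_filter Pa.
have : b \in filter P s by rewrite mem_filter Pb.
by case: (filter P s) e => [|c [|]] //= _; rewrite !inE => /eqP-> /eqP->.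
Qed.

Section Expansions.

Variables (m : nat) (F : unitRingType) (omega : F).
Variable M : forall T : triangulation m, lattice T -> F.
Hypothesis hM : quantum_frames omega M.
Hypothesis hm : (3 <= m)%N.
Variable T : triangulation m.

Local Notation qterms := (@terms m F omega M T).
Local Notation clfun := (forall K : fieldType, (chord m -> K) -> K).
Local Notation star := (star hM T).

Implicit Types (s t : seq (int * lattice T)) (x : F) (y : clfun).
Implicit Types (dg : 'I_m -> int) (l : chord m -> int) (c j : chord m).

(* The quantum element x and the classical function y have the same exponents *)
(* p.2. All of them have degree dg; their pairings with the edges j of T are  *)
(* at most l j, with simultaneous equality for a single term.                 *)
Definition expansion s x y dg l : Prop :=
  [/\ x = qterms s,
      forall (K : fieldType) (B : chord m -> K), ptolemy B ->
        (forall c, c \in val T -> B c != 0) -> y K B = \sum_(p <- s) cmon B p.2,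
      forall p, p \in s -> [/\ (4 %| p.1)%Z, forall z, vdeg p.2 z = dg z &
        forall j, j \in val T -> pair p.2 j <= l j] &
      exists h, [/\ forall j, j \in val T -> pair h j = l j, (0, h) \in s &
        count (fun p => p.2 == h) s = 1%N]].

Definition good x y dg l : Prop := exists s, expansion s x y dg l.

(** Powers of [omega] are ignored while multiplying; [good_of_pgood] restores them at the end. *)
Definition pgood x y dg l : Prop := exists n, good (omega ^ n * x) y dg l.

Lemma good_ext x y y' dg dg' l l' :
  (forall (K : fieldType) (B : chord m -> K), ptolemy B ->
     (forall c, c \in val T -> B c != 0) -> y K B = y' K B) ->
  dg =1 dg' -> (forall j, j \in val T -> l j = l' j) ->
  good x y dg l -> good x y' dg' l'.
Proof.
move=> ey ed el [s [e1 e2 e3 [h [h1 h2 h3]]]]; exists s; split=> //.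
- by move=> K B pB nz; rewrite -ey // e2.
- by move=> p /e3[p1 p2 p3]; split=> // [z|j hj]; rewrite -?ed -?el //; exact: p3.
- by exists h; split=> // j hj; rewrite -el // h1.
Qed.

Lemma pgood_ext x y y' dg dg' l l' :
  (forall (K : fieldType) (B : chord m -> K), ptolemy B ->
     (forall c, c \in val T -> B c != 0) -> y K B = y' K B) ->
  dg =1 dg' -> (forall j, j \in val T -> l j = l' j) ->
  pgood x y dg l -> pgood x y' dg' l'.
Proof. by move=> ey ed el [n g]; exists n; exact: good_ext g. Qed.

Lemma good_pgood x y dg l : good x y dg l -> pgood x y dg l.
Proof. by move=> g; exists 0; rewrite expr0z mul1r. Qed.

Lemma pgood_shift n x y dg l : pgood x y dg l -> pgood (omega ^ n * x) y dg l.
Proof.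
move=> [n' g]; exists (n' - n).
by rewrite mulrA -(omegaD hM) subrK.
Qed.

Lemma good_monomial (v : lattice T) :
  good (M v) (fun K B => cmon B v) (vdeg v) (pair v).
Proof.
exists [:: (0, v)]; split.
- by rewrite terms1 expr0z mul1r.
- by move=> K B _ _; rewrite big_seq1.
- by move=> p; rewrite inE => /eqP->; split=> //=; rewrite dvdz0.
- by exists v; split=> //=; rewrite ?inE ?eqxx.
Qed.

Lemma pairD (u v : lattice T) j : pair (u + v) j = pair u j + pair v j.
Proof. exact: wsumDl. Qed.

Lemma vdegD (u v : lattice T) z : vdeg (u + v) z = vdeg u z + vdeg v z.
Proof. exact: wsumDl. Qed.

Lemma pair_vdeg_inj (u v : lattice T) : (forall z, vdeg u z = vdeg v z) ->
  (forall j, j \in val T -> pair u j = pair v j) -> u = v.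
Proof.
move=> ed ep; apply/eqP; rewrite -subr_eq0; apply/eqP.
apply: (pair_nondegenerate hm) => [z|j hj].
  by have := ed z; rewrite /vdeg wsumBl => ->; rewrite subrr.
by have := ep j hj; rewrite /pair wsumBl => ->; rewrite subrr.
Qed.

Lemma Lam_dvd4 (u v : lattice T) : (forall z, vdeg u z = 0) -> (4 %| Lam u v)%Z.
Proof.
move=> hu; rewrite LamE /wsum; apply: (big_ind (fun z => (4 %| z)%Z)) => //.
- by move=> a b; exact: dvdzD.
- by move=> i _; rewrite dvdz_mull // (pair_dvd4 hu) // (valP i).
Qed.

(** The difference is a combination of pairings with the degree 0 vectors [u - u'] and [v - v']. *)
Lemma Lam_mod4 (u u' v v' : lattice T) : (forall z, vdeg u z = vdeg u' z) ->
  (forall z, vdeg v z = vdeg v' z) -> (4 %| Lam u v - Lam u' v')%Z.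
Proof.
move=> eu ev.
have -> : Lam u v - Lam u' v' = Lam (u - u') v - Lam (v - v') u'.
  rewrite !LamDl !LamNl (LamC v u') (LamC v' u'); ring.
apply: dvdzB; apply: Lam_dvd4 => z.
  by have := eu z; rewrite /vdeg wsumBl => ->; rewrite subrr.
by have := ev z; rewrite /vdeg wsumBl => ->; rewrite subrr.
Qed.

(** A sum of two bounded pairings reaches its bound only if both do. As degree and pairings
    determine an exponent, the top exponent [h + h'] arises from one pair of terms only. *)
Lemma pgood_mul x x' y y' dg dg' l l' : pgood x y dg l -> pgood x' y' dg' l' ->
  pgood (x * x') (fun K B => y K B * y' K B) (fun z => dg z + dg' z) (fun j => l j + l' j).
Proof.
move=> [n [s [e1 e2 e3 [h [h1 h2 h3]]]]] [n' [s' [e1' e2' e3' [h' [h1' h2' h3']]]]].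
(* The factor [omega ^ Lam h h'] gives [M (h + h')] coefficient 1; the other powers then stay
   divisible by 4 by [Lam_mod4]. *)
exists (Lam h h' + n + n'), (shift (Lam h h') (qmul s s')).
have [_ hd _] := e3 _ h2; have [_ hd' _] := e3' _ h2'.
have sumE (p r : int * lattice T) : p \in s -> r \in s' ->
    (p.2 + r.2 == h + h') = (p.2 == h) && (r.2 == h').
  move=> /e3[_ pd pl] /e3'[_ rd rl]; apply/eqP/andP => [e|[/eqP-> /eqP->//]].
  have E j : j \in val T -> pair p.2 j = pair h j /\ pair r.2 j = pair h' j.
    move=> hj; have : pair (p.2 + r.2) j = pair (h + h') j by rewrite e.
    rewrite !pairD h1 // h1' //.
    have := pl j hj; have := rl j hj; move: (pair p.2 j) (pair r.2 j) (l j) (l' j); clear => a b c d *; lia.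
  split; apply/eqP; apply: pair_vdeg_inj => [z|j hj]; try by have [] := E j hj.
    by rewrite pd -hd.
  by rewrite rd -hd'.
split.
- rewrite (terms_shift hM) (terms_mul hM) -e1 -e1' !(omegaD hM) -!mulrA; congr (_ * _).
  by congr (_ * _); rewrite !mulrA (omegaXC hM).
- move=> K B pB nz; rewrite e2 // e2' // /shift big_map /qmul big_allpairs_dep.
  rewrite mulr_suml; apply: eq_bigr => p _; rewrite mulr_sumr; apply: eq_bigr => r _.
  by rewrite /= cmonD.
- move=> p /mapP[p0 /allpairsP[[a b] /= [/e3[a1 a2 a3] /e3'[b1 b2 b3] ->]] ->] /=; split.
  + have -> : Lam h h' + (a.1 + b.1 - Lam a.2 b.2) =
        a.1 + b.1 - (Lam a.2 b.2 - Lam h h') by ring.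
    apply: dvdzB; first exact: dvdzD.
    by apply: Lam_mod4 => z; rewrite ?a2 ?b2 -?hd -?hd'.
  + by move=> z; rewrite vdegD a2 b2.
  + by move=> j hj; rewrite pairD lerD ?a3 ?b3.
- exists (h + h'); split.
  + by move=> j hj; rewrite pairD h1 ?h1'.
  + apply/mapP; exists (0 + 0 - Lam h h', h + h').
      by apply/allpairsP; exists ((0, h), (0, h')).
    by rewrite /= addr0 add0r subrr.
  + rewrite count_map -sum1_count big_mkcond /qmul big_allpairs_dep /=.
    transitivity (\sum_(p <- s) \sum_(r <- s') (p.2 == h) * (r.2 == h'))%N.
      rewrite !big_seq; apply: eq_bigr => p hp; rewrite !big_seq.
      apply: eq_bigr => r hr; rewrite sumE // mulnb.
      by case: andb.
    rewrite -[RHS]muln1 -{1}h3 -h3' -!sum1_count !(big_mkcond (fun p => p.2 == _)) /=.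
    rewrite big_distrl; apply: eq_bigr => p _; rewrite big_distrr; apply: eq_bigr => r _.
    by do 2!case: eqP.
Qed.

Lemma good_add x x' y y' dg l l' j0 : good x y dg l -> good x' y' dg l' ->
  (forall j, j \in val T -> l' j <= l j) -> j0 \in val T -> l' j0 < l j0 ->
  good (x + x') (fun K B => y K B + y' K B) dg l.
Proof.
move=> [s [e1 e2 e3 [h [h1 h2 h3]]]] [s' [e1' e2' e3' _]] le hj0 lt.
exists (s ++ s'); split.
- by rewrite terms_cat e1 e1'.
- by move=> K B pB nz; rewrite e2 // e2' // big_cat.
- move=> p; rewrite mem_cat => /orP[/e3//|/e3'[p1 p2 p3]]; split=> // j hj.
  exact: le_trans (p3 _ hj) (le _ hj).
- exists h; split=> //; first by rewrite mem_cat h2.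
  rewrite count_cat h3 (eq_in_count (a2 := pred0)) ?count_pred0 // => p /e3'[_ _ p3].
  apply/negbTE; apply: contraTneq (p3 _ hj0) => ->.
  by rewrite h1 // -ltNge.
Qed.

(* The involution inverts omega, so the coefficient of the highest term of an *)
(* element that it fixes is 1.                                                *)
Lemma good_of_pgood x y dg l : star x = x -> pgood x y dg l -> good x y dg l.
Proof.
move=> fx [n [s [e1 e2 e3 [h [h1 h2 h3]]]]].
suff n0 : n = 0 by exists s; split=> //; [rewrite -e1 n0 expr0z mul1r | exists h].
have ex : x = qterms (shift (- n) s).
  by rewrite (terms_shift hM) -e1 mulrA -(omegaD hM) addNr expr0z mul1r.
have : perm_eq (shift (- n) s) (bar (shift (- n) s)).
  by apply: (terms_inj hM); rewrite -(star_terms hM) -ex fx.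
move/perm_mem/(_ (n, h)).
have h2' : (- n, h) \in shift (- n) s.
  by apply/mapP; exists (0, h); rewrite //= addr0.
have -> : (n, h) \in bar (shift (- n) s).
  by apply/mapP; exists (- n, h); rewrite //= opprK.
move=> h2''; have h3' : count (fun p => p.2 == h) (shift (- n) s) = 1%N.
  by rewrite count_map -[RHS]h3; apply: eq_count.
have [] : (n, h) = (- n, h) by apply: (count1_eq h3') => //=.
by clear; lia.
Qed.

End Expansions.

(** * Expansions of chord variables and of frame monomials *)

Section ChordExpansions.

Variables (m : nat) (F : unitRingType) (omega : F).
Variable M : forall T : triangulation m, lattice T -> F.
Hypothesis hM : quantum_frames omega M.
Hypothesis hm : (3 <= m)%N.
Variable T : triangulation m.

Local Notation clfun := (forall K : fieldType, (chord m -> K) -> K).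
Local Notation star := (star hM T).
Local Notation Aq := (Aq M).
Local Notation good := (good omega M T).
Local Notation pgood := (pgood omega M T).

Implicit Types (x : F) (y : clfun).
Implicit Types (dg : 'I_m -> int) (l : chord m -> int) (c j k : chord m).

Lemma frame_ratio (T' : triangulation m) c k : c \in val T' -> k \in val T' ->
  exists n, M (basis T' c - basis T' k) = omega ^ n * (Aq c * (Aq k)^-1).
Proof.
move=> hc hk; exists (Lam (basis T' c) (- basis T' k)).
by rewrite (MD hM) (MN hM) !(AqE hM) // mulrA.
Qed.

(** Since [T] and [T'] share [c3] and [k], the summand is, up to a power of [omega], the variable of
    [c1] times a monomial of [T]: dividing by [k] costs nothing. *)
Lemma pgood_summand (T' : triangulation m) c1 c3 k y dg l : c1 \in val T' -> c3 \in val T' -> k \in val T' ->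
  c3 \in val T -> k \in val T -> pgood (Aq c1) y dg l ->
  pgood (M (basis T' c1 + basis T' c3 - basis T' k))
    (fun K B => y K B * (B c3 / B k))
    (fun z => dg z + ((incident z c3)%:Z - (incident z k)%:Z))
    (fun j => l j + (lam c3 j - lam k j)).
Proof.
move=> h1 h3 hk h3T hkT g; have [n e] := frame_ratio h3 hk.
have [n' e'] := frame_ratio h3T hkT.
have -> : M (basis T' c1 + basis T' c3 - basis T' k) =
    omega ^ (Lam (basis T' c1) (basis T' c3 - basis T' k) + n - n') *
    (Aq c1 * M (basis T c3 - basis T k)).
  rewrite -[X in M X = _]addrA [LHS](MD hM) (AqE hM h1) e e' !(omegaD hM) -!mulrA.
  congr (_ * _).
  rewrite (mulrA (Aq c1)) -(omegaXC hM n) -mulrA; congr (_ * _).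
  rewrite (mulrA (Aq c1) (omega ^ n')) -(omegaXC hM n') -[X in _ = _ * X]mulrA.
  rewrite [RHS]mulrA -(omegaD hM) addNr.
  by rewrite expr0z mul1r.
apply: (pgood_shift hM); apply: pgood_ext (pgood_mul hM hm g (good_pgood (good_monomial omega M _))).
- move=> K B pB nz; congr (_ * _).
  rewrite cmonD // cmon_basis //; congr (_ * _).
  by rewrite -mulrN1z cmon_basisMz // exprN1.
- by move=> z; rewrite /vdeg wsumBl !wsum_basis.
- by move=> j hj; rewrite /pair wsumBl !wsum_basis.
Qed.

Lemma good_Aq c : good (Aq c) (fun K B => B c) (fun z => (incident z c)%:Z) (lamp c).
Proof.
move: c; apply: (@chord_ind _ T) => [c hc|].
  rewrite -(AqE hM hc); apply: good_ext (good_monomial omega M (basis T c)).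
  - by move=> K B pB nz; rewrite cmon_basis.
  - by move=> z; rewrite /vdeg wsum_basis.
  - by move=> j hj; rewrite /pair wsum_basis // /lamp (tri_ncr hc hj).
move=> c k czx cxy cyu cuz z x y u nc jk jzx jxy jyu juz jc zxy yuz hk hyu huz e1 e2.
have [T' [sq ->]] := quantum_ptolemy hM jk jc jzx jxy jyu juz zxy yuz.
have [_ _ [hk' h1' h2' h3' h4'] _] := sq.
have trop j : j \in val T ->
    lamp c j = lam cyu j - lam k j + lamp czx j /\
    lam cuz j - lam k j + lamp cxy j <= lamp c j - (if k == j then 4 else 0).
  by move=> hj; apply: tropical jk jc jzx jxy jyu juz zxy yuz _ _ _; exact: tri_ncr hj.
have inc d (v w : 'I_m) : joins d v w -> forall t, (incident t d)%:Z = (t == v)%:Z + (t == w)%:Z :> int.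
  move=> jd t; rewrite (incidentE _ jd); have := joins_neq jd.
  by case: (eqVneq t v) => [->|] //; case: (eqVneq v w).
have g1 := pgood_summand h1' h3' hk' hyu hk (good_pgood e1).
have g2 := pgood_summand h2' h4' hk' huz hk (good_pgood e2).
(* Each summand is fixed by the involution on its own, so both are normalised before being added. *)
have {}g1 := good_of_pgood (star_frame hM T _) g1.
have {}g2 := good_of_pgood (star_frame hM T _) g2.
have degE t : (incident t cxy)%:Z + ((incident t cuz)%:Z - (incident t k)%:Z) =
    (incident t czx)%:Z + ((incident t cyu)%:Z - (incident t k)%:Z) :> int.
  by rewrite (inc _ _ _ jxy) (inc _ _ _ juz) (inc _ _ _ jzx) (inc _ _ _ jyu); ring.
have {}g2 := good_ext (fun K B _ _ => erefl) degE (fun j _ => erefl) g2.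
have le12 j : j \in val T -> lamp cxy j + (lam cuz j - lam k j) <=
    lamp czx j + (lam cyu j - lam k j) - (if k == j then 4 else 0).
  by move=> /trop[e]; rewrite e addrC [X in _ <= X - _]addrC.
apply: good_ext (good_add g1 g2 _ hk _).
- move=> K B pB nz; have ck := ptolemy_cyc pB jk jc jzx jxy jyu juz zxy yuz.
  apply: (mulfI (nz _ hk)); rewrite ck; field; exact: nz.
- move=> t; rewrite (inc _ _ _ jc) (inc _ _ _ jzx) (inc _ _ _ jyu) (inc _ _ _ jk); ring.
- by move=> j /trop[-> _]; rewrite addrC.
- by move=> j /le12 h; apply: le_trans h _; rewrite gerBl; case: ifP.
- by have := le12 _ hk; rewrite eqxx => h; apply: le_lt_trans h _; rewrite gtrBl.
Qed.

Lemma pgood1 : pgood 1 (fun K B => 1) (fun=> 0) (fun=> 0).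
Proof.
rewrite -(frame0 hM T); apply: good_pgood; apply: good_ext (good_monomial omega M 0).
- by move=> K B _ _; rewrite cmon0.
- by move=> z; rewrite /vdeg wsum0l.
- by move=> j _; rewrite /pair wsum0l.
Qed.

Lemma pgood_exp x y dg l n : pgood x y dg l ->
  pgood (x ^+ n) (fun K B => y K B ^+ n) (fun z => n%:Z * dg z) (fun j => n%:Z * l j).
Proof.
move=> g; elim: n => [|n IH].
  by apply: pgood_ext pgood1 => [K B _ _|z|j _]; rewrite ?expr0 // [0%:Z]/(0 : int) mul0r.
rewrite exprS; apply: pgood_ext (pgood_mul hM hm g IH) => [K B _ _|z|j _].
- by rewrite exprS.
- by rewrite -(natz n.+1) mulrS mulrDl mul1r natz.
- by rewrite -(natz n.+1) mulrS mulrDl mul1r natz.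
Qed.

Lemma M_mulrn (T' : triangulation m) (v : lattice T') n : M (v *+ n) = M v ^+ n.
Proof.
elim: n => [|n IH]; first by rewrite mulr0n (frame0 hM).
rewrite mulrS (MD hM) IH exprS [X in Lam _ X]pmulrn LamMzr Lamvv mulr0.
by rewrite expr0z mul1r.
Qed.

Lemma M_mulrz (T' : triangulation m) (v : lattice T') z : M (v *~ z) = M v ^ z.
Proof.
case: z => z; first by rewrite -pmulrn M_mulrn.
by rewrite NegzE mulrNz -pmulrn (MN hM) M_mulrn.
Qed.

Lemma M_basisMz (T' : triangulation m) c n : c \in val T' -> M (basis T' c *~ n) = Aq c ^ n.
Proof. by move=> hc; rewrite M_mulrz (AqE hM hc). Qed.

(** Inverses are taken of boundary variables only; boundary edges belong to [T], so these inverses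
    are monomials. *)
Lemma pgood_edge (T' : triangulation m) (c : chord m) (n : int) : c \in val T' -> (~~ boundary c -> 0 <= n) ->
  pgood (M (basis T' c *~ n)) (fun K B => B c ^ n)
    (fun z => n * (incident z c)%:Z) (fun j => n * lamp c j).
Proof.
move=> hc hn; case: n hn => n hn.
  rewrite M_basisMz //.
  by apply: pgood_ext (pgood_exp n (good_pgood (good_Aq c))) => *; rewrite ?exprnP.
have bc : boundary c by apply: contraT => /hn.
have hcT := boundary_tri T bc.
have -> : M (basis T' c *~ Negz n) = M (basis T c *~ Negz n).
  by rewrite !M_basisMz.
apply: good_pgood; apply: good_ext (good_monomial omega M _).
- by move=> K B pB nz; rewrite cmon_basisMz.
- by move=> z; rewrite /vdeg wsumMzl wsum_basis.
- by move=> j hj; rewrite /pair wsumMzl wsum_basis // /lamp (tri_ncr hcT hj).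
Qed.

Lemma pgood_lattice (T' : triangulation m) (w : lattice T') :
  (forall i : edge T', ~~ boundary (val i) -> 0 <= w i) ->
  pgood (M w) (fun K B => \prod_(i : edge T') B (val i) ^ w i)
    (fun z => \sum_(i : edge T') w i * (incident z (val i))%:Z)
    (fun j => \sum_(i : edge T') w i * lamp (val i) j).
Proof.
move=> hw; rewrite {1}(lattice_expand w).
elim: (index_enum _) => [|i r IH].
  by rewrite big_nil (frame0 hM); apply: pgood_ext pgood1 => [K B _ _|z|j _] /=; rewrite big_nil.
rewrite big_cons (MD hM) -mulrA; apply: (pgood_shift hM).
have ge := pgood_edge (valP i) (hw i).
by apply: pgood_ext (pgood_mul hM hm ge IH) => [K B _ _|z|j _] /=; rewrite big_cons.
Qed.

Lemma good_lattice (T' : triangulation m) (w : lattice T') :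
  (forall i : edge T', ~~ boundary (val i) -> 0 <= w i) ->
  good (M w) (fun K B => \prod_(i : edge T') B (val i) ^ w i)
    (fun z => \sum_(i : edge T') w i * (incident z (val i))%:Z)
    (fun j => \sum_(i : edge T') w i * lamp (val i) j).
Proof. by move=> hw; apply: good_of_pgood (star_frame hM T w) (pgood_lattice hw). Qed.

End ChordExpansions.

(** * Independence of the classical coordinates *)

Lemma addr_norm_ge0 (x y : int) : 0 <= x + (`|x| + `|y|).
Proof.
rewrite addrA addr_ge0 //; have := ler_norm (- x); rewrite normrN => h.
by rewrite -[X in X + _]opprK addrC subr_ge0.
Qed.

Section LaurentVars.

Variables (m : nat) (T : triangulation m) (A : chord m -> ratfun T).
Hypothesis A_var : forall i : edge T, A (val i) = RatFun.var (enum_rank i).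

Lemma coord_neq0 c : c \in val T -> A c != 0.
Proof. by move=> hc; have := A_var (exist _ c hc); rewrite /= => ->; exact: RatFunTheory.var_neq0. Qed.

Lemma lattice_bound (s : seq (lattice T)) :
  exists N : lattice T, forall v, v \in s -> forall i, 0 <= v i + N i.
Proof.
elim: s => [|v s [N hN]]; first by exists 0.
exists [ffun i => `|v i| + `|N i|] => u; rewrite inE => /orP[/eqP->|/hN h] i; rewrite ffunE.
  exact: addr_norm_ge0.
by apply: le_trans (h i) _; rewrite lerD2l ler_wpDl // ler_norm.
Qed.

(** Multiplication by a large monomial clears the denominators and reduces the claim to
    polynomials. *)
Lemma coord_monomials_inj (s t : seq (lattice T)) :
  \sum_(v <- s) cmon A v = \sum_(v <- t) cmon A v -> perm_eq s t.
Proof.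
have [N hN] := lattice_bound (s ++ t).
pose nn (v : lattice T) : {ffun 'I_#|{: edge T}| -> nat} :=
  [ffun i => absz (v (enum_val i) + N (enum_val i))].
have nnE v : v \in s ++ t ->
    cmon A v * cmon A N = \prod_i RatFun.var i ^+ nn v i.
  move=> hv; rewrite -cmonD; last exact: coord_neq0.
  rewrite /cmon (reindex (@enum_val _ {: edge T})) /=; last first.
    by apply: onW_bij; exact: enum_val_bij.
  apply: eq_bigr => i _; rewrite A_var enum_valK !ffunE.
  by rewrite -[X in _ ^ X]gez0_abs ?hN // -exprnP.
have nn_inj : {in s ++ t &, injective nn}.
  move=> u v hu hv e; apply/ffunP => i.
  have := congr1 (fun f : {ffun 'I_#|{: edge T}| -> nat} => (f (enum_rank i))%:Z) e.
  by rewrite !ffunE !enum_rankK !gez0_abs ?hN // => /addIr.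
move=> e; have /RatFunTheory.var_monomials_inj : \sum_(v <- map nn s) \prod_i RatFun.var i ^+ v i =
    \sum_(v <- map nn t) \prod_i RatFun.var i ^+ v i :> ratfun T.
  have := congr1 (fun x => x * cmon A N) e; rewrite !mulr_suml !big_map.
  rewrite big_seq [X in _ = X -> _]big_seq [X in _ -> X = _]big_seq [X in _ -> _ = X]big_seq.
  rewrite (eq_bigr (fun v => \prod_i RatFun.var i ^+ nn v i)); last first.
    by move=> v hv; rewrite nnE // mem_cat hv.
  rewrite [X in _ = X -> _](eq_bigr (fun v => \prod_i RatFun.var i ^+ nn v i)) //.
  by move=> v hv; rewrite nnE // mem_cat hv orbT.
move=> pe; apply/allP => u hu /=.
have aux r : {subset r <= s ++ t} -> count_mem u r = count_mem (nn u) (map nn r).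
  move=> sr; rewrite count_map; apply: eq_in_count => v /sr hv /=.
  by apply/eqP/eqP => [->//|]; exact: nn_inj.
rewrite !aux; first by move/permP: pe => ->.
  by move=> v hv; rewrite mem_cat hv orbT.
by move=> v hv; rewrite mem_cat hv.
Qed.

End LaurentVars.

(** * Solutions of the Ptolemy relations with prescribed values on a triangulation *)

Section Plucker.

Variables (m : nat) (T : triangulation m) (K : fieldType) (x : chord m -> K).
Hypothesis x0 : forall c, c \in val T -> x c != 0.
Hypothesis hm : (3 <= m)%N.

(** The columns of a 2-row matrix are built downwards from [j]: the columns at [p] and [r] determine
    the one at the apex [s] below, and the parts under [ps] and [sr] share only the vertex [s]. *)
Lemma plucker_within (j : chord m) (p r : 'I_m) (a a' b b' : K) :
  j \in val T -> val j = (p, r) -> a * b' - a' * b = x j ->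
  exists V W : 'I_m -> K, [/\ V p = a, W p = a', V r = b, W r = b' &
    forall c, c \in val T -> within c j ->
      V (val c).1 * W (val c).2 - W (val c).1 * V (val c).2 = x c].
Proof.
have [k] := ubnP (r - p)%N; elim: k => // k IH in j p r a a' b b' *.
move=> hk hj ej dj; have := valP j; rewrite ej /= => pr.
have nrp : (r == p) = false by rewrite -val_eqE /=; move: pr; clear; lia.
have [rp|rp] := eqVneq (r : nat) p.+1.
  exists (fun i => if i == p then a else b), (fun i => if i == p then a' else b').
  rewrite eqxx nrp; split=> // c hc cj; suff e : c = j by rewrite e ej /= eqxx nrp.
  apply: val_inj; apply/eqP; rewrite ej; move: cj (valP c); rewrite /within ej.
  rewrite [X in _ -> _ -> X == _]surjective_pairing xpair_eqE -!val_eqE.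
  by move: (val c).1 (val c).2 => u v /=; move: rp; clear; lia.
have hw : (p.+1 < m)%N by apply: leq_ltn_trans pr (ltn_ord r).
have pwr : ccw p (Ordinal hw) r by move: rp pr; rewrite /ccw /=; clear; lia.
have jj := joins_ends j; rewrite ej /= in jj.
have [s [ca [cb [psr ha hb ja jb]]]] := apex hj jj pwr.
have /andP[ps sr] : (p < s < r)%N by move: psr pr; rewrite /ccw; clear; lia.
have ea := joins_lt ja ps; have eb := joins_lt jb sr.
(* Cramer's rule for the column at [s], whose minors with the columns at [p] and [r] are prescribed;
   the determinant is [x j]. *)
pose v := (x cb * a + x ca * b) / x j; pose v' := (x cb * a' + x ca * b') / x j.
have da : a * v' - a' * v = x ca.
  transitivity (x ca * (a * b' - a' * b) / x j); first by rewrite /v /v'; ring.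
  by rewrite dj mulfK // x0.
have db : v * b' - v' * b = x cb.
  transitivity (x cb * (a * b' - a' * b) / x j); first by rewrite /v /v'; ring.
  by rewrite dj mulfK // x0.
have lt1 : (s - p < k)%N by move: hk ps sr; clear; lia.
have lt2 : (r - s < k)%N by move: hk ps sr; clear; lia.
have [V1 [W1 [V1p W1p V1s W1s h1]]] := IH _ _ _ _ _ _ _ lt1 ha ea da.
have [V2 [W2 [V2s W2s V2r W2r h2]]] := IH _ _ _ _ _ _ _ lt2 hb eb db.
have srF : (r <= s)%N = false by rewrite leqNgt sr.
exists (fun i : 'I_m => if (i <= s)%N then V1 i else V2 i).
exists (fun i : 'I_m => if (i <= s)%N then W1 i else W2 i).
rewrite (ltnW ps) srF; split=> // c hc cj.
have : [\/ c = j, within c ca | within c cb].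
  move: cj (tri_ncr hc ha) (tri_ncr hc hb) (valP c) (valP j) (valP ca) (valP cb).
  rewrite /crosses /within ej ea eb /= => cj na nb vc _ _ _.
  have [h|h|h] : [\/ ((val c).1 == p :> nat) && ((val c).2 == r :> nat),
    (p <= (val c).1)%N && ((val c).2 <= s)%N | (s <= (val c).1)%N && ((val c).2 <= r)%N].
  + move: cj na nb vc; move: (val c).1 (val c).2 => u w /= cj na nb vc.
    have [h|h] := leqP w s; first by apply: Or32; move: cj h; clear; lia.
    have [h'|h'] := leqP s u; first by apply: Or33; move: cj h'; clear; lia.
    by apply: Or31; move: cj na nb vc h h'; clear; lia.
  + apply: Or31; apply: val_inj; rewrite ej [LHS]surjective_pairing.
    by case/andP: h => /eqP/val_inj-> /eqP/val_inj->.
  + exact: Or32.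
  + exact: Or33.
case=> [->|cin|cin].
- by rewrite ej /= (ltnW ps) srF V1p W1p V2r W2r.
- have cin' := cin; move: cin'; rewrite /within ea /= => /andP[_ c2s].
  by rewrite c2s (ltnW (leq_trans (valP c) c2s)) h1.
- have cin' := cin; move: cin'; rewrite /within eb /= => /andP[sc1 _].
  have sc2 : ((val c).2 <= s)%N = false by rewrite leqNgt (leq_ltn_trans sc1 (valP c)).
  rewrite sc2; case: leqP => [c1s|_]; last exact: h2.
  have -> : (val c).1 = s by apply/val_inj/eqP; rewrite eqn_leq c1s sc1.
  rewrite V1s W1s -V2s -W2s -(h2 _ hc cin); congr (_ * _ - _ * _); congr (_ _).
  all: by apply/val_inj/eqP; rewrite eqn_leq c1s sc1.
Qed.

(* The Ptolemy relations are the Pluecker relations between the minors of a   *)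
(* 2 x m matrix.                                                              *)
Lemma ptolemy_ex : exists2 B : chord m -> K, ptolemy B &
  forall c, c \in val T -> B c = x c.
Proof.
have h0 : (0 < m)%N by apply: ltn_trans hm.
have h1 : (m.-1 < m)%N by rewrite prednK.
have lt : (Ordinal h0 < Ordinal h1)%N by rewrite /=; move: hm; clear; lia.
have nlt : Ordinal h0 != Ordinal h1 by rewrite -val_eqE /=; move: hm; clear; lia.
have [j jj] := chord_ex nlt; have ej := joins_lt jj lt.
have bj : boundary j by rewrite /boundary ej /= !eqxx orbT.
have dj : 1 * x j - 0 * 0 = x j by rewrite mul1r mul0r subr0.
have [V [W [_ _ _ _ h]]] := plucker_within (boundary_tri T bj) ej dj.
exists (fun c => V (val c).1 * W (val c).2 - W (val c).1 * V (val c).2).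
  move=> a b c d k k' [p [s [r [t [_ [[-> -> -> ->] [-> ->]]]]]]] /=; ring.
by move=> c hc; apply: h => //; rewrite /within ej /= -ltnS prednK ?ltn_ord.
Qed.

End Plucker.

(** * Independence of the monomials in any triangulation *)

Section Independence.

Variables (m : nat) (F : unitRingType) (omega : F).
Variable M : forall T : triangulation m, lattice T -> F.
Hypothesis hM : quantum_frames omega M.
Hypothesis hm : (3 <= m)%N.

(** The expansion of [B c] is a nonempty sum of monomials with positive coefficients, so it cannot
    vanish. *)
Lemma coord_chord_neq0 (T : triangulation m) (B : chord m -> ratfun T) :
  ptolemy B -> (forall i : edge T, B (val i) = RatFun.var (enum_rank i)) ->
  forall c, B c != 0.
Proof.
move=> pB vB c; have nz := coord_neq0 vB.
have [s [_ e _ [h [_ hs _]]]] := good_Aq hM hm T c.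
apply/eqP => B0; have := e _ B pB nz; rewrite B0 => e0.
have /perm_size : perm_eq [::] (map snd s).
  by apply: (coord_monomials_inj vB); rewrite big_nil big_map.
by case: s hs {e e0}.
Qed.

Lemma lattice_expansion (T T' : triangulation m) (r : seq (lattice T')) :
  (forall v, v \in r -> forall i, 0 <= v i) ->
  exists R : seq (lattice T), forall (K : fieldType) (B : chord m -> K),
    ptolemy B -> (forall c, c \in val T -> B c != 0) ->
    \sum_(v <- r) cmon B v = \sum_(u <- R) cmon B u.
Proof.
elim: r => [|v r IH] hr; first by exists [::] => K B _ _; rewrite !big_nil.
have [R hR] : exists R : seq (lattice T), forall (K : fieldType) (B : chord m -> K),
    ptolemy B -> (forall c, c \in val T -> B c != 0) ->
    \sum_(v <- r) cmon B v = \sum_(u <- R) cmon B u.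
  by apply: IH => u hu; apply: hr; rewrite inE hu orbT.
have [s [_ e _ _]] := good_lattice hM hm T (fun i _ => hr v (mem_head _ _) i).
exists (map snd s ++ R) => K B pB nz; rewrite big_cons big_cat hR // big_map.
by rewrite -e.
Qed.

(* Once expanded in T0, a relation between the monomials in the A_c, c in T,  *)
(* becomes an identity between multisets of exponents. Hence it holds for all *)
(* solutions of the Ptolemy relations, in particular for one whose values on  *)
(* T are independent variables.                                               *)
Lemma monomials_inj (T0 : triangulation m) (A : chord m -> ratfun T0)
    (T : triangulation m) (s t : seq (lattice T)) : ptolemy_coordinates A ->
  \sum_(v <- s) cmon A v = \sum_(v <- t) cmon A v -> perm_eq s t.
Proof.
move=> hA e; have pA : ptolemy A by move=> *; exact: (ptolemy_rel hA).
have vA := ptolemy_var hA; have nzA := coord_chord_neq0 pA vA.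
(* Only nonnegative powers of a chord outside [T0] expand as sums of monomials, so the exponents are
   first shifted. *)
have [N hN] := lattice_bound (s ++ t).
pose sh (r : seq (lattice T)) := [seq v + N | v <- r].
have shE (K : fieldType) (B : chord m -> K) r : (forall c, B c != 0) ->
    \sum_(v <- sh r) cmon B v = (\sum_(v <- r) cmon B v) * cmon B N.
  move=> nz; rewrite big_map mulr_suml; apply: eq_bigr => v _.
  by rewrite cmonD.
have pos r : {subset r <= s ++ t} -> forall v, v \in sh r -> forall i, 0 <= v i.
  by move=> sr v /mapP[u /sr hu ->] i; rewrite ffunE hN.
have [|S hS] := @lattice_expansion T0 T (sh s).
  by apply: pos => v hv; rewrite mem_cat hv.
have [|S' hS'] := @lattice_expansion T0 T (sh t).
  by apply: pos => v hv; rewrite mem_cat hv orbT.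
have pS : perm_eq S S'.
  by apply: (coord_monomials_inj vA); rewrite -hS // -hS' // !shE // e.
pose x c : ratfun T := if insub c is Some i then RatFun.var (enum_rank (i : edge T)) else 1.
have xE (i : edge T) : x (val i) = RatFun.var (enum_rank i) by rewrite /x valK.
have [c hc|B pB eB] := @ptolemy_ex m T _ x _ hm.
  by rewrite -[c]/(val (exist _ c hc : edge T)) xE RatFunTheory.var_neq0.
have vB (i : edge T) : B (val i) = RatFun.var (enum_rank i) by rewrite eB ?(valP i) ?xE.
have nzB := coord_chord_neq0 pB vB.
have /(perm_map_inj (@addIr _ N))// : perm_eq (sh s) (sh t).
by apply: (coord_monomials_inj vB); rewrite hS // hS' //; exact: perm_big.
Qed.

End Independence.

(** * Laminations *)

Section Laminations.

Variables (m : nat) (F : unitRingType) (omega : F).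
Variable M : forall T : triangulation m, lattice T -> F.
Hypothesis hM : quantum_frames omega M.
Hypothesis hm : (3 <= m)%N.

Implicit Types (T : triangulation m) (c d : chord m) (f g : chord m -> int).

Definition lattice_of T (r : seq (chord m)) f : lattice T :=
  \sum_(c <- r) basis T c *~ f c.

Lemma lattice_of_cons T c r f : lattice_of T (c :: r) f = basis T c *~ f c + lattice_of T r f.
Proof. by rewrite /lattice_of big_cons. Qed.

Lemma pair_lattice_of T r f d : {subset r <= val T} ->
  pair (lattice_of T r f) d = \sum_(c <- r) f c * lam c d.
Proof.
move=> sr; rewrite /pair wsum_suml big_seq [RHS]big_seq.
by apply: eq_bigr => c /sr hc; rewrite wsumMzl wsum_basis.
Qed.

(** Split into powers of chord variables; the powers of [omega] that appear involve only [lam]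
    between chords of [r], whatever the triangulation. *)
Lemma M_lattice_of T T' r f : {subset r <= val T} -> {subset r <= val T'} ->
  M (lattice_of T r f) = M (lattice_of T' r f).
Proof.
elim: r => [|c r IH] hT hT'; first by rewrite /lattice_of !big_nil !(frame0 hM).
have sT : {subset r <= val T} by move=> d hd; apply: hT; rewrite inE hd orbT.
have sT' : {subset r <= val T'} by move=> d hd; apply: hT'; rewrite inE hd orbT.
have [cT cT'] : c \in val T /\ c \in val T' by rewrite hT ?hT' ?mem_head.
rewrite !lattice_of_cons !(MD hM) !(M_basisMz hM) // (IH sT sT').
congr (omega ^ _ * _ * _); rewrite !LamMzl; congr (_ * _).
by rewrite !(LamC (basis _ _)) !Lam_basisr // !pair_lattice_of.
Qed.

Lemma restr_lattice_of T f : (forall c, f c != 0 -> c \in val T) ->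
  restr T f = lattice_of T [seq c <- enum {: chord m} | f c != 0] f.
Proof.
move=> hf; rewrite /lattice_of big_filter big_enum_cond /=.
apply/ffunP => i; rewrite ffunE sum_ffunE.
have [fi|fi] := eqVneq (f (val i)) 0.
  rewrite fi big1 // => c fc; rewrite ffunMzE ffunE; case: eqP => [e|_]; last by rewrite mul0rz.
  by rewrite -e fi eqxx in fc.
rewrite (bigD1 (val i)) //= ffunMzE ffunE eqxx intz big1 ?addr0 // => c /andP[_ nc].
by rewrite ffunMzE ffunE eq_sym (negbTE nc) mul0rz.
Qed.

Lemma M_restr T T' f : (forall c, f c != 0 -> c \in val T) ->
  (forall c, f c != 0 -> c \in val T') -> M (restr T f) = M (restr T' f).
Proof.
move=> hT hT'; rewrite !restr_lattice_of //.
by apply: M_lattice_of => c; rewrite mem_filter => /andP[fc _]; [exact: hT | exact: hT'].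
Qed.

Lemma lamination_noncrossing (l : lamination m) : noncrossing [set c | val l c != 0].
Proof. by case/and3P: (valP l). Qed.

Definition Iq (l : lamination m) : F :=
  M (restr (tri_of (lamination_noncrossing l)) (val l)).

Lemma tri_of_carries (l : lamination m) : carries (tri_of (lamination_noncrossing l)) l.
Proof. by move=> c lc; apply: (subsetP (tri_ofP _)); rewrite inE. Qed.

Lemma IqE T (l : lamination m) : carries T l -> Iq l = M (restr T (val l)).
Proof. by move=> hT; apply: M_restr => //; exact: tri_of_carries. Qed.

Lemma Iq_duality_map : is_duality_map M Iq.
Proof.
move=> l; split; last by move=> T; exact: IqE.
by exists (tri_of (lamination_noncrossing l)); exact: tri_of_carries.
Qed.

Definition lam_height (l : lamination m) (j : chord m) : int :=
  \sum_c val l c * lamp c j.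

Lemma lamination_sum T (l : lamination m) (g : chord m -> int) : carries T l ->
  \sum_(i : edge T) val l (val i) * g (val i) = \sum_c val l c * g c.
Proof.
move=> hT; rewrite -(big_sub (mem (val T)) (fun c => val l c * g c)).
rewrite [LHS]big_mkcond; apply: eq_bigr => c _; case: ifP => // nc.
have [->|/hT hc] := eqVneq (val l c) 0; first by rewrite mul0r.
by case/negP: (negbT nc).
Qed.

Lemma lamination_ge0 (l : lamination m) c : ~~ boundary c -> 0 <= val l c.
Proof.
move=> nb; have [->//|n0] := eqVneq (val l c) 0.
by have /and3P[_ /forallP/(_ c) h _] := valP l; apply: ltW; move: h; rewrite n0 nb.
Qed.

Lemma lamination_vertex (l : lamination m) z : \sum_(c | incident z c) val l c = 0.
Proof. by have /and3P[_ _ /forallP/(_ z)/eqP] := valP l. Qed.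

Lemma lamination_degree T (l : lamination m) z : carries T l ->
  \sum_(i : edge T) val l (val i) * (incident z (val i))%:Z = 0.
Proof.
move=> hT; rewrite (lamination_sum (fun c => (incident z c)%:Z) hT).
rewrite -[RHS](lamination_vertex l z) [RHS]big_mkcond; apply: eq_bigr => c _.
by case: incident; rewrite ?mulr1 ?mulr0.
Qed.

Lemma good_Iq T (l : lamination m) :
  good omega M T (Iq l) (fun K B => \prod_c B c ^ val l c) (fun=> 0) (lam_height l).
Proof.
pose T' := tri_of (lamination_noncrossing l); have cT' := @tri_of_carries l.
have pos (i : edge T') : ~~ boundary (val i) -> 0 <= restr T' (val l) i.
  by move=> nb; rewrite ffunE lamination_ge0.
apply: good_ext (good_lattice hM hm T pos).
- move=> K B _ _; transitivity (\prod_(i : edge T') B (val i) ^ val l (val i)).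
    by apply: eq_bigr => i _; rewrite ffunE.
  rewrite -(big_sub (mem (val T')) (fun c => B c ^ val l c)) big_mkcond.
  apply: eq_bigr => c _; case: ifP => // nc.
  by have [->//|/cT' hc] := eqVneq (val l c) 0; case/negP: (negbT nc).
- move=> z; transitivity (\sum_(i : edge T') val l (val i) * (incident z (val i))%:Z).
    by apply: eq_bigr => i _; rewrite ffunE.
  exact: lamination_degree.
- move=> j _; transitivity (\sum_(i : edge T') val l (val i) * lamp (val i) j).
    by apply: eq_bigr => i _; rewrite ffunE.
  exact: (lamination_sum (fun c => lamp c j) cT').
Qed.

End Laminations.

(** * Ordered monomials in the variables [X_j] *)

Section Numbering.

Variables (m : nat) (F : unitRingType) (omega : F).
Variable M : forall T : triangulation m, lattice T -> F.
Hypothesis hM : quantum_frames omega M.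
Hypothesis hm : (3 <= m)%N.
Variables (T : triangulation m) (n : nat) (e : n.-tuple (chord m)).
Hypothesis he : numbering T e.

Local Notation q := (q_of omega).
Local Notation X := (fun j : 'I_n => Xq M T (tnth e j)).

Implicit Types (d : expo n).

Definition lift_expo d : lattice T := \sum_(i < n) epsv T (tnth e i) *~ d i.

Definition expo_of (v : lattice T) : expo n := [ffun i => (pair v (tnth e i) %/ 4)%Z].

(** The power of [q] separating the ordered monomial from [M (lift_expo d)]; see [monomialE]. *)
Definition twist d : int :=
  \sum_(i < n) \sum_(j < n | (i < j)%N) eps T (tnth e i) (tnth e j) * d i * d j.

Lemma edge_internal (i : 'I_n) : internal T (tnth e i).
Proof. by case: he => _ h; rewrite -h mem_tnth. Qed.

Lemma edge_eq (i j : 'I_n) : (tnth e i == tnth e j) = (i == j).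
Proof. by case: he => u _; rewrite (inj_eq (elimT (tuple_uniqP e) u)). Qed.

Lemma pair_lift d i : pair (lift_expo d) (tnth e i) = 4 * d i.
Proof.
have /andP[hi _] := edge_internal i.
rewrite /pair wsum_suml (bigD1 i) //= big1 => [|j nij].
  rewrite wsumMzl; have := pair_epsv (edge_internal i) hi; rewrite /pair => ->.
  by rewrite eqxx addr0 mulrC.
rewrite wsumMzl; have := pair_epsv (edge_internal j) hi; rewrite /pair => ->.
by rewrite edge_eq (negbTE nij) mulr0.
Qed.

Lemma lift_expoK : cancel lift_expo expo_of.
Proof. by move=> d; apply/ffunP => i; rewrite ffunE pair_lift mulKz. Qed.

Lemma expo_ofK v : (forall z, vdeg v z = 0) -> lift_expo (expo_of v) = v.
Proof.
move=> hv; rewrite [RHS](zero_degree_expand hm he hv).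
by apply: eq_bigr => i _; rewrite ffunE.
Qed.

Lemma Lam_epsv (i j : 'I_n) :
  Lam (epsv T (tnth e i)) (epsv T (tnth e j)) = 4 * eps T (tnth e j) (tnth e i).
Proof.
have /andP[hi _] := edge_internal i.
rewrite LamE wsum_restr (bigD1 (tnth e i)) //= big1 => [|c /andP[hc nc]].
  by rewrite pair_epsv ?edge_internal // eqxx addr0 mulrC.
by rewrite pair_epsv ?edge_internal // eq_sym (negbTE nc) mulr0.
Qed.

Lemma M_prod k (v : nat -> lattice T) :
  \prod_(i < k) M (v i) =
  omega ^ (- \sum_(j < k) \sum_(i < j) Lam (v i) (v j)) * M (\sum_(i < k) v i).
Proof.
elim: k => [|k IH]; first by rewrite !big_ord0 (frame0 hM) expr0z mul1r.
rewrite !big_ord_recr /= IH -mulrA (frameM hM) mulrA -(omegaD hM) opprD.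
congr (omega ^ (_ - _) * _).
by rewrite LamC !LamE wsum_suml -sumrN; apply: eq_bigr => i _; rewrite -LamE LamC opprK.
Qed.

Lemma q_exp z : q ^ z = omega ^ (4 * z).
Proof. by rewrite /q_of exprnP exprz_exp. Qed.

Lemma monomialE d : monomial X d = q ^ twist d * M (lift_expo d).
Proof.
(* [M_prod] takes a family indexed by all natural numbers, hence the default 0 beyond [n]. *)
pose v k : lattice T := if insub k is Some i then epsv T (tnth e i) *~ d i else 0.
have vE (i : 'I_n) : v i = epsv T (tnth e i) *~ d i by rewrite /v valK.
have -> : monomial X d = \prod_(i < n) M (v i).
  by apply: eq_bigr => i _; rewrite vE (M_mulrz hM).
have vS : \sum_(i < n) v i = lift_expo d by apply: eq_bigr => i _; rewrite vE.
rewrite M_prod vS q_exp; congr (omega ^ _ * _).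
rewrite /twist (exchange_big_dep predT) //= mulr_sumr -sumrN; apply: eq_bigr => j _.
rewrite (big_ord_widen n (fun i => Lam (v i) (v j)) (ltnW (ltn_ord j))).
rewrite mulr_sumr -sumrN; apply: eq_bigr => i _.
by rewrite !vE LamMzl LamMzr Lam_epsv (epsC T (tnth e j)); ring.
Qed.

Lemma qeval_lpoly (s : seq (int * expo n)) : qeval q X (lpoly s) =
  terms omega M [seq (4 * (p.1 + twist p.2), lift_expo p.2) | p <- s].
Proof.
rewrite /qeval mmap_lpoly /terms big_map; apply: eq_bigr => p _ /=.
by rewrite monomialE mulrA !q_exp -(omegaD hM) -mulrDr.
Qed.

(** Distinct pairs of a power of [q] and an exponent give distinct terms in the frame, so
    [terms_inj] applies. Statements about an arbitrary expansion [P] thus reduce to the one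
    constructed. *)
Lemma qeval_inj (P P' : {malg {malg int[int]}[expo n]}) :
  qeval q X P = qeval q X P' -> P = P'.
Proof.
have [s [t ->]] := lpoly_split P; have [s' [t' ->]] := lpoly_split P'.
pose g (p : int * expo n) := (4 * (p.1 + twist p.2), lift_expo p.2).
have g_inj : injective g.
  move=> [k d] [k' d'] [e1 e2]; have ed : d = d' by rewrite -[d]lift_expoK e2 lift_expoK.
  by rewrite ed in e1 *; move: e1 => /(mulfI (isT : 4 != 0 :> int))/addIr->.
rewrite /qeval !raddfB /= -!/(qeval _ _ _) !qeval_lpoly => E.
have /(terms_inj hM) : terms omega M (map g (s ++ t')) = terms omega M (map g (s' ++ t)).
  rewrite !map_cat !terms_cat; apply/eqP; rewrite -subr_eq addrAC.
  by rewrite [X in X + _]E subrK.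
move/(perm_map_inj g_inj)/perm_lpoly; rewrite /lpoly !big_cat /= => E'.
by apply/eqP; rewrite subr_eq addrAC -[X in _ == X - _]E' addrK.
Qed.

End Numbering.

Lemma lez_div4 (a b : int) : a <= b -> (a %/ 4 <= b %/ 4)%Z.
Proof. by lia. Qed.

(** * Positivity, classical limit and highest term *)

Section Properties.

Variables (m : nat) (F : unitRingType) (omega : F).
Variable M : forall T : triangulation m, lattice T -> F.
Hypothesis hM : quantum_frames omega M.
Hypothesis hm : (3 <= m)%N.

Local Notation q := (q_of omega).
Local Notation Iq := (Iq M).

Section Expansion.

Variables (T : triangulation m) (n : nat) (e : n.-tuple (chord m)).
Hypothesis he : numbering T e.

Local Notation X := (fun j : 'I_n => Xq M T (tnth e j)).
Local Notation lift_expo := (@lift_expo m T n e).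
Local Notation twist := (@twist m T n e).
Local Notation expo_of := (@expo_of m T n e).

(** In degree 0 the exponents of the [X_j] are the pairings divided by 4, so domination carries
    over. The highest term, with coefficient 1 in front of [M h], acquires [- twist a] when
    rewritten as an ordered monomial. *)
Lemma Iq_expansion (l : lamination m) :
  exists (s : seq (int * expo n)) (a : expo n),
  [/\ Iq l = qeval q X (lpoly s),
      forall (K : fieldType) (B : chord m -> K), ptolemy B ->
        (forall c, c \in val T -> B c != 0) ->
        \prod_c B c ^ val l c = \sum_(p <- s) cmon B (lift_expo p.2),
      forall p, p \in s -> forall j, p.2 j <= a j,
      (- twist a, a) \in s & count (fun p => p.2 == a) s = 1%N].
Proof.
have [s [e1 e2 e3 [h [h1 h2 h3]]]] := good_Iq hM hm T l.
have deg p : p \in s -> lift_expo (expo_of p.2) = p.2.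
  by move=> /e3[_ pd _]; apply: (expo_ofK hm he) => z; rewrite pd.
have hh := deg _ h2; rewrite /= in hh.
exists [seq ((p.1 %/ 4)%Z - twist (expo_of p.2), expo_of p.2) | p <- s], (expo_of h); split.
- rewrite (qeval_lpoly hM he) e1 -map_comp; congr terms; rewrite -[LHS]map_id.
  apply/eq_in_map => p hp /=; have [p4 _ _] := e3 _ hp.
  by rewrite subrK mulrC divzK // deg // -surjective_pairing.
- move=> K B pB nz; rewrite e2 // big_map big_seq [RHS]big_seq.
  by apply: eq_bigr => p hp; rewrite /= deg.
- move=> p /mapP[p0 hp ->] j /=; rewrite !ffunE.
  have /andP[hj _] := edge_internal he j.
  by have [_ _ /(_ _ hj)] := e3 _ hp; rewrite -h1 //; exact: lez_div4.
- by apply/mapP; exists (0, h); rewrite // div0z sub0r.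
- rewrite count_map -h3; apply: eq_in_count => p hp /=.
  by apply/eqP/eqP => [E|->//]; rewrite -(deg _ hp) E hh.
Qed.

Variables (T0 : triangulation m) (A : chord m -> ratfun T0).
Hypothesis hA : ptolemy_coordinates A.

Lemma coord_ptolemy : ptolemy A.
Proof. by move=> *; exact: (ptolemy_rel hA). Qed.

Lemma coord_nz c : A c != 0.
Proof. exact: (coord_chord_neq0 hM hm coord_ptolemy (ptolemy_var hA)). Qed.

Lemma cmonMz (v : lattice T) z : cmon A (v *~ z) = cmon A v ^ z.
Proof.
rewrite /cmon; elim/big_rec2: _ => [|i x y _ ->]; first by rewrite exp1rz.
by rewrite ffunMzE expfzMl exprz_exp mulrzz mulrC.
Qed.

Lemma cmon_epsv c : cmon A (epsv T c) = Xcl A T c.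
Proof. by apply: eq_bigr => i _; rewrite ffunE. Qed.

Local Notation Xc := (fun j : 'I_n => Xcl A T (tnth e j)).

Lemma monomial_cl d : monomial Xc d = cmon A (lift_expo d).
Proof.
rewrite /monomial /lift_expo; elim/big_rec2: _ => [|i x y _ ->]; first by rewrite cmon0.
by rewrite cmonD ?cmonMz ?cmon_epsv // => c _; exact: coord_nz.
Qed.

Lemma ceval_cpoly (s : seq (expo n)) :
  ceval Xc (cpoly s) = \sum_(d <- s) cmon A (lift_expo d).
Proof. by rewrite /ceval mmap_cpoly; apply: eq_bigr => d _; rewrite monomial_cl. Qed.

Lemma ceval_inj (P P' : {malg int[expo n]}) : ceval Xc P = ceval Xc P' -> P = P'.
Proof.
have [s [t ->]] := cpoly_split P; have [s' [t' ->]] := cpoly_split P'.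
rewrite /ceval !raddfB /= -!/(ceval _ _) !ceval_cpoly => E.
have /(monomials_inj hM hm hA) : \sum_(v <- map lift_expo (s ++ t')) cmon A v =
    \sum_(v <- map lift_expo (s' ++ t)) cmon A v.
  rewrite !map_cat !big_cat !big_map /=; apply/eqP; rewrite -subr_eq addrAC.
  by rewrite [X in X + _]E subrK.
move/(perm_map_inj (can_inj (lift_expoK he)))/perm_cpoly; rewrite /cpoly !big_cat /= => E'.
by apply/eqP; rewrite subr_eq addrAC -[X in _ == X - _]E' addrK.
Qed.

Lemma Icl_sum (l : lamination m) (s : seq (int * expo n)) :
  (forall (K : fieldType) (B : chord m -> K), ptolemy B ->
     (forall c, c \in val T -> B c != 0) ->
     \prod_c B c ^ val l c = \sum_(p <- s) cmon B (lift_expo p.2)) ->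
  Icl A l = \sum_(p <- s) cmon A (lift_expo p.2).
Proof. by move=> h; apply: h => [|c _]; [exact: coord_ptolemy | exact: coord_nz]. Qed.

Lemma Iq_positive (l : lamination m) : exists P : {malg {malg int[int]}[expo n]},
  (forall (d : expo n) (s : int), 0 <= P@_d@_s) /\ Iq l = qeval q X P.
Proof.
have [s [a [-> _ _ _ _]]] := Iq_expansion l; exists (lpoly s).
by split=> // d k; rewrite lpolyE ler0n.
Qed.

Lemma Iq_specialize (l : lamination m) (P : {malg {malg int[int]}[expo n]}) :
  Iq l = qeval q X P -> qeval 1 Xc P = Icl A l.
Proof.
have [s [a [e1 e2 _ _ _]]] := Iq_expansion l; rewrite e1 => /(qeval_inj hM he) <-.
rewrite (Icl_sum e2) /qeval mmap_lpoly; apply: eq_bigr => p _.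
by rewrite exp1rz mul1r monomial_cl.
Qed.

Lemma Iq_highest (l : lamination m) (P : {malg {malg int[int]}[expo n]})
    (Pcl : {malg int[expo n]}) :
  Iq l = qeval q X P -> Icl A l = ceval Xc Pcl ->
  exists a : expo n, (is_highest Pcl a /\ Pcl@_a = 1) /\ is_highest P a /\
    P@_a = << - twist a >>.
Proof.
have [s [a [e1 e2 e3 ha ca]]] := Iq_expansion l; rewrite e1 => /(qeval_inj hM he) <-.
have -> : Icl A l = ceval Xc (cpoly (map snd s)).
  by rewrite (Icl_sum e2) ceval_cpoly big_map.
move/ceval_inj => <-; exists a.
(* A single entry of the list has exponent [a], so its coefficient is one power of [q]. *)
have Pa : (lpoly s)@_a = << - twist a >>.
  apply/malgP => k; rewrite lpolyE mcoeffU.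
  have /permP -> := perm_to_rem ha; rewrite /= xpair_eqE eqxx andbT.
  have /eqP : count (fun p => p.2 == a) s = 1%N := ca.
  have /permP -> := perm_to_rem ha; rewrite /= eqxx add1n eqSS => /eqP c0.
  suff -> : count_mem (k, a) (rem (- twist a, a) s) = 0%N by rewrite addn0.
  apply/eqP; rewrite -leqn0 -c0; apply: sub_count => p /= /eqP->; exact: eqxx.
have cl1 : (cpoly (map snd s))@_a = 1.
  by rewrite cpolyE count_map (eq_count (a2 := fun p => p.2 == a)) ?ca.
have le d : d \in map snd s -> forall j, d j <= a j.
  by case/mapP=> p hp -> j; exact: e3.
split; [split=> //; split | split=> //; split].
- by rewrite cl1 oner_neq0.
- move=> d; rewrite cpolyE pnatr_eq0 -lt0n -has_count has_pred1; exact: le.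
- by rewrite Pa monalgU_eq0 oner_neq0.
- move=> d dn; apply: le; apply: contraNT dn => nd; apply/eqP/malgP => k.
  rewrite lpolyE mcoeff0; apply/eqP; rewrite pnatr_eq0 -leqn0 leqNgt -has_count has_pred1.
  by apply: contra nd => hk; apply/mapP; exists (k, d).
Qed.

End Expansion.

End Properties.

(** * Membership in the subalgebra, and its involution *)

Section Closure.

Variables (m : nat) (F : unitRingType) (omega : F).
Variable M : forall T : triangulation m, lattice T -> F.
Hypothesis hM : quantum_frames omega M.
Hypothesis hm : (3 <= m)%N.

Local Notation q := (q_of omega).
Local Notation in_Xalg := (in_Xalg omega M).

Lemma numbering_ex (T : triangulation m) :
  exists n (e : n.-tuple (chord m)), numbering T e.
Proof.
exists (size [seq c <- enum {: chord m} | internal T c]), (in_tuple _); split.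
  by rewrite /= filter_uniq // enum_uniq.
by move=> c; rewrite mem_filter mem_enum andbT.
Qed.

Lemma Xalg0 : in_Xalg 0.
Proof. by rewrite -(subrr 1); apply: XalgB; exact: Xalg1. Qed.

Lemma Xalg_exp x z : in_Xalg x -> in_Xalg (x ^ z).
Proof.
move=> hx; have nat_exp k : in_Xalg (x ^+ k).
  by elim: k => [|k IH]; [exact: Xalg1 | rewrite exprS; exact: XalgM].
by case: z => k; [exact: nat_exp | exact: XalgV].
Qed.

Lemma Xalg_M (T : triangulation m) (v : lattice T) :
  (forall z, vdeg v z = 0) -> in_Xalg (M v).
Proof.
move=> hv; have [n [e he]] := numbering_ex T.
rewrite -(expo_ofK hm he hv).
have -> : M (lift_expo T e (expo_of e v)) = q ^ (- twist T e (expo_of e v)) *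
    monomial (fun j => Xq M T (tnth e j)) (expo_of e v).
  by rewrite (monomialE hM he) mulrA !(q_exp omega) -(omegaD hM) mulrN addNr mul1r.
apply: XalgM; first exact/Xalg_exp/Xalg_q.
apply: (big_ind in_Xalg); [exact: Xalg1 | exact: XalgM | move=> i _].
by apply: Xalg_exp; apply: Xalg_gen; exact: edge_internal he i.
Qed.

Lemma restr_vdeg (T : triangulation m) (l : lamination m) z : carries T l ->
  vdeg (restr T (val l)) z = 0.
Proof.
move=> hT; rewrite /vdeg wsum_restr.
rewrite (big_sub (mem (val T)) (fun c => val l c * (incident z c)%:Z)).
exact: lamination_degree.
Qed.

Lemma Iq_Xalg l : in_Xalg (Iq M l).
Proof. by apply: Xalg_M => z; apply: restr_vdeg; exact: tri_of_carries. Qed.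

Lemma star_is_star (T : triangulation m) : is_star omega M (star hM T).
Proof.
split.
- move=> x; elim=> {x} [||T' j hj|x y _ hx _ hy|x y _ hx _ hy|x _ hx].
  + by rewrite star_one; exact: Xalg1.
  + by rewrite /q_of exprnP star_omega -invr_expz; apply: XalgV; exact: Xalg_q.
  + by rewrite /Xq star_frame; exact: Xalg_gen.
  + by rewrite star_add star_opp; exact: XalgB.
  + by rewrite star_mul; exact: XalgM.
  + by rewrite star_inv; exact: XalgV.
- exact: star_one.
- by move=> x y _ _; exact: star_add.
- by move=> x y _ _; exact: star_mul.
- by move=> x _; exact: star_invol.
- by rewrite /q_of exprnP star_omega -invr_expz.
- by move=> T' j _; exact: star_frame.
Qed.

Section AnyStar.

Variable st : F -> F.
Hypothesis hst : is_star omega M st.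

Lemma is_star_zero : st 0 = 0.
Proof.
have := Defs.starD hst Xalg0 Xalg0; rewrite addr0 => e.
by apply: (addrI (st 0)); rewrite -e addr0.
Qed.

Lemma is_star_inv x : in_Xalg x -> st x^-1 = (st x)^-1.
Proof.
move=> hx; have [->|x0] := eqVneq x 0; first by rewrite invr0 is_star_zero invr0.
have ux : x \is a GRing.unit := skew_field hM x0.
have e : st x * st x^-1 = 1.
  by rewrite -(Defs.starM hst) ?mulVr ?(Defs.star1 hst) //; exact: XalgV.
have n0 : st x != 0.
  by apply: contraTneq (oner_neq0 F) => e0; rewrite -e e0 mul0r eqxx.
by apply: (mulrI (skew_field hM n0)); rewrite e mulrV // (skew_field hM n0).
Qed.

Lemma is_star_exp x z : in_Xalg x -> st (x ^ z) = st x ^ z.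
Proof.
move=> hx; have nat_exp k : st (x ^+ k) = st x ^+ k.
  elim: k => [|k IH]; first by rewrite !expr0 (Defs.star1 hst).
  rewrite exprS (Defs.starM hst) ?IH -?exprSr //.
  by have := Xalg_exp k hx.
case: z => k; first exact: nat_exp.
by rewrite NegzE -!exprnN is_star_inv ?nat_exp //; have := Xalg_exp k.+1 hx.
Qed.

(** An abstract involution is controlled only on [q] and the [X_j]. In degree 0 this suffices: [Lam]
    is divisible by 4, so the factors from reordering are powers of [q], and the [X_j] generate. *)
Lemma is_star_M (T : triangulation m) (v : lattice T) :
  (forall z, vdeg v z = 0) -> st (M v) = M v.
Proof.
pose S (w : lattice T) := (forall z, vdeg w z = 0) /\ st (M w) = M w.
have S0 : S 0.
  by split=> [z|]; [rewrite /vdeg wsum0l | rewrite (frame0 hM) (Defs.star1 hst)].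
have SD u w : S u -> S w -> S (u + w).
  move=> [du su] [dw sw]; split=> [z|]; first by rewrite vdegD du dw addr0.
  have /dvdzP[k ek] := Lam_dvd4 w du.
  have uw : M (u + w) = q ^ k * (M u * M w).
    by rewrite (MD hM) mulrA ek mulrC (q_exp omega).
  have wu : M (u + w) = M w * M u * q ^ (- k).
    rewrite addrC (MD hM) LamC ek (q_exp omega) mulrN [4 * k]mulrC.
    by rewrite -[RHS](omegaXC hM) mulrA.
  have [Xu Xw] := (Xalg_M du, Xalg_M dw).
  have Xq : in_Xalg (q ^ k) by exact/Xalg_exp/Xalg_q.
  rewrite {1}uw !(Defs.starM hst) ?su ?sw ?is_star_exp ?(star_q hst) //; try exact: XalgM.
    by rewrite wu exprz_inv.
  exact: Xalg_q.
have SN u : S u -> S (- u).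
  move=> [du su]; split=> [z|]; first by have := du z; rewrite /vdeg wsumNl => ->; rewrite oppr0.
  by rewrite (MN hM) is_star_inv ?su //; exact: Xalg_M.
have SM u z : S u -> S (u *~ z).
  move=> hu; have aux (k : nat) : S (u *+ k).
    by elim: k => [|k IH]; rewrite ?mulr0n // mulrS; apply: SD.
  by case: z => k; [rewrite -pmulrn | rewrite NegzE mulrNz -pmulrn; apply: SN].
move=> hv; have [n [e he]] := numbering_ex T; rewrite -(expo_ofK hm he hv).
suff [] : S (lift_expo T e (expo_of e v)) by [].
apply: (big_ind S) => // i _; apply: SM; split; first by move=> z; exact: vdeg_epsv (edge_internal he i).
exact: (star_X hst (edge_internal he i)).
Qed.

Lemma is_star_Iq l : st (Iq M l) = Iq M l.
Proof. by apply: is_star_M => z; apply: restr_vdeg; exact: tri_of_carries. Qed.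

End AnyStar.

End Closure.

(** * Products *)

Section Resolution.

(** A chord crossing two opposite sides crosses both diagonals; one crossing a single side separates
    two consecutive corners and so meets at least one diagonal. *)
Lemma xing_resolve0 (a s b t q : nat) : ccw a s b -> ccw b t a -> (0 < q)%N ->
  (xing a s 0 q + xing b t 0 q <= xing a b 0 q + xing s t 0 q)%N.
Proof.
move=> asb bta q0; rewrite !xing_signs.
move: asb bta; rewrite /ccw => asb bta.
case: (ltngtP a q) => ha; case: (ltngtP s q) => hs; case: (ltngtP b q) => hb;
  case: (ltngtP t q) => ht; rewrite ?andbF ?andbT ?orbF //=;
  case: (posnP a) => ha0; case: (posnP s) => hs0; case: (posnP b) => hb0;
  case: (posnP t) => ht0 //=; exfalso;
  by move: asb bta ha hs hb ht ha0 hs0 hb0 ht0 q0; clear; lia.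
Qed.

Variable m : nat.
Implicit Types (c d x : chord m).

Lemma crosses_resolve k k' c1 c3 (a s b t : 'I_m) x : joins k a b -> joins k' s t ->
  joins c1 a s -> joins c3 b t -> ccw a s b -> ccw b t a ->
  (crosses c1 x + crosses c3 x <= crosses k x + crosses k' x)%N.
Proof.
have jx := joins_ends x; move: (val x).1 (val x).2 jx => p q jx.
move=> jk jk' j1 j3; have nq := joins_neq jx; rewrite -(offset_gt0 p) in nq.
rewrite (crossesE jk jx) (crossesE jk' jx) (crossesE j1 jx) (crossesE j3 jx).
rewrite !(xing_off p) !(ccw_off p) offsetvv => asb bta; exact: xing_resolve0.
Qed.

End Resolution.

(** * Words in chord variables and resolution of crossings *)

Section Words.

Variables (m : nat) (F : unitRingType) (omega : F).
Variable M : forall T : triangulation m, lattice T -> F.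
Hypothesis hM : quantum_frames omega M.
Hypothesis hm : (3 <= m)%N.

Local Notation Aq := (Aq M).
Local Notation Iq := (Iq M).

Implicit Types (T : triangulation m) (c d x : chord m) (r : seq (chord m)).
Implicit Types (f g : chord m -> int).

Definition word r : F := \prod_(c <- r) Aq c.

Lemma word_cat r r' : word (r ++ r') = word r * word r'.
Proof. exact: big_cat. Qed.

Lemma word_cons c r : word (c :: r) = Aq c * word r.
Proof. exact: big_cons. Qed.

(** Each crossing is counted twice, once for each order of the two chords. *)
Definition crossing_number r : nat := \sum_(c <- r) \sum_(d <- r) crosses c d.

Lemma crossing_number_perm r r' : perm_eq r r' -> crossing_number r = crossing_number r'.
Proof.
move=> e; rewrite /crossing_number (perm_big _ e); apply: eq_bigr => c _.
exact: perm_big.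
Qed.

Lemma crossing_number_cons c r :
  crossing_number (c :: r) = (2 * (\sum_(d <- r) crosses c d) + crossing_number r)%N.
Proof.
rewrite /crossing_number big_cons big_cons crosses_irr add0n.
under [X in (_ + X)%N]eq_bigr do rewrite big_cons crossesC.
by rewrite big_split /= addnA addnn mul2n.
Qed.

Definition planar r : Prop := forall c d, c \in r -> d \in r -> crosses c d = false.

Lemma crossing_number0 r : crossing_number r = 0%N -> planar r.
Proof.
move=> /eqP; rewrite sum_nat_seq_eq0 => /allP h c d /h /=.
by rewrite sum_nat_seq_eq0 => /allP h' /h' /=; case: crosses.
Qed.

Lemma planar_tri r : planar r -> exists T, {subset r <= val T}.
Proof.
move=> pr; have hS : noncrossing [set c in r].
  by apply/noncrossingP => c d; rewrite !inE; exact: pr.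
have [T /subsetP sT] := tri_ext hS; exists T => c hc; apply: sT; by rewrite inE.
Qed.

Lemma Aq_commute c d : crosses c d = false ->
  exists n, Aq c * Aq d = omega ^ n * (Aq d * Aq c).
Proof.
move=> cd; have [|T sT] := @planar_tri [:: c; d].
  by move=> u v; rewrite !inE => /orP[]/eqP-> /orP[]/eqP->; rewrite ?crosses_irr // crossesC.
have [hc hd] : c \in val T /\ d \in val T by rewrite !sT // !inE eqxx ?orbT.
rewrite -!(AqE hM hc) -!(AqE hM hd) !(frameM hM) addrC.
exists (Lam (basis T d) (basis T c) - Lam (basis T c) (basis T d)).
by rewrite mulrA -(omegaD hM); congr (omega ^ _ * _); ring.
Qed.

Lemma word_pull r c r' : (forall d, d \in r -> crosses c d = false) ->
  exists n, word (r ++ c :: r') = omega ^ n * word (c :: r ++ r').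
Proof.
elim: r => [|d r IH] h; first by exists 0; rewrite expr0z mul1r.
have [n e] : exists n, word (r ++ c :: r') = omega ^ n * word (c :: r ++ r').
  by apply: IH => x hx; apply: h; rewrite inE hx orbT.
have [n' e'] := Aq_commute (etrans (crossesC d c) (h d (mem_head _ _))).
exists (n + n'); rewrite !word_cons [in LHS]/= e word_cons.
rewrite mulrA -(omegaXC hM) -mulrA (mulrA (Aq d)) e' (omegaD hM) -!mulrA.
by [].
Qed.

(** Take a crossing whose first letter is as far right as possible: the letters after it form a
    planar word, hence commute up to powers of [omega], and the second letter can be pulled next to
    it. *)
Lemma word_crossing r : crossing_number r != 0%N ->
  exists n r1 c d r2, [/\ crosses c d, perm_eq r (r1 ++ c :: d :: r2) &
    word r = omega ^ n * word (r1 ++ c :: d :: r2)].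
Proof.
elim: r => [|c r IH]; first by rewrite /crossing_number big_nil.
have [n0|n0] := eqVneq (crossing_number r) 0%N.
  rewrite crossing_number_cons n0 addn0 muln_eq0 /= sum_nat_seq_neq0.
  case/hasP => d hd cd; have pr := crossing_number0 n0.
  have cd' : crosses c d by move: cd; case: crosses.
  case/splitPr: hd pr => r1 r2 pr.
  have [n e] : exists n, word (r1 ++ d :: r2) = omega ^ n * word (d :: r1 ++ r2).
    by apply: word_pull => x hx; apply: pr; rewrite mem_cat ?mem_head ?hx ?orbT.
  exists n, [::], c, d, (r1 ++ r2); split=> //.
    by rewrite perm_cons -cat1s perm_catCA.
  by rewrite word_cons e mulrA -(omegaXC hM) -mulrA -word_cons.
have [n [r1 [c' [d' [r2 [cd e1 e2]]]]]] := IH n0 => _.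
exists n, (c :: r1), c', d', r2; split=> //; first by rewrite perm_cons.
by rewrite word_cons e2 mulrA -(omegaXC hM) -mulrA -word_cons.
Qed.

(** The quantum Ptolemy relation for [d], multiplied by the variable of [c], which cancels the
    denominator. *)
Lemma resolve_crossing c d : crosses c d ->
  exists n1 n2 c1 c2 c3 c4, [/\
    Aq c * Aq d = omega ^ n1 * (Aq c1 * Aq c3) + omega ^ n2 * (Aq c2 * Aq c4),
    crosses c1 c3 = false /\ crosses c2 c4 = false,
    forall x, (crosses c1 x + crosses c3 x <= crosses c x + crosses d x)%N /\
              (crosses c2 x + crosses c4 x <= crosses c x + crosses d x)%N &
    forall z, ((incident z c1)%:Z + (incident z c3)%:Z = (incident z c)%:Z + (incident z d)%:Z) /\
              ((incident z c2)%:Z + (incident z c4)%:Z = (incident z c)%:Z + (incident z d)%:Z)].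
Proof.
have jc := joins_ends c; have [s [t [jd h]]] : exists s t, joins d s t /\
    (crosses c d -> ccw (val c).1 s (val c).2 /\ ccw (val c).2 t (val c).1).
  have jd := joins_ends d.
  have [/andP[h1 h2]|h] := boolP (ccw (val c).1 (val d).1 (val c).2 && ccw (val c).2 (val d).2 (val c).1).
    by exists (val d).1, (val d).2.
  exists (val d).2, (val d).1; rewrite joinsC; split=> //.
  by rewrite (crossesE jc jd) /xing (negbTE h) => /andP[].
move=> /h[asb bta]; move: (val c).1 (val c).2 jc asb bta => a b jc asb bta.
have [[n1 n2] [n3 n4]] : (a != s /\ s != b) /\ (b != t /\ t != a).
  by move: asb bta; rewrite -!val_eqE /= /ccw; clear; lia.
have [c1 j1] := chord_ex n1; have [c2 j2] := chord_ex n2.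
have [c3 j3] := chord_ex n3; have [c4 j4] := chord_ex n4.
have [T [sq e]] := quantum_ptolemy hM jc jd j1 j2 j3 j4 asb bta.
have [_ _ [hc h1 h2 h3 h4] _] := sq.
have E c' c'' : c' \in val T -> c'' \in val T ->
    exists n, Aq c * M (basis T c' + basis T c'' - basis T c) = omega ^ n * (Aq c' * Aq c'').
  move=> hc' hc''; rewrite -(AqE hM hc) -(AqE hM hc') -(AqE hM hc'').
  rewrite !(frameM hM) subrKC.
  exists (- Lam (basis T c) (basis T c' + basis T c'' - basis T c) +
          Lam (basis T c') (basis T c'')).
  by rewrite mulrA -(omegaD hM) addrK.
have [m1 e1] := E _ _ h1 h3; have [m2 e2] := E _ _ h2 h4.
exists m1, m2, c1, c2, c3, c4; split.
- by rewrite e mulrDr e1 e2.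
- by split; [exact: tri_ncr h1 h3 | exact: tri_ncr h2 h4].
- move=> x; split; first exact: crosses_resolve jc jd j1 j3 asb bta.
  have jc' := jc; rewrite joinsC in jc'; rewrite [X in (_ <= X)%N]addnC.
  have sbt : ccw s b t by move: asb bta; clear; rewrite /ccw; lia.
  have tas : ccw t a s by move: asb bta; clear; rewrite /ccw; lia.
  by apply: (crosses_resolve x jd jc' j2 j4 sbt tas).
- have inc (u : chord m) (v w z : 'I_m) : joins u v w -> (incident z u)%:Z = (z == v)%:Z + (z == w)%:Z :> int.
    move=> ju; rewrite (incidentE _ ju); have := joins_neq ju.
    by case: (eqVneq z v) => [->|] //; case: (eqVneq v w).
  move=> z; rewrite (inc _ _ _ z jc) (inc _ _ _ z jd) (inc _ _ _ z j1) (inc _ _ _ z j2).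
  by rewrite (inc _ _ _ z j3) (inc _ _ _ z j4); split; ring.
Qed.

Definition word_degree r (z : 'I_m) : int := \sum_(c <- r) (incident z c)%:Z.

(** Resolving removes the crossing of [c] with [d] and creates none with the other letters, so the
    crossing number decreases, while the degrees are preserved. *)
Lemma word_expansion r : exists t : seq (int * seq (chord m)),
  word r = \sum_(p <- t) omega ^ p.1 * word p.2 /\
  forall p, p \in t -> planar p.2 /\ forall z, word_degree p.2 z = word_degree r z.
Proof.
have [k] := ubnP (crossing_number r); elim: k => // k IH in r *; rewrite ltnS => hk.
have [n0|n0] := eqVneq (crossing_number r) 0%N.
  exists [:: (0, r)]; rewrite big_seq1 expr0z mul1r; split=> // p; rewrite inE => /eqP->.
  by split=> //; exact: crossing_number0.
have [n [r1 [c [d [r2 [cd pr er]]]]]] := word_crossing n0.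
have [n1 [n2 [c1 [c2 [c3 [c4 [e [x1 x2] cr deg]]]]]]] := resolve_crossing cd.
have part u v n' : crosses u v = false ->
    (forall x, (crosses u x + crosses v x <= crosses c x + crosses d x)%N) ->
    (forall z, (incident z u)%:Z + (incident z v)%:Z = (incident z c)%:Z + (incident z d)%:Z :> int) ->
    exists t : seq (int * seq (chord m)),
      omega ^ n' * word (r1 ++ u :: v :: r2) = \sum_(p <- t) omega ^ p.1 * word p.2 /\
      forall p, p \in t -> planar p.2 /\ forall z, word_degree p.2 z = word_degree r z.
  move=> uv hx hz; have [|t [et ht]] := IH (r1 ++ u :: v :: r2).
    apply: leq_trans hk; rewrite (crossing_number_perm pr).
    have mv a b : perm_eq (r1 ++ a :: b :: r2) (a :: b :: r1 ++ r2).
      by rewrite -(cat1s a) -(cat1s b) perm_catCA /= perm_cons -cat1s perm_catCA.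
    rewrite !(crossing_number_perm (mv _ _)) !crossing_number_cons !big_cons uv cd.
    have : (\sum_(x <- r1 ++ r2) crosses u x + \sum_(x <- r1 ++ r2) crosses v x <=
        \sum_(x <- r1 ++ r2) crosses c x + \sum_(x <- r1 ++ r2) crosses d x)%N.
      by rewrite -!big_split; apply: leq_sum => x _.
    by move: (crossing_number _); clear => N; lia.
  exists [seq (n' + p.1, p.2) | p <- t]; rewrite big_map et mulr_sumr; split.
    by apply: eq_bigr => p _; rewrite (omegaD hM) mulrA.
  move=> p /mapP[p0 /ht[h1 h2] ->]; split=> // z; rewrite h2 /word_degree.
  rewrite [RHS](perm_big _ pr) !big_cat !big_cons /=; congr (_ + _).
  by rewrite !addrA hz.
have [t1 [et1 ht1]] := part _ _ (n + n1) x1 (fun x => proj1 (cr x)) (fun z => proj1 (deg z)).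
have [t2 [et2 ht2]] := part _ _ (n + n2) x2 (fun x => proj2 (cr x)) (fun z => proj2 (deg z)).
exists (t1 ++ t2); split; last by move=> p; rewrite mem_cat => /orP[/ht1|/ht2].
have sh k' (x y : F) : omega ^ (n + k') * (x * y) = omega ^ n * (x * (omega ^ k' * y)).
  by rewrite (omegaD hM) -mulrA; congr (_ * _); rewrite !mulrA (omegaXC hM).
rewrite big_cat -et1 -et2 er !word_cat !word_cons (mulrA (Aq c)) e mulrDl !mulrDr.
by rewrite !sh -!mulrA.
Qed.

Lemma word_restr T r : {subset r <= val T} ->
  exists n, word r = omega ^ n * M (restr T (fun c => (count_mem c r)%:Z)).
Proof.
elim: r => [|c r IH] hr.
  exists 0; rewrite expr0z mul1r /word big_nil -(frame0 hM T); apply: (congr1 (@M T)).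
  by apply/ffunP => i; rewrite !ffunE.
have [n e] : exists n, word r = omega ^ n * M (restr T (fun c => (count_mem c r)%:Z)).
  by apply: IH => d hd; apply: hr; rewrite inE hd orbT.
have hc : c \in val T by apply: hr; exact: mem_head.
pose v := restr T (fun c => (count_mem c r)%:Z).
exists (n - Lam (basis T c) v); rewrite word_cons e mulrA -(omegaXC hM) -mulrA.
rewrite -(AqE hM hc) (frameM hM) mulrA -(omegaD hM); congr (_ * _); apply: (congr1 (@M T)).
by apply/ffunP => i; rewrite !ffunE /= PoszD eq_sym natz.
Qed.

Definition word_of f : seq (chord m) :=
  flatten [seq nseq (absz (f c)) c | c <- enum {: chord m}].

Lemma count_word_of f c : count_mem c (word_of f) = absz (f c).
Proof.
rewrite /word_of count_flatten -map_comp sumnE big_map big_enum /=.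
rewrite (bigD1 c) //= count_nseq /= eqxx mul1n big1 ?addn0 // => d nd.
by rewrite count_nseq /= (negbTE nd).
Qed.

Lemma mem_word_of f c : c \in word_of f -> f c != 0.
Proof. by rewrite -has_pred1 has_count count_word_of absz_gt0. Qed.

Lemma M_mulE T (u v : lattice T) : exists n, M u * M v = omega ^ n * M (u + v).
Proof. by exists (- Lam u v); rewrite (frameM hM). Qed.

(* Multiplying by boundary monomials, which belong to every frame, makes all  *)
(* weights nonnegative.                                                       *)
Lemma Iq_word (l : lamination m) (b : chord m -> int) :
  (forall c, ~~ boundary c -> b c = 0) -> (forall c, 0 <= val l c + b c) ->
  exists n T, [/\ {subset word_of (fun c => val l c + b c) <= val T} &
    Iq l = omega ^ n * (M (restr T (fun c => - b c)) *
      word (word_of (fun c => val l c + b c)))].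
Proof.
move=> hb pos; pose T := tri_of (lamination_noncrossing l).
have sT : {subset word_of (fun c => val l c + b c) <= val T}.
  move=> c /mem_word_of; have [bc _|nb] := boolP (boundary c); first exact: boundary_tri.
  by rewrite hb // addr0; exact: tri_of_carries.
have [n e] := word_restr sT.
have [n' e'] := M_mulE (restr T (fun c => - b c))
  (restr T (fun c => (count_mem c (word_of (fun c => val l c + b c)))%:Z)).
exists (- n' - n), T; split=> //.
rewrite e (mulrA (M _)) -(omegaXC hM) -mulrA e' !mulrA -!(omegaD hM).
have -> : - n' - n + n + n' = 0 by ring.
rewrite expr0z mul1r; apply: (congr1 (@M T)); apply/ffunP => i; rewrite !ffunE count_word_of.
by rewrite gez0_abs //; ring.
Qed.

End Words.

Section Products.

Variables (m : nat) (F : unitRingType) (omega : F).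
Variable M : forall T : triangulation m, lattice T -> F.
Hypothesis hM : quantum_frames omega M.
Hypothesis hm : (3 <= m)%N.

Local Notation q := (q_of omega).
Local Notation Iq := (Iq M).
Local Notation word := (word M).

Implicit Types (T : triangulation m) (c d : chord m) (r : seq (chord m)).

Lemma word_degreeE r z :
  word_degree r z = \sum_(c | incident z c) (count_mem c r)%:Z.
Proof.
elim: r => [|d r IH]; first by rewrite /word_degree big_nil big1.
rewrite /word_degree big_cons -/(word_degree r z) IH [RHS]big_mkcond.
rewrite [in LHS]big_mkcond (bigD1 d) //= [RHS](bigD1 d) //= eqxx.
rewrite addrA; congr (_ + _); first by case: incident; rewrite ?PoszD.
by apply: eq_bigr => c nc; rewrite eq_sym (negbTE nc).
Qed.

Lemma M_boundary T T' (b : chord m -> int) : (forall c, ~~ boundary c -> b c = 0) ->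
  M (restr T b) = M (restr T' b).
Proof.
by move=> hb; apply: (M_restr hM) => c bc; apply: boundary_tri;
  apply: contraNT bc => /hb->.
Qed.

(** The weights are [b] plus the multiplicities in [r]. Boundary chords cross nothing, and off the
    boundary the weights are multiplicities, so the conditions on a lamination hold. *)
Lemma planar_word_Iq r (b : chord m -> int) T : planar r ->
  (forall c, ~~ boundary c -> b c = 0) ->
  (forall z, word_degree r z + \sum_(c | incident z c) b c = 0) ->
  exists n l, M (restr T b) * word r = omega ^ n * Iq l.
Proof.
move=> pr hb deg; pose w := [ffun c => b c + (count_mem c r)%:Z].
have w0 c : w c != 0 -> boundary c \/ c \in r.
  rewrite ffunE; have [bc _|/hb->] := boolP (boundary c); first by left.
  by rewrite add0r eqz_nat -lt0n -has_count has_pred1; right.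
have hw : is_lamination w.
  apply/and3P; split.
  - apply/noncrossingP => c d; rewrite !inE => /w0[bc|cr] /w0[bd|dr].
    + exact: boundary_ncr.
    + exact: boundary_ncr.
    + by rewrite crossesC boundary_ncr.
    + exact: pr.
  - apply/forallP => c; apply/implyP => /andP[wc nb]; rewrite lt_neqAle eq_sym wc /=.
    by rewrite ffunE hb.
  - apply/forallP => z; under eq_bigr do rewrite ffunE.
    by rewrite big_split /= -word_degreeE addrC deg.
have [T1 sT1] := planar_tri pr.
have cT1 : carries T1 (exist _ w hw).
  by move=> c /w0[/boundary_tri->|/sT1].
have [n e] := word_restr hM sT1; have [n' e'] := M_mulE hM (restr T1 b)
  (restr T1 (fun c => (count_mem c r)%:Z)).
exists (n + n'), (exist _ w hw); rewrite (IqE hM cT1) e (M_boundary T T1 hb).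
rewrite mulrA -(omegaXC hM) -mulrA e' mulrA -(omegaD hM); congr (_ * _).
by apply: (congr1 (@M T1)); apply/ffunP => i; rewrite !ffunE.
Qed.

Lemma Iq_product (l l' : lamination m) : exists t : seq (int * lamination m),
  Iq l * Iq l' = \sum_(p <- t) omega ^ p.1 * Iq p.2.
Proof.
(* One shift large enough for both laminations, so that the two boundary corrections coincide. *)
pose b c : int := if boundary c then `|val l c| + `|val l' c| else 0.
have hb c : ~~ boundary c -> b c = 0 by rewrite /b => /negbTE->.
have posl c : 0 <= val l c + b c.
  by rewrite /b; case: ifPn => [_|nb]; rewrite ?addr_norm_ge0 // addr0 lamination_ge0.
have posl' c : 0 <= val l' c + b c.
  rewrite /b; case: ifPn => [_|nb]; last by rewrite addr0 lamination_ge0.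
  by rewrite [`|_| + _]addrC addr_norm_ge0.
have hNb c : ~~ boundary c -> - b c = 0 by move=> /hb->; rewrite oppr0.
have [n [T [sT e]]] := Iq_word hM hb posl.
have [n' [T' [sT' e']]] := Iq_word hM hb posl'.
set r := word_of _ in sT e; set r' := word_of _ in sT' e'.
pose v := restr T (fun c => - b c).
have [k ek] : exists k, word r * M v = omega ^ k * (M v * word r).
  have [k1 ->] := word_restr hM sT; set u := restr T _.
  exists (- Lam u v + Lam v u).
  rewrite -mulrA !(frameM hM) addrC (mulrA (M v)) -(omegaXC hM) -mulrA.
  rewrite (frameM hM) !mulrA -!(omegaD hM) addrC; congr (omega ^ _ * _); ring.
have [k2 ek2] := M_mulE hM v v.
have vv : v + v = restr T (fun c => - b c - b c) by apply/ffunP => i; rewrite !ffunE.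
have hb2 c : ~~ boundary c -> - b c - b c = 0 by move=> /hb->; rewrite oppr0 addr0.
have prod : Iq l * Iq l' = omega ^ (n + n' + k + k2) *
    (M (restr T (fun c => - b c - b c)) * word (r ++ r')).
  rewrite e e' (M_boundary T' T hNb) -/v -vv word_cat.
  have -> : omega ^ n * (M v * word r) * (omega ^ n' * (M v * word r')) =
      omega ^ (n + n') * (M v * (word r * M v) * word r').
    rewrite (omegaD hM) -!mulrA; congr (_ * _).
    by rewrite !mulrA -(omegaXC hM n' (M v * word r)) !mulrA.
  rewrite ek (mulrA (M v)) -(omegaXC hM k) -!mulrA (mulrA (M v) (M v)) ek2.
  by rewrite !mulrA -!(omegaD hM).
have [t [et ht]] := word_expansion hM (r ++ r').
have deg p : p \in t -> forall z,
    word_degree p.2 z + \sum_(c | incident z c) (- b c - b c) = 0.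
  move=> /ht[_ h] z; rewrite h word_degreeE -big_split /=.
  transitivity (\sum_(c | incident z c) (val l c + val l' c)).
    2: by rewrite big_split /= !lamination_vertex addr0.
  apply: eq_bigr => c _.
  by rewrite count_cat PoszD !count_word_of !gez0_abs //; ring.
have : exists t' : seq (int * lamination m),
    M (restr T (fun c => - b c - b c)) * (\sum_(p <- t) omega ^ p.1 * word p.2) =
    \sum_(p <- t') omega ^ p.1 * Iq p.2.
  elim: t {et} ht deg => [|p t IH] ht deg.
    by exists [::]; rewrite !big_nil mulr0.
  have sub p' : p' \in t -> p' \in p :: t by move=> h; rewrite inE h orbT.
  have [t' et'] := IH (fun p' h => ht p' (sub p' h)) (fun p' h => deg p' (sub p' h)).
  have [pp _] := ht _ (mem_head _ _).
  have [n1 [l1 e1]] := planar_word_Iq T pp hb2 (deg _ (mem_head _ _)).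
  exists ((p.1 + n1, l1) :: t'); rewrite !big_cons mulrDr et'; congr (_ + _).
  by rewrite mulrA -(omegaXC hM) -mulrA e1 mulrA -(omegaD hM).
rewrite -et => -[t' et']; exists [seq (n + n' + k + k2 + p.1, p.2) | p <- t'].
rewrite prod et' big_map mulr_sumr; apply: eq_bigr => p _.
by rewrite mulrA -(omegaD hM).
Qed.

(* Both sides are sums of monomials with coefficients powers of omega, so     *)
(* nothing cancels: the powers of omega occurring on the right are those on   *)
(* the left, and therefore powers of q.                                       *)
Lemma Iq_structure_constants (l l' : lamination m) :
  exists c : {malg {malg int[int]}[lamination m]},
    Iq l * Iq l' = mmap (laurent_at q) Iq c.
Proof.
have [t et] := Iq_product l l'.
pose T := tri_of (lamination_noncrossing l).
(* Each entry of [t] leaves in [R] a trace with the same power of [omega] modulo 4, namely its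
   highest term. *)
have [R [eR hR]] : exists R : seq (int * lattice T),
    \sum_(p <- t) omega ^ p.1 * Iq p.2 = terms omega M R /\
    forall p, p \in t -> exists2 x, x \in R & (4 %| x.1 - p.1)%Z.
  elim: (t) => [|p t' [R [eR hR]]]; first by exists [::]; rewrite big_nil terms_nil.
  have [s [e1 _ e3 [h [_ h2 _]]]] := good_Iq hM hm T p.2.
  exists (shift p.1 s ++ R); rewrite big_cons terms_cat (terms_shift hM) -e1 eR.
  split=> // p'; rewrite inE => /orP[/eqP->|/hR[x hx px]].
    exists (p.1 + 0, h); last by rewrite /= addr0 subrr dvdz0.
    by rewrite mem_cat; apply/orP; left; apply/mapP; exists (0, h).
  by exists x => //; rewrite mem_cat hx orbT.
have [s [e1 _ e3 _]] := good_Iq hM hm T l; have [s' [e1' _ e3' _]] := good_Iq hM hm T l'.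
have /perm_mem eq_R : perm_eq R (qmul s s').
  by apply: (terms_inj hM); rewrite -eR -et e1 e1' (terms_mul hM).
have dvd p : p \in t -> (4 %| p.1)%Z.
  move=> /hR[x]; rewrite eq_R => /allpairsP[[a b] /= [/e3[a1 a2 _] /e3'[b1 _ _] ->]] h.
  have -> : p.1 = a.1 + b.1 - Lam a.2 b.2 - (a.1 + b.1 - Lam a.2 b.2 - p.1) by ring.
  by apply: dvdzB h; apply: dvdzB; [exact: dvdzD | exact: Lam_dvd4].
exists (lpoly [seq ((p.1 %/ 4)%Z, p.2) | p <- t]).
rewrite mmap_lpoly big_map et big_seq [RHS]big_seq; apply: eq_bigr => p /dvd p4.
by rewrite (q_exp omega) mulrC divzK.
Qed.

End Products.

Theorem theorem1p1 (m : nat) (hm : (3 <= m)%N)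
  (F : unitRingType) (omega : F)
  (M : forall T : triangulation m, lattice T -> F)
  (hM : quantum_frames omega M)
  (T0 : triangulation m) (A : chord m -> ratfun T0)
  (hA : ptolemy_coordinates A) :
  let q := q_of omega in
  exists Iq : lamination m -> F,
    is_duality_map M Iq /\
    (forall l, in_Xalg omega M (Iq l)) /\
    (* 1 *)
    (forall (T : triangulation m) (n : nat) (e : n.-tuple (chord m)),
      numbering T e -> forall l,
      exists P : {malg {malg int[int]}[expo n]},
        (forall (d : expo n) (s : int), 0 <= P@_d@_s) /\
        Iq l = qeval q (fun j => Xq M T (tnth e j)) P) /\
    (* 2 *)
    (forall (T : triangulation m) (n : nat) (e : n.-tuple (chord m)),
      numbering T e -> forall l (P : {malg {malg int[int]}[expo n]}),
      Iq l = qeval q (fun j => Xq M T (tnth e j)) P ->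
      qeval 1 (fun j => Xcl A T (tnth e j)) P = Icl A l) /\
    (* 3 *)
    ((exists star : F -> F, is_star omega M star) /\
     (forall star : F -> F, is_star omega M star ->
        forall l, star (Iq l) = Iq l)) /\
    (* 4 *)
    (forall (T : triangulation m) (n : nat) (e : n.-tuple (chord m)),
      numbering T e ->
      forall l (P : {malg {malg int[int]}[expo n]}) (Pcl : {malg int[expo n]}),
      Iq l = qeval q (fun j => Xq M T (tnth e j)) P ->
      Icl A l = ceval (fun j => Xcl A T (tnth e j)) Pcl ->
      exists a : expo n,
        (is_highest Pcl a /\ Pcl@_a = 1) /\
        is_highest P a /\
        P@_a = << - \sum_(i < n) \sum_(j < n | (i < j)%N)
                      eps T (tnth e i) (tnth e j) * a i * a j >>) /\
    (* 5 *)
    (forall l l' : lamination m,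
      exists c : {malg {malg int[int]}[lamination m]},
        Iq l * Iq l' = mmap (laurent_at q) Iq c).
Proof.
exists (Iq M); split; first exact: Iq_duality_map hM.
split; first exact: Iq_Xalg hM hm.
split; first by move=> T n e he l; exact: (Iq_positive hM hm he).
split; first by move=> T n e he l P; exact: (Iq_specialize hM hm he hA).
split.
  split; first by exists (star hM T0); exact: star_is_star.
  by move=> st hst l; exact: (is_star_Iq hM hm hst).
split; last exact: Iq_structure_constants hM hm.
by move=> T n e he l P Pcl; exact: (Iq_highest hM hm he hA).
Qed.
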